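(* Let $Q(x)=(q_{jk}(x))$ be a $4\times4$ Hermitian matrix-valued $C^1$ function on $\mathbf R^3$ for which there exist positive constants $\epsilon$ and $K$ such that $$\langle x\rangle^{1+\epsilon}|q_{jk}(x)|+\sum_{\ell=1}^3\Big|\frac{\partial q_{jk}}{\partial x_\ell}(x)\Big|\le K\qquad (x\in\mathbf R^3,\ j,k=1,2,3,4),$$ and let $s>1/2$. For real $t$ let $H_t=-i\sum_{j=1}^3\alpha_j\frac{\partial}{\partial x_j}+\beta+tQ(x)$, with extended resolvents $R_t^{\pm}(\lambda)$ for real $\lambda$, $|\lambda|>1$. Then there exist constants $t_0>0$ and $C>0$ such that for every real $t$ with $|t|\le t_0$: (i) $\displaystyle\sup_{|\lambda|\ge2}\|R_t^{\pm}(\lambda)\|_{(s,-s)}\le C$; (ii) $R_t^{\pm}(\lambda)$ converge strongly to $0$ as $|\lambda|\to\infty$ (that is, for every $f\in\mathcal L_{2,s}$, $R_t^{\pm}(\lambda)f\to0$ in $\mathcal L_{2,-s}$ as $|\lambda|\to\infty$).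
   Context: Notation: $\langle x\rangle = \sqrt{1+|x|^2}$. For $s\in\mathbf R$, $L_{2,s}(\mathbf R^3)=\{f : \langle x\rangle^s f\in L_2(\mathbf R^3)\}$ with norm $\|f\|_s = \big(\int_{\mathbf R^3}\langle x\rangle^{2s}|f(x)|^2dx\big)^{1/2}$, and $\mathcal L_{2,s}=[L_{2,s}(\mathbf R^3)]^4$ is the Hilbert space direct sum, with norm again denoted $\|\cdot\|_s$; $\mathcal L_2=\mathcal L_{2,0}$. For a bounded linear operator $T:\mathcal L_{2,s}\to\mathcal L_{2,t}$, $\|T\|_{(s,t)}$ denotes its operator norm. Dirac matrices: $\alpha_1,\alpha_2,\alpha_3$ and $\alpha_4=\beta$ are $4\times4$ Hermitian matrices with $\alpha_j\alpha_k+\alpha_k\alpha_j=2\delta_{jk}I$ for $j,k=1,2,3,4$. For $t\in\mathbf R$ and $Q$ as in the claim, $H_t$ denotes the selfadjoint operator in $\mathcal L_2$ with domain $[H^1(\mathbf R^3)]^4$ (the selfadjoint extension of the essentially selfadjoint restriction of the differential expression to $[C_0^\infty(\mathbf R^3)]^4$), and $R_t(z)=(H_t-z)^{-1}$. Extended resolvents (limiting absorption principle, known, due to Yamada): if $Q(x)=(q_{jk}(x))$ is a $4\times4$ Hermitian matrix-valued $C^1$ function on $\mathbf R^3$ for which there exist positive constants $\epsilon$ and $K$ such that $\langle x\rangle^{1+\epsilon}|q_{jk}(x)|+\sum_{\ell=1}^3\big|\frac{\partial q_{jk}}{\partial x_\ell}(x)\big|\le K$ for all $x\in\mathbf R^3$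 and $j,k=1,2,3,4$, then for $s>1/2$ and every real $\lambda\in(-\infty,-1)\cup(1,\infty)$ there exist bounded operators $R_t^{\pm}(\lambda):\mathcal L_{2,s}\to\mathcal L_{2,-s}$ such that for every $f\in\mathcal L_{2,s}$, $R_t(\lambda\pm i\mu)f\to R_t^{\pm}(\lambda)f$ in $\mathcal L_{2,-s}$ as $\mu\downarrow0$. *)

(* Defs.v *)
From HB Require Import structures.
From mathcomp Require Import all_boot all_order all_algebra.
From mathcomp Require Import all_classical all_reals all_analysis.
From mathcomp Require Import complex.
Set Implicit Arguments.
Unset Strict Implicit.
Unset Printing Implicit Defensive.
Import Order.TTheory GRing.Theory Num.Theory.
Import numFieldNormedType.Exports.
Local Open Scope classical_set_scope.
Local Open Scope complex_scope.
Local Open Scope ring_scope.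

(* R * R * R carries both a normed-module structure (used for derivatives) and
   the product Borel sigma-algebra (used for integration).  The norm `|x| of the
   product is the maximum norm; the Euclidean norm of x only enters through
   [japanese x], the bracket <x> = sqrt (1 + |x|^2). *)
Notation R3 R := (R * R * R)%type.

(* C^4-valued functions; equality in the L_2 spaces is equality a.e. *)
Notation spinor R := (R3 R -> 'cV[R[i]]_4).

Section euclidean_space.
Context {R : realType}.

Definition leb3 : {measure set (R3 (measurableTypeR R)) -> \bar R} :=
  ((@lebesgue_measure R \x @lebesgue_measure R) \x @lebesgue_measure R)%E.

Definition basis3 (j : 'I_3) : R3 R :=
  ((j == 0%N :> nat)%:R, (j == 1%N :> nat)%:R, (j == 2%N :> nat)%:R).

Definition japanese (x : R3 R) : R :=
  Num.sqrt (1 + (x.1.1 ^+ 2 + x.1.2 ^+ 2 + x.2 ^+ 2)).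

Definition partial (j : 'I_3) (f : R3 R -> R) (x : R3 R) : R :=
  'D_(basis3 j) f x.

Fixpoint Ck (n : nat) (f : R3 R -> R) : Prop :=
  continuous f /\
  if n is m.+1 then
    forall j, (forall x, derivable f x (basis3 j)) /\ Ck m (partial j f)
  else True.

Definition test_function (phi : R3 R -> R) : Prop :=
  (forall n, Ck n phi) /\ compact (closure [set x | phi x != 0]).

Definition cmod (z : R[i]) : R :=
  Num.sqrt (complex.Re z ^+ 2 + complex.Im z ^+ 2).

Definition cCk (n : nat) (f : R3 R -> R[i]) : Prop :=
  Ck n (fun x => complex.Re (f x)) /\ Ck n (fun x => complex.Im (f x)).

Definition cpartial (j : 'I_3) (f : R3 R -> R[i]) (x : R3 R) : R[i] :=
  partial j (fun y => complex.Re (f y)) x +i*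
  partial j (fun y => complex.Im (f y)) x.

Definition cintegral (f : R3 R -> R[i]) : R[i] :=
  Rintegral leb3 setT (fun x => complex.Re (f x)) +i*
  Rintegral leb3 setT (fun x => complex.Im (f x)).

End euclidean_space.

Section weighted_spaces.
Context {R : realType}.
Implicit Types (f g u v : spinor R) (T : spinor R -> spinor R).

Definition norm4 (v : 'cV[R[i]]_4) : R :=
  Num.sqrt (\sum_(k < 4) cmod (v k 0) ^+ 2).

Definition spinor_measurable f : Prop :=
  forall k, measurable_fun setT (fun x => complex.Re (f x k 0)) /\
            measurable_fun setT (fun x => complex.Im (f x k 0)).

(* ||f||_s = (int <x>^(2s) |f x|^2 dx)^(1/2), possibly +oo *)
Definition wnorm (s : R) f : \bar R :=
  Lnorm leb3 2%:E (fun x => (japanese x `^ s * norm4 (f x))%:E).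

Definition L2w (s : R) : set (spinor R) :=
  [set f | spinor_measurable f /\ (wnorm s f < +oo)%E].

(* The norm of T from L_{2,s} to L_{2,t}, as the supremum of ||T f||_t over the
   closed unit ball. *)
Definition opnorm (s t : R) T : \bar R :=
  ereal_sup [set wnorm t (T f) | f in [set f | L2w s f /\ (wnorm s f <= 1)%E]].

(* Operators act on representatives; linearity and the bound force them to
   respect equality almost everywhere. *)
Definition bounded_operator (s t : R) T : Prop :=
  [/\ forall f, L2w s f -> L2w t (T f),
      forall (a : R[i]) f g, L2w s f -> L2w s g ->
        T (a *: f + g) = a *: T f + T g %[ae leb3] &
      (opnorm s t T < +oo)%E].

End weighted_spaces.

Section dirac_operator.
Context {R : realType}.
Implicit Types (f g u v : spinor R) (T : spinor R -> spinor R).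

Definition is_weak_partial (j : 'I_3) u v : Prop :=
  forall phi : R3 R -> R, test_function phi -> forall k : 'I_4,
    cintegral (fun x => u x k 0 * (partial j phi x)%:C) =
    - cintegral (fun x => v x k 0 * (phi x)%:C).

(* [H^1(R^3)]^4 *)
Definition H1 : set (spinor R) :=
  [set u | L2w 0 u /\
           forall j, exists v, L2w 0 v /\ is_weak_partial j u v].

(* A representative of the L_2 weak derivative of u (0 if there is none). *)
Definition weak_partial (j : 'I_3) u : spinor R :=
  xget (0 : spinor R) [set v | L2w 0 v /\ is_weak_partial j u v].

Definition dirac_matrices (alpha : 'I_4 -> 'M[R[i]]_4) : Prop :=
  (forall j, alpha j \is hermsymmx) /\
  (forall j k, alpha j *m alpha k + alpha k *m alpha j =
               (2 * (j == k)%:R)%:M).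

(* H_t u = -i sum_j alpha_j d_j u + beta u + t Q u for u in H1, where
   alpha_1, alpha_2, alpha_3, beta are the values of alpha at 0, 1, 2, 3. *)
Definition dirac_op (alpha : 'I_4 -> 'M[R[i]]_4) (Q : R3 R -> 'M[R[i]]_4)
    (t : R) u : spinor R :=
  fun x =>
    - (0 +i* 1) *: (\sum_(j < 3) alpha (lift ord_max j) *m weak_partial j u x)
    + alpha ord_max *m u x
    + t%:C *: (Q x *m u x).

(* R_t(z) f = (H_t - z)^-1 f: the element u of H1 with (H_t - z) u = f, which
   exists and is unique up to a.e. equality when z is not real, H_t being
   selfadjoint on H1 (0 is returned if there is none). *)
Definition resolvent (alpha : 'I_4 -> 'M[R[i]]_4) (Q : R3 R -> 'M[R[i]]_4)
    (t : R) (z : R[i]) f : spinor R :=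
  xget (0 : spinor R)
    [set u | H1 u /\ dirac_op alpha Q t u - z *: u = f %[ae leb3]].

(* T is R_t^+(lambda) if sg = false and R_t^-(lambda) if sg = true. *)
Definition is_extended_resolvent (alpha : 'I_4 -> 'M[R[i]]_4)
    (Q : R3 R -> 'M[R[i]]_4) (s : R) (sg : bool) (t lambda : R) T : Prop :=
  bounded_operator s (- s) T /\
  forall f, L2w s f ->
    wnorm (- s) (resolvent alpha Q t (lambda +i* ((-1) ^+ sg * mu)) f - T f)
      @[mu --> 0^'+] --> 0%E.

End dirac_operator.

(* Main.v *)
(* A multiplier argument, with no Fourier analysis.  Let [z = lam + i mu],
   [f = (H_0 - z) u], and let [g = x (2 q^(-1/2) - q^(-theta))] with
   [q = 1 + del^2 |x|^2] and [1/2 < theta <= 1]: a bounded vector field whose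
   Jacobian is bounded below by [(2 theta - 1) q^(-theta)].  Since [H_0^2] is
   [1 - Laplacian], pairing [f] with [g . grad u + (div g / 2) u], and with [u],
   yields
     [int q^(-theta) |u|^2 <= C int q^theta |f|^2],
   uniformly for [|lam| >= 2] and [0 < |mu| <= 1], up to integrals of
   divergences; these vanish by translation invariance of the measure.
   Mollification extends the estimate to [H^1].  When [2 theta <= 1 + epsilon] the
   term [t Q u] is absorbed for small [t], and [mu -> 0] gives the uniform bound.
   If [h] is a mollification of [f], then [u + h / z] solves the equation with
   right-hand side [(f - h) - t Q u + H_0 h / z] (where [H_0 h] is square
   integrable with the weight); choosing first [h] close to [f], then [|lam|]
   large, gives the strong convergence to 0. *)

Require Import Defs.
From HB Require Import structures.
From mathcomp Require Import all_boot all_order all_algebra.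
From mathcomp Require Import all_classical all_reals all_analysis.
From mathcomp Require Import complex measurable_realfun ring lra.
Set Implicit Arguments.
Unset Strict Implicit.
Unset Printing Implicit Defensive.
Import Order.TTheory GRing.Theory Num.Theory.
Import numFieldNormedType.Exports.
Local Open Scope classical_set_scope.
Local Open Scope complex_scope.
Local Open Scope ring_scope.

(** The field and its divergence are bounded, so for a smooth [u] with square integrable derivatives
    every flux is integrable and no cut-off enters. Two obstacles shape the identities. No
    derivative of [f] may survive in the estimate: the fluxes are therefore written with
    [W_j = A_j f + U_j], where [A_j = -i alpha_j] and [U_j = d_j u]. The divergence of [W] is
    [Laplacian u + sum_j A_j d_j f], which the squared equation shows to be of order zero in [u] and
    [f]. Moreover the virial identity contains [2 lam mu] times the pairing of [i u] with
    [g . grad u], which has no decaying weight and cannot be absorbed by the Jacobian term. Young's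
    inequality bounds it by [|mu| |grad u|^2] and [|mu| lam^2 |u|^2]; the pairing with [u] trades
    the former for the latter, and the pairing with [i u], conservation of charge, expresses
    [mu |u|^2] through [f] up to a divergence. The resulting [lam^2 |u| |f|] is admissible because
    [lam^2 |u|^2] is controlled by [|grad u|^2 + |f|^2] once [|lam| >= 2]; thus [lam^2] stands on
    both sides and cancels. *)

(** * Measure-preserving maps and translations of R^3 *)

Section invariance.
Context d (T : measurableType d) {R : realType}.
Variables (m : {measure set T -> \bar R}) (phi : T -> T).
Hypothesis mphi : measurable_fun [set: T] phi.
Hypothesis inv : forall A, measurable A -> m (phi @^-1` A) = m A.
Implicit Types f : T -> \bar R.
Local Open Scope ereal_scope.

Lemma ge0_integral_invariant f : measurable_fun [set: T] f ->
  (forall x, 0 <= f x) -> \int[m]_x f (phi x) = \int[m]_x f x.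
Proof.
move=> mf f0; transitivity (\int[pushforward m phi]_x f x); last first.
  by apply: eq_measure_integral => A mA _; rewrite /= /pushforward inv.
by rewrite ge0_integral_pushforward.
Qed.

Lemma integrable_invariant f :
  m.-integrable setT f -> m.-integrable setT (f \o phi).
Proof.
move=> /integrableP[mf fi]; apply/integrableP; split.
  exact: (measurableT_comp mf mphi).
have ma : measurable_fun [set: T] (fun x => `|f x|) by exact: measurableT_comp.
by have /= -> := ge0_integral_invariant ma.
Qed.

Lemma integral_invariant f : m.-integrable setT f ->
  \int[m]_x f (phi x) = \int[m]_x f x.
Proof.
move=> fi; have mf := measurable_int _ fi.
rewrite integralE [RHS]integralE.
have Ep := ge0_integral_invariant (measurable_funepos mf) (funepos_ge0 _).
have En := ge0_integral_invariant (measurable_funeneg mf) (funeneg_ge0 _).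
rewrite -Ep -En.
by congr (_ - _); apply: eq_integral => x _; rewrite ?funeposE ?funenegE.
Qed.
End invariance.

Section translation.
Context {R : realType}.
Local Notation mR := (measurableTypeR R).
Local Notation leb := (@lebesgue_measure R).

Definition sleb : {sigma_finite_measure set mR -> \bar R} := @lebesgue_measure R.

Lemma sigma_finite_product d1 d2 (T1 : measurableType d1) (T2 : measurableType d2)
    (m1 : {sigma_finite_measure set T1 -> \bar R})
    (m2 : {sigma_finite_measure set T2 -> \bar R}) :
  sigma_finite setT (m1 \x m2)%E.
Proof.
have /sigma_finiteP[F [TF ndF Foo]] := sigma_finiteT m1.
have /sigma_finiteP[G [TG ndG Goo]] := sigma_finiteT m2.
exists (fun n => F n `*` G n) => [|n].
  apply/esym/seteqP; split => // -[x y] _.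
  have [n _ Fnx] : (\bigcup_n F n) x by rewrite -TF.
  have [k _ Gky] : (\bigcup_n G n) y by rewrite -TG.
  exists (maxn n k) => //; split.
    exact: (subsetPset _ _ (ndF _ _ (leq_maxl n k))).
  exact: (subsetPset _ _ (ndG _ _ (leq_maxr n k))).
have [mF Fy] := Foo n; have [mG Gy] := Goo n.
split; first exact: measurableX.
by rewrite product_measure1E// lte_mul_pinfty// ge0_fin_numE.
Qed.

(** Fubini, Tonelli and the uniqueness of product measures ask for sigma-finite factors, so [leb3]
    is repackaged as a sigma-finite measure with the same values. *)
Definition sprod d1 d2 (T1 : measurableType d1) (T2 : measurableType d2)
    (m1 : {sigma_finite_measure set T1 -> \bar R})
    (m2 : {sigma_finite_measure set T2 -> \bar R}) :
    {sigma_finite_measure set (T1 * T2)%type -> \bar R} :=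
  HB.pack_for (SigmaFiniteMeasure.type (T1 * T2)%type R) (m1 \x m2)%E
    (Measure_isSigmaFinite.Build _ _ _ (m1 \x m2)%E (sigma_finite_product m1 m2)).

Definition sleb2 : {sigma_finite_measure set (mR * mR)%type -> \bar R} :=
  sprod sleb sleb.

Definition sleb3 : {sigma_finite_measure set (R3 mR) -> \bar R} :=
  sprod sleb2 sleb.

Lemma leb3E : leb3 = sleb3 :> (set (R3 mR) -> \bar R). Proof. by []. Qed.

Lemma measurable_shift1 (a : R) :
  measurable_fun [set: mR] (fun x : mR => x + a : mR).
Proof. exact: measurable_funD. Qed.

(** The pushforward by a shift agrees with Lebesgue measure on half-open intervals, which determine
    it. *)
Lemma lebesgue_measure_shift (a : R) (A : set mR) : measurable A ->
  leb ((fun x : mR => x + a) @^-1` A) = leb A.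
Proof.
move=> mA.
pose m'_ := [the {measure set mR -> \bar R} of
  pushforward leb (fun x : mR => x + a : mR)].
pose m' := m'_ (measurable_shift1 a).
have H : forall X, ocitv X -> leb X = m' X.
  move=> _ [[u v] _ <-] /=.
  rewrite /pushforward (_ : _ @^-1` _ = `]u - a, v - a]%classic).
    rewrite !lebesgue_measure_itv/= !lte_fin ltrD2r; case: ifP => // _.
    by rewrite -!EFinB; congr (_%:E); ring.
  by apply/seteqP; split => x /=; rewrite !in_itv/= ltrBlDr lerBrDr.
by rewrite (lebesgue_measure_unique H mA).
Qed.

Local Notation mR3 := (R3 mR).

Lemma measurable_shift3 (a : R3 R) :
  measurable_fun [set: mR3] (fun x : mR3 => x + a : mR3).
Proof.
apply/measurable_fun_pairP; split => /=.
  apply/measurable_fun_pairP; split => /=.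
    exact: (measurableT_comp (measurable_shift1 a.1.1)
      (measurableT_comp measurable_fst measurable_fst)).
  exact: (measurableT_comp (measurable_shift1 a.1.2)
      (measurableT_comp measurable_snd measurable_fst)).
exact: (measurableT_comp (measurable_shift1 a.2) measurable_snd).
Qed.

(** Uniqueness of product measures, used on the plane and again on space: a shift maps rectangles to
    rectangles and acts on each factor separately. *)
Lemma leb3_shift (a : R3 R) (A : set mR3) : measurable A ->
  leb3 ((fun x : mR3 => x + a) @^-1` A) = leb3 A.
Proof.
move=> mA.
have m12 : measurable_fun [set: mR * mR]
    (fun x : mR * mR => (x.1 + a.1.1, x.2 + a.1.2) : mR * mR).
  apply/measurable_fun_pairP; split => /=.
    exact: (measurableT_comp (measurable_shift1 a.1.1) measurable_fst).
  exact: (measurableT_comp (measurable_shift1 a.1.2) measurable_snd).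
pose m2_ := [the {measure set (mR * mR) -> \bar R} of pushforward (leb \x leb)%E
     (fun x : mR * mR => (x.1 + a.1.1, x.2 + a.1.2) : mR * mR)].
pose m2 := m2_ m12.
have H2 (X : set (mR * mR)) : measurable X -> (leb \x leb)%E X = m2 X.
  apply: product_measure_unique => B C mB mC /=.
  rewrite /m2 /m2_ /= /pushforward.
  rewrite (_ : _ @^-1` _ = ((fun x : mR => x + a.1.1) @^-1` B) `*`
     ((fun x : mR => x + a.1.2) @^-1` C)) //.
  rewrite product_measure1E; first 1 last.
  - by rewrite -[X in measurable X]setTI; exact: measurable_shift1.
  - by rewrite -[X in measurable X]setTI; exact: measurable_shift1.
  by congr (_ * _)%E; apply: lebesgue_measure_shift.
pose m'_ := [the {measure set mR3 -> \bar R} of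
  pushforward leb3 (fun x : mR3 => x + a : mR3)].
pose m' := m'_ (measurable_shift3 a).
have H (B : set (mR * mR)) (C : set mR) : measurable B -> measurable C ->
    m' (B `*` C) = ((leb \x leb) B * leb C)%E.
  move=> mB mC; rewrite /m' /m'_ /= /pushforward.
  rewrite (_ : _ @^-1` _ =
     ((fun x : mR * mR => (x.1 + a.1.1, x.2 + a.1.2) : mR * mR) @^-1` B) `*`
     ((fun x : mR => x + a.2) @^-1` C)) //.
  rewrite /leb3 product_measure1E; first 1 last.
  - by rewrite -[X in measurable X]setTI; have := m12; apply.
  - by rewrite -[X in measurable X]setTI; exact: measurable_shift1.
  by congr (_ * _)%E; [rewrite [in RHS]H2|apply: lebesgue_measure_shift].
(* Uniqueness is restated for abstract factors so that it can be instantiated with the sigma-finite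
   packaging [sleb2] of the plane measure. *)
have K (m1 : {sigma_finite_measure set (mR * mR)%type -> \bar R})
    (m2' : {sigma_finite_measure set mR -> \bar R})
    (m3 : {measure set mR3 -> \bar R}) :
    (forall B C, measurable B -> measurable C -> m3 (B `*` C) = m1 B * m2' C)%E ->
    m3 A = (m1 \x m2')%E A.
  by move=> h; rewrite -(product_measure_unique h mA).
exact: (K sleb2 sleb m' H).
Qed.

Definition ge0_integral_shift (a : R3 R) :=
  ge0_integral_invariant (measurable_shift3 a) (leb3_shift a).

Definition integrable_shift (a : R3 R) :=
  integrable_invariant (measurable_shift3 a) (leb3_shift a).

Definition integral_shift (a : R3 R) :=
  integral_invariant (measurable_shift3 a) (leb3_shift a).
End translation.

(** * Integrals of directional derivatives *)

Section line_derivative.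
Context {R : realType} {V : normedModType R}.

(** Both difference quotients are the same function of the increment; this moves directional
    derivatives to one-variable calculus. *)
Lemma is_derive_line (f : V -> R) (x v : V) (t df : R) :
  is_derive (x + t *: v) v f df <->
  is_derive t (1:R) (fun u : R => f (x + u *: v)) df.
Proof.
have E : (fun h : R => h^-1 *: ((f \o shift (x + t *: v)) (h *: v) - f (x + t *: v)))
   = (fun h : R => h^-1 *: (((fun u : R => f (x + u *: v)) \o shift t) (h *: (1:R)) -
      f (x + t *: v))).
  apply/funext => h /=; congr (_ *: (f _ - _)).
  have -> : h *: (1:R) = h by rewrite /GRing.scale/= mulr1.
  by rewrite scalerDl addrCA.
split=> -[d1 d2]; split.
- by move: d1; rewrite /derivable E.
- by move: d2; rewrite /derive E.
- by move: d1; rewrite /derivable E.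
- by move: d2; rewrite /derive E.
Qed.

Lemma derivable_line_continuous (f df : V -> R) (x v : V) :
  (forall x, is_derive x v f (df x)) -> continuous (fun t : R => f (x + t *: v)).
Proof.
move=> fd t; apply: differentiable_continuous; apply/derivable1_diffP.
by have /is_derive_line[] := fd (x + t *: v).
Qed.

Lemma FTC_line (f df : V -> R) (x v : V) :
  (forall x, is_derive x v f (df x)) ->
  continuous (fun t : R => df (x + t *: v)) ->
  (\int[lebesgue_measure]_(t in `[0%R, 1%R]) (df (x + t *: v)%R)%:E =
   (f (x + v) - f x)%:E)%E.
Proof.
move=> fd cdf.
rewrite (@continuous_FTC2 _ (fun t => df (x + t *: v)) (fun t => f (x + t *: v)) 0 1).
- by rewrite scale1r scale0r addr0 EFinB.
- exact: ltr01.
- exact: continuous_subspaceT.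
- have c := derivable_line_continuous (x := x) fd; split.
  + move=> t _; by have /is_derive_line[] := fd (x + t *: v).
  + by apply: cvg_at_right_filter; exact: c.
  + by apply: cvg_at_left_filter; exact: c.
- move=> t _; rewrite derive1E.
  by have /is_derive_line[_ ->] := fd (x + t *: v).
Qed.
End line_derivative.

Section average_invariant.
Context {R : realType} d (T : measurableType d).
Local Notation mR := (measurableTypeR R).
Local Notation leb := (@sleb R).
Variables (m : {sigma_finite_measure set T -> \bar R}) (phi : T * mR -> T).
Hypothesis mphi : measurable_fun [set: T * mR] phi.
Hypothesis inv : forall t A, measurable A -> m ((fun x => phi (x, t)) @^-1` A) = m A.
Implicit Types f : T -> R.
Local Open Scope ereal_scope.

Let mphit t : measurable_fun setT (fun x => phi (x, t)).
Proof. exact: (measurableT_comp mphi (measurable_pair2 t)). Qed.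

(** Fubini on the product with [[0, 1]]: each inner integral over the space is unchanged by the
    invariant map, and the interval has mass 1. *)
Lemma integral_average_invariant f : m.-integrable setT (EFin \o f) ->
  \int[m]_x \int[leb]_(t in `[0%R, 1%R]) (f (phi (x, t)))%:E = \int[m]_x (f x)%:E.
Proof.
move=> fi.
pose h (p : T * mR) : \bar R :=
  (f (phi p))%:E * (\1_(`[0%R, 1%R]%classic) p.2)%:E.
have mf := measurable_int _ fi.
have mI : measurable (`[0%R, 1%R]%classic : set mR) by exact: measurable_itv.
have mh : measurable_fun setT h.
  apply: emeasurable_funM; first exact: (measurableT_comp mf mphi).
  apply/measurable_EFinP; apply: (measurableT_comp _ measurable_snd).
  exact: measurable_indic.
have I1 : \int[leb]_t (\1_(`[0%R, 1%R]%classic) t)%:E = 1.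
  rewrite integral_indic // setIT.
  rewrite [LHS](lebesgue_measure_itv `[0%R, 1%R]) /= ?lte_fin ltr01. by rewrite ?oppr0 ?adde0 ?sube0.
have hI t : \int[m]_x `|h (x, t)| =
    (\int[m]_x `|(f x)%:E|) * (\1_(`[0%R, 1%R]%classic) t)%:E.
  transitivity (\int[m]_x ((\1_(`[0%R, 1%R]%classic) t)%:E * `|(f (phi (x, t)))%:E|)).
    by apply: eq_integral => x _; rewrite /h abseM muleC gee0_abs ?lee_fin.
  rewrite ge0_integralZl//; last first.
    by apply: measurableT_comp => //; exact: (measurableT_comp mf (mphit t)).
  rewrite (ge0_integral_invariant (mphit t) (@inv t) (f := fun x => `|(f x)%:E|)) //.
    by rewrite muleC.
  exact: measurableT_comp.
have ih : (m \x leb).-integrable setT h.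
  apply/integrable21ltyP => //.
  under eq_integral do rewrite hI.
  rewrite /= ge0_integralZl//.
  - by rewrite I1 mule1; have /integrableP[] := fi.
  - by apply/measurable_EFinP; exact: measurable_indic.
  - exact: integral_ge0.
have E := Fubini ih.
transitivity (\int[m]_x \int[leb]_y h (x, y)).
  apply: eq_integral => x _; rewrite [LHS]integral_mkcond /=.
  by apply: eq_integral => t _; rewrite epatch_indic.
rewrite E /h /=.
under eq_integral => t _.
  rewrite integralZr //; last exact: (integrable_invariant (mphit t) (@inv t) fi).
  rewrite (integral_invariant (mphit t) (@inv t) fi).
  over.
have F := integrable_fin_num measurableT fi.
rewrite -(fineK F) integralZl //; last exact: integrable_indic_itv.
by rewrite I1 mule1.
Qed.
End average_invariant.

Section integral_derivative.
Context {R : realType}.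
Local Notation mR := (measurableTypeR R).
Local Notation leb := (@lebesgue_measure R).
Local Notation mR3 := (R3 mR).

Lemma measurable_line (v : R3 R) :
  measurable_fun [set: mR3 * mR] (fun p : mR3 * mR => p.1 + p.2 *: v : mR3).
Proof.
have m (g : mR3 * mR -> mR) (c : R) : measurable_fun setT g ->
    measurable_fun [set: mR3 * mR] (fun p => g p + p.2 * c).
  move=> mg; apply: measurable_funD => //.
  by apply: measurable_funM => //; exact: measurable_snd.
apply/measurable_fun_pairP; split => /=.
  apply/measurable_fun_pairP; split => /=.
    apply: (m (fun p => p.1.1.1)).
    exact: (measurableT_comp measurable_fst (measurableT_comp measurable_fst measurable_fst)).
  apply: (m (fun p => p.1.1.2)).
  exact: (measurableT_comp measurable_snd (measurableT_comp measurable_fst measurable_fst)).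
apply: (m (fun p => p.1.2)).
exact: (measurableT_comp measurable_snd measurable_fst).
Qed.

(** The integral of [df] equals that of its average over the segment from [x] to [x + v]. By the
    fundamental theorem this average is [f (x + v) - f x], whose integral vanishes by translation
    invariance. Hence integrability replaces any decay at infinity. *)
Lemma integral_derivative0 (f df : R3 R -> R) (v : R3 R) :
  (forall x, is_derive x v f (df x)) ->
  (forall x, continuous (fun t : R => df (x + t *: v))) ->
  leb3.-integrable setT (EFin \o f) -> leb3.-integrable setT (EFin \o df) ->
  (\int[leb3]_x (df x)%:E = 0)%E.
Proof.
move=> fd cdf fi dfi.
have /= <- := integral_average_invariant (m := sleb3) (measurable_line v)
  (fun t => leb3_shift (t *: v)) dfi.
transitivity (\int[leb3]_x ((f (x + v)%R)%:E - (f x)%:E))%E.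
  by apply: eq_integral => x _; rewrite (FTC_line fd (cdf x)).
rewrite integralB //; last exact: (integrable_shift v fi).
by rewrite (integral_shift v fi) subee //; exact: integrable_fin_num.
Qed.
End integral_derivative.

(** * Pointwise identities for the Dirac operator *)

Section real_inner_product.
Context {R : realType}.
Local Notation V := 'cV[R[i]]_4.
Implicit Types (a b c : V) (r : R).

(** The real part of the Hermitian product: C^4 is treated as a real Euclidean space of dimension 8,
    on which the imaginary unit acts as a skew isometry [J]. *)
Definition ip a b : R :=
  \sum_(k < 4) (complex.Re (a k 0) * complex.Re (b k 0) +
                complex.Im (a k 0) * complex.Im (b k 0)).

Definition rscale r a : V := r%:C *: a.

Lemma ipC a b : ip a b = ip b a.
Proof. by apply: eq_bigr => k _; ring. Qed.

Lemma ipDl a b c : ip (a + b) c = ip a c + ip b c.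
Proof.
rewrite /ip -big_split; apply: eq_bigr => k _; rewrite mxE.
by case: (a k 0) (b k 0) => [? ?] [? ?] /=; ring.
Qed.

Lemma ipZl r a b : ip (rscale r a) b = r * ip a b.
Proof.
rewrite /ip mulr_sumr; apply: eq_bigr => k _; rewrite mxE.
by case: (a k 0) (b k 0) => [? ?] [? ?] /=; ring.
Qed.

Lemma ipNl a b : ip (- a) b = - ip a b.
Proof.
rewrite /ip -sumrN; apply: eq_bigr => k _; rewrite mxE.
by case: (a k 0) (b k 0) => [? ?] [? ?] /=; ring.
Qed.

Lemma ipDr a b c : ip a (b + c) = ip a b + ip a c.
Proof. by rewrite ipC ipDl !(ipC _ a). Qed.

Lemma ipZr r a b : ip a (rscale r b) = r * ip a b.
Proof. by rewrite ipC ipZl ipC. Qed.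

Lemma ipNr a b : ip a (- b) = - ip a b.
Proof. by rewrite ipC ipNl ipC. Qed.

Lemma ipBr a b c : ip a (b - c) = ip a b - ip a c.
Proof. by rewrite ipDr ipNr. Qed.

Definition ipE := (ipDl, ipDr, ipZl, ipZr, ipNl, ipNr).

Lemma ip_ge0 a : 0 <= ip a a.
Proof. by apply: sumr_ge0 => k _; rewrite -!expr2 addr_ge0 ?sqr_ge0. Qed.

(** The square of [2 e a - k b] is nonnegative. *)
Lemma ip_young (k e : R) a b : 0 < e ->
  k * ip a b <= e * ip a a + k ^+ 2 / (4 * e) * ip b b.
Proof.
move=> e0; rewrite -(ler_pM2l (_ : 0 < 4 * e)); last by lra.
have := ip_ge0 (rscale (2 * e) a - rscale k b); rewrite !ipE (ipC b a) => h.
have -> : 4 * e * (e * ip a a + k ^+ 2 / (4 * e) * ip b b) =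
   4 * e ^+ 2 * ip a a + k ^+ 2 * ip b b by field; rewrite gt_eqF.
lra.
Qed.

Lemma ip_young_le (k e K : R) a b : 0 < e -> k ^+ 2 <= 4 * e * K ->
  k * ip a b <= e * ip a a + K * ip b b.
Proof.
move=> e0 kK; apply: (le_trans (ip_young k a b e0)); rewrite lerD2l.
apply: ler_wpM2r; first exact: ip_ge0.
by rewrite ler_pdivrMr; lra.
Qed.

Lemma sum3 (W : nmodType) (F : 'I_3 -> W) :
  \sum_(j < 3) F j = F 0 + F 1 + F 2%:R.
Proof.
rewrite !big_ord_recl big_ord0 addr0 addrA.
by congr (F _ + F _ + F _); apply: val_inj.
Qed.

(** * Virial, energy and charge identities at one point, for an abstract Dirac algebra *)

Section flux.
Variables (A : 'I_3 -> V -> V) (B J : V -> V).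
Hypothesis A_skew : forall j a b, ip (A j a) b = - ip a (A j b).
Hypothesis A_iso : forall j a, ip (A j a) (A j a) = ip a a.
Hypothesis B_sym : forall a b, ip (B a) b = ip a (B b).
Hypothesis B_iso : forall a, ip (B a) (B a) = ip a a.
Hypothesis J_skew : forall a b, ip (J a) b = - ip a (J b).
Hypothesis J_iso : forall a, ip (J a) (J a) = ip a a.
Hypothesis JB : forall a, J (B a) = B (J a).
Hypothesis JA : forall j a, J (A j a) = A j (J a).

Variables (lam mu : R) (u f : V) (U F W dW : 'I_3 -> V) (UU : 'I_3 -> 'I_3 -> V).
(** The real part of [1 - z^2] for [z = lam + i mu]. Applying [H_0 + z] to the equation gives
    [Laplacian u = (1 - z^2) u - (H_0 + z) f], which [eq_dW] expresses as a divergence. *)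
Let m := 1 - lam ^+ 2 + mu ^+ 2.
Hypothesis UU_sym : forall j k, UU j k = UU k j.
Hypothesis eq_f :
  \sum_(j < 3) A j (U j) = f - B u + rscale lam u + rscale mu (J u).
Hypothesis eq_F : forall k,
  \sum_(j < 3) A j (UU k j) =
  F k - B (U k) + rscale lam (U k) + rscale mu (J (U k)).
Hypothesis WE : forall j, W j = A j f + U j.
Hypothesis eq_dW :
  \sum_(j < 3) dW j =
  - (B f + rscale lam f + rscale mu (J f)) + rscale m u
  - rscale (2 * lam * mu) (J u).

Lemma ip_Jself a : ip (J a) a = 0.
Proof. by have := J_skew a a; rewrite (ipC a); lra. Qed.

Lemma ip_JB a : ip (J a) (B a) = 0.
Proof. by have := J_skew a (B a); rewrite JB -(B_sym a) (ipC (B a)); lra. Qed.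

(** Pairing the equation with [J u] kills the mass term and the real part of [z], by [ip_JB] and
    [ip_Jself]. What remains relates the divergence of the charge current to [mu] times the density
    and to [f]. *)
Lemma charge_identity :
  - 2^-1 * \sum_(j < 3) (ip (J (U j)) (A j u) + ip (J u) (A j (U j))) =
  - ip (J u) f - mu * ip u u.
Proof.
have e j : ip (J (U j)) (A j u) = ip (J u) (A j (U j)).
  by rewrite ipC A_skew -JA -J_skew.
have h : \sum_(j < 3) ip (J u) (A j (U j)) = ip (J u) f + mu * ip u u.
  move/(congr1 (ip (J u))): eq_f; rewrite !sum3 !ipE ip_JB ip_Jself J_iso.
  by move->; ring.
rewrite (eq_bigr (fun j => 2 * ip (J u) (A j (U j)))); last first.
  by move=> j _; rewrite e; ring.
by rewrite -mulr_sumr h; field.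
Qed.

Lemma ipW j a : ip (W j) a = ip (U j) a - ip f (A j a).
Proof. by rewrite WE ipDl A_skew addrC. Qed.

Lemma ip_sum_dW a : ip (\sum_(j < 3) dW j) a =
  - ip f (B a) - lam * ip f a + mu * ip f (J a) + m * ip u a
  - 2 * lam * mu * ip (J u) a.
Proof. by rewrite eq_dW !ipE B_sym J_skew; ring. Qed.

(** The divergence of the pairings of [W] with [u]. The first-order equation, paired with [f],
    removes the terms where [A] or [B] meets [f]. As [m] is about [- lam^2], it bounds the gradient
    by [lam^2 |u|^2] up to a divergence and terms in [f]. *)
Lemma energy_identity :
  \sum_(j < 3) (ip (dW j) u + ip (W j) (U j)) =
  \sum_(j < 3) ip (U j) (U j) + m * ip u u - ip f f - 2 * lam * ip f u.
Proof.
have h1 := ip_sum_dW u; rewrite sum3 !ipDl ip_Jself in h1.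
have h0 := congr1 (ip f) eq_f; rewrite sum3 !ipE in h0.
rewrite !sum3 !ipW; lra.
Qed.

Variables (g : 'I_3 -> R) (Dg : 'I_3 -> 'I_3 -> R) (d : R) (dd : 'I_3 -> R).
Hypothesis dE : d = \sum_(j < 3) Dg j j.

(** The left side is the divergence of the field whose component [j] is the pairing of [W_j] with
    [g . grad u + (d / 2) u], plus [(g_j / 2) (|f|^2 - |grad u|^2 - m |u|^2)]. This last term is
    chosen so that second derivatives of [u] and first derivatives of [f] cancel on the right
    side. *)
Lemma virial_identity :
  \sum_(j < 3) (\sum_(k < 3) (Dg j k * ip (W j) (U k) +
      g k * (ip (dW j) (U k) + ip (W j) (UU j k))) +
    2^-1 * (dd j * ip (W j) u + d * (ip (dW j) u + ip (W j) (U j))) +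
    2^-1 * Dg j j * (ip f f - \sum_(k < 3) ip (U k) (U k) - m * ip u u) +
    g j * (ip f (F j) - \sum_(k < 3) ip (U k) (UU j k) - m * ip u (U j))) =
  \sum_(j < 3) \sum_(k < 3) Dg j k * ip (U j) (U k) +
  2^-1 * \sum_(j < 3) dd j * ip (U j) u -
  2 * lam * mu * \sum_(k < 3) g k * ip (J u) (U k) -
  2 * lam * (\sum_(k < 3) g k * ip f (U k) + 2^-1 * d * ip f u) -
  \sum_(j < 3) \sum_(k < 3) Dg j k * ip f (A j (U k)) -
  2^-1 * \sum_(j < 3) dd j * ip f (A j u).
Proof.
have hu := ip_sum_dW u; rewrite sum3 !ipDl ip_Jself in hu.
have h0 := congr1 (ip f) eq_f; rewrite sum3 !ipE in h0.
have hU k : ip (dW 0) (U k) + ip (dW 1) (U k) + ip (dW 2%:R) (U k) =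
   - ip f (B (U k)) - lam * ip f (U k) + mu * ip f (J (U k)) + m * ip u (U k)
  - 2 * lam * mu * ip (J u) (U k).
  by rewrite -ip_sum_dW sum3 !ipDl.
have h1 k : ip f (A 0 (UU 0 k)) + ip f (A 1 (UU 1 k)) + ip f (A 2%:R (UU 2%:R k)) =
  ip f (F k) - ip f (B (U k)) + lam * ip f (U k) + mu * ip f (J (U k)).
  have := congr1 (ip f) (eq_F k); rewrite sum3 !ipE => <-.
  by rewrite !(UU_sym k).
have e0 := hU 0; have e1 := hU 1; have e2 := hU 2%:R.
have k0 := h1 0; have k1 := h1 1; have k2 := h1 2%:R.
rewrite dE !sum3 !ipW.
rewrite !(UU_sym 1 0) !(UU_sym 2%:R 0) !(UU_sym 2%:R 1).
rewrite !(UU_sym 1 0) !(UU_sym 2%:R 0) !(UU_sym 2%:R 1) in k0 k1 k2.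
(* The goal multiplies these relations by the indeterminates [g] and [Dg], which is beyond linear
   arithmetic; hence each relation is solved for one pairing and substituted. *)
have s0 : ip (dW 0) (U 0) = - ip (dW 1) (U 0) - ip (dW 2%:R) (U 0)
  - ip f (B (U 0)) - lam * ip f (U 0) + mu * ip f (J (U 0)) + m * ip u (U 0)
  - 2 * lam * mu * ip (J u) (U 0) by lra.
have s1 : ip (dW 0) (U 1) = - ip (dW 1) (U 1) - ip (dW 2%:R) (U 1)
  - ip f (B (U 1)) - lam * ip f (U 1) + mu * ip f (J (U 1)) + m * ip u (U 1)
  - 2 * lam * mu * ip (J u) (U 1) by lra.
have s2 : ip (dW 0) (U 2%:R) = - ip (dW 1) (U 2%:R) - ip (dW 2%:R) (U 2%:R)
  - ip f (B (U 2%:R)) - lam * ip f (U 2%:R) + mu * ip f (J (U 2%:R)) + m * ip u (U 2%:R)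
  - 2 * lam * mu * ip (J u) (U 2%:R) by lra.
have su : ip (dW 0) u = - ip (dW 1) u - ip (dW 2%:R) u
  - ip f (B u) - lam * ip f u + mu * ip f (J u) + m * ip u u by lra.
have sf : ip f (A 0 (U 0)) = - ip f (A 1 (U 1)) - ip f (A 2%:R (U 2%:R))
   + ip f f - ip f (B u) + lam * ip f u + mu * ip f (J u) by lra.
have t0 : ip f (F 0) = ip f (A 0 (UU 0 0)) + ip f (A 1 (UU 0 1)) + ip f (A 2%:R (UU 0 2%:R))
  + ip f (B (U 0)) - lam * ip f (U 0) - mu * ip f (J (U 0)) by lra.
have t1 : ip f (F 1) = ip f (A 0 (UU 0 1)) + ip f (A 1 (UU 1 1)) + ip f (A 2%:R (UU 1 2%:R))
  + ip f (B (U 1)) - lam * ip f (U 1) - mu * ip f (J (U 1)) by lra.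
have t2 : ip f (F 2%:R) = ip f (A 0 (UU 0 2%:R)) + ip f (A 1 (UU 1 2%:R)) + ip f (A 2%:R (UU 2%:R 2%:R))
  + ip f (B (U 2%:R)) - lam * ip f (U 2%:R) - mu * ip f (J (U 2%:R)) by lra.
rewrite s0 s1 s2 su sf t0 t1 t2 (ipC (U 1) (U 0)) (ipC (U 2%:R) (U 0)) (ipC (U 2%:R) (U 1)).
rewrite (ipC u (U 0)) (ipC u (U 1)) (ipC u (U 2%:R)).
by field.
Qed.
(** The equation reads [z u = s + B u] with [|s|^2 <= 4 (|grad u|^2 + |f|^2)], so
    [(lam^2 - 2) |u|^2 <= 2 |s|^2]. The assumption on [lam] keeps half of [lam^2] on the left. *)
Lemma mass_bound : 4 <= lam ^+ 2 ->
  lam ^+ 2 * ip u u <= 16 * (\sum_(k < 3) ip (U k) (U k) + ip f f).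
Proof.
move=> lam2.
have [s sE] : exists s, s = \sum_(j < 3) A j (U j) - f by eexists.
have e : rscale lam u + rscale mu (J u) = s + B u.
  by rewrite sE eq_f -(addrA (f - B u)) (addrC (f - B u)) addrA [_ - B u - f]addrAC
    addrK subrK.
have := congr1 (fun v => ip v v) e.
have juu := ip_Jself u.
have bs := ip_ge0 (s - B u).
rewrite !ipE B_iso (ipC (B u) s) in bs.
rewrite !ipE J_iso B_iso (ipC u (J u)) juu (ipC (B u) s) => h1.
have h2 : (lam ^+ 2 + mu ^+ 2) * ip u u <= 2 * ip s s + 2 * ip u u by lra.
have s4 : ip s s <= 4 * (\sum_(k < 3) ip (U k) (U k) + ip f f).
  rewrite sE !sum3.
  have q1 := ip_ge0 (A 0 (U 0) - A 1 (U 1)).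
  have q2 := ip_ge0 (A 0 (U 0) - A 2%:R (U 2%:R)).
  have q3 := ip_ge0 (A 0 (U 0) + f).
  have q4 := ip_ge0 (A 1 (U 1) - A 2%:R (U 2%:R)).
  have q5 := ip_ge0 (A 1 (U 1) + f).
  have q6 := ip_ge0 (A 2%:R (U 2%:R) + f).
  rewrite !ipE !A_iso in q1 q2 q3 q4 q5 q6 *.
  have c1 := ipC (A 1 (U 1)) (A 0 (U 0)).
  have c2 := ipC (A 2%:R (U 2%:R)) (A 0 (U 0)).
  have c3 := ipC (A 2%:R (U 2%:R)) (A 1 (U 1)).
  have c4 := ipC f (A 0 (U 0)); have c5 := ipC f (A 1 (U 1)).
  have c6 := ipC f (A 2%:R (U 2%:R)).
  lra.
have u0 := ip_ge0 u; have mu0 : 0 <= mu ^+ 2 * ip u u by rewrite mulr_ge0 ?sqr_ge0.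
have l4 : 0 <= (lam ^+ 2 - 4) * ip u u by rewrite mulr_ge0 // subr_ge0.
lra.
Qed.

Variables (kap del w wi M : R).
Hypothesis kap_gt0 : 0 < kap.
Hypothesis delE : 1200 * del = kap.
Hypothesis kap_le1 : kap <= 1.
Hypothesis w_gt0 : 0 < w.
Hypothesis w_le1 : w <= 1.
Hypothesis wwi : w * wi = 1.
Hypothesis M_ge0 : 0 <= M.
Hypothesis g_le : forall k, g k ^+ 2 <= M ^+ 2.
Hypothesis Dg_le : forall j k, Dg j k ^+ 2 <= 16.
Hypothesis d_le : d ^+ 2 <= 121.
Hypothesis dd_le : forall j, dd j ^+ 2 <= (22 * del * w) ^+ 2.
Hypothesis hessian : kap * w * \sum_(k < 3) ip (U k) (U k) <=
  \sum_(j < 3) \sum_(k < 3) Dg j k * ip (U j) (U k).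
Hypothesis lam_ge : 4 <= lam ^+ 2.
Hypothesis mu_neq0 : mu != 0.
Hypothesis mu_le1 : `|mu| <= 1.

(** The inner factor collects the coefficients of [lam^2 wi |f|^2] from the Young inequalities of
    [pointwise_bound]: [824 = 24 + 800] and [1184 = 968 + 9 * 24]. The factor [64 / kap] converts
    [kap / 4] into the 16 of [mass_bound], and the final 4 pays for its term [16 |f|^2]. *)
Definition resolvent_const : R :=
  64 / kap * ((824 * M ^+ 2 + 1184) / kap + M / 2 + 2) + 4.

(* The divergences of the virial, energy and charge fluxes, in terms of the field
   [u], its first and second derivatives [U] and [UU], and the derivatives [F] of
   [f = (H_0 - z) u]. *)
Variables (dPhi dPsi dchi : R).
Hypothesis dPhiE : dPhi =
  \sum_(j < 3) \sum_(k < 3) Dg j k * ip (U j) (U k) +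
  2^-1 * \sum_(j < 3) dd j * ip (U j) u -
  2 * lam * mu * \sum_(k < 3) g k * ip (J u) (U k) -
  2 * lam * (\sum_(k < 3) g k * ip f (U k) + 2^-1 * d * ip f u) -
  \sum_(j < 3) \sum_(k < 3) Dg j k * ip f (A j (U k)) -
  2^-1 * \sum_(j < 3) dd j * ip f (A j u).
Hypothesis dPsiE : dPsi =
  \sum_(j < 3) ip (U j) (U j) + m * ip u u - ip f f - 2 * lam * ip f u.
Hypothesis dchiE : dchi = - ip (J u) f - mu * ip u u.

Let X := \sum_(k < 3) ip (U k) (U k).

(** Every indefinite term of the virial identity is split by Young's inequality into a part absorbed
    by the Jacobian lower bound [kap w |grad u|^2] and a multiple of [lam^2 wi |f|^2]; [w wi = 1]
    makes the weights match. *)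
Lemma pointwise_bound :
  lam ^+ 2 * w * ip u u <=
  64 / kap * (dPhi + M * `|mu| * dPsi - 5 * M * lam ^+ 2 * Num.sg mu * dchi) +
  resolvent_const * (lam ^+ 2 * wi * ip f f).
Proof.
have u0 := ip_ge0 u; have f0 := ip_ge0 f; have mb := mass_bound lam_ge.
have kap0 := kap_gt0; have kap1 := kap_le1; have w0 := w_gt0; have w1 := w_le1.
have delk := delE; have lam4 := lam_ge; have M0 := M_ge0.
have X0 : 0 <= X by apply: sumr_ge0 => k _; exact: ip_ge0.
have wi0 : 0 < wi by have : 0 < w * wi; [rewrite wwi | rewrite pmulr_rgt0].
have wi1 : 1 <= wi by rewrite -wwi ler_piMl // ltW.
have del0 : 0 < del by move: kap_gt0 delE; lra.
have amu : 0 < `|mu| by rewrite normr_gt0.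
have sgmu : Num.sg mu * mu = `|mu| by rewrite normrEsg.
pose N := lam ^+ 2 * wi * ip f f.
have ff : ip f f <= wi * ip f f by rewrite ler_peMl.
have wff : w * ip f f <= ip f f by rewrite ler_piMl.
have N4 : 4 * (wi * ip f f) <= N.
  by rewrite /N -mulrA ler_wpM2r // mulr_ge0 // ltW.
have M2 : 0 <= M ^+ 2 by exact: sqr_ge0.
have c0 (n : nat) : 0 <= n%:R / kap by rewrite divr_ge0 ?ler0n ?ltW.
have t1 j : - (2^-1 * (dd j * ip (U j) u)) <= 6 * del * w * (ip (U j) (U j) + ip u u).
  have := @ip_young_le (- (2^-1 * dd j)) (6 * del * w) (6 * del * w) (U j) u.
  have h := dd_le j; have p : 0 < del * w by rewrite mulr_gt0.
  have -> : - (2^-1 * dd j) * ip (U j) u = - (2^-1 * (dd j * ip (U j) u)) by ring.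
  rewrite mulrDr; apply; [lra|].
  have -> : (- (2^-1 * dd j)) ^+ 2 = 4^-1 * dd j ^+ 2 by field.
  have : 0 <= (del * w) ^+ 2 by exact: sqr_ge0.
  lra.
have t6 j : 2^-1 * (dd j * ip f (A j u)) <= 6 * del * w * (ip u u + ip f f).
  have := @ip_young_le (2^-1 * dd j) (6 * del * w) (6 * del * w) (A j u) f.
  have h := dd_le j; have p : 0 < del * w by rewrite mulr_gt0.
  have -> : 2^-1 * (dd j * ip f (A j u)) = 2^-1 * dd j * ip (A j u) f.
    by rewrite (ipC f); ring.
  rewrite A_iso mulrDr; apply; [lra|].
  have -> : (2^-1 * dd j) ^+ 2 = 4^-1 * dd j ^+ 2 by field.
  have : 0 <= (del * w) ^+ 2 by exact: sqr_ge0.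
  lra.
(* This bound carries [|mu|] in place of the weight [w]; the energy and charge identities are there
   to remove its right side. Young's inequality needs [M > 0], and for [M = 0] the field
   vanishes. *)
have t2 k : 2 * lam * mu * (g k * ip (J u) (U k)) <=
    M * `|mu| * ip (U k) (U k) + M * `|mu| * lam ^+ 2 * ip u u.
  have [M00|M00] := eqVneq M 0.
    have : g k ^+ 2 <= 0 by have := g_le k; rewrite M00 expr0n.
    rewrite le_eqVlt ltNge sqr_ge0 orbF sqrf_eq0 => /eqP ->.
    by rewrite M00 !mul0r mulr0 addr0.
  have Mgt : 0 < M by rewrite lt_neqAle eq_sym M00.
  have := @ip_young_le (2 * lam * mu * g k) (M * `|mu|) (M * `|mu| * lam ^+ 2) (U k) (J u).
  have -> : 2 * lam * mu * (g k * ip (J u) (U k)) = 2 * lam * mu * g k * ip (U k) (J u).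
    by rewrite (ipC (J u)); ring.
  rewrite J_iso; apply; first by rewrite mulr_gt0.
  have -> : (2 * lam * mu * g k) ^+ 2 = 4 * (lam ^+ 2 * mu ^+ 2) * g k ^+ 2 by ring.
  have -> : 4 * (M * `|mu|) * (M * `|mu| * lam ^+ 2) =
    4 * (lam ^+ 2 * mu ^+ 2) * M ^+ 2.
    by rewrite -(real_normK (num_real mu)); ring.
  rewrite ler_wpM2l //.
  by have := mulr_ge0 (sqr_ge0 lam) (sqr_ge0 mu); lra.
have t3 k : 2 * lam * (g k * ip f (U k)) <=
    kap / 8 * (w * ip (U k) (U k)) + 8 * M ^+ 2 / kap * N.
  have := @ip_young_le (2 * lam * g k) (kap / 8 * w) (8 * M ^+ 2 / kap * (lam ^+ 2 * wi)) (U k) f.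
  have -> : 2 * lam * (g k * ip f (U k)) = 2 * lam * g k * ip (U k) f.
    by rewrite (ipC f); ring.
  rewrite /N !mulrA; apply; first by rewrite mulr_gt0 //; lra.
  rewrite [leRHS](_ : _ = (2 * lam) ^+ 2 * M ^+ 2 * (w * wi)); last first.
    by field; rewrite gt_eqF.
  by rewrite wwi mulr1 exprMn ler_wpM2l // sqr_ge0.
have t4 : lam * (d * ip f u) <= kap / 128 * (lam ^+ 2 * w * ip u u) + 968 / kap * N.
  have := @ip_young_le (lam * d) (kap / 128 * (lam ^+ 2 * w)) (3872 / kap * wi) u f.
  have kw : 0 < kap / 128 * (lam ^+ 2 * w).
    have l2 : 0 < lam ^+ 2 by lra.
    by have := mulr_gt0 kap0 (mulr_gt0 l2 w0); lra.
  rewrite (ipC u) => /(_ kw) h.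
  apply: (@le_trans _ _ (kap / 128 * (lam ^+ 2 * w) * ip u u + 3872 / kap * wi * ip f f)).
    rewrite mulrA; apply: h.
    have -> : 4 * (kap / 128 * (lam ^+ 2 * w)) * (3872 / kap * wi) =
      lam ^+ 2 * 121 * (w * wi) by field; rewrite gt_eqF.
    by rewrite wwi mulr1 exprMn ler_wpM2l // sqr_ge0.
  have k0 : 0 < kap^-1 by rewrite invr_gt0.
  have : 968 / kap * (4 * (wi * ip f f)) <= 968 / kap * N.
    exact: (ler_wpM2l (c0 _) N4).
  lra.
have t5 j k : Dg j k * ip f (A j (U k)) <=
    kap / 24 * (w * ip (U k) (U k)) + 24 / kap * N.
  have := @ip_young_le (Dg j k) (kap / 24 * w) (96 / kap * wi) (A j (U k)) f.
  rewrite A_iso (ipC (A j _)) => h.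
  apply: (@le_trans _ _ (kap / 24 * w * ip (U k) (U k) + 96 / kap * wi * ip f f)).
    apply: h; first by rewrite mulr_gt0 //; lra.
    have -> : 4 * (kap / 24 * w) * (96 / kap * wi) = 16 * (w * wi) by field; rewrite gt_eqF.
    by rewrite wwi mulr1.
  have k0 : 0 < kap^-1 by rewrite invr_gt0.
  have : 24 / kap * (4 * (wi * ip f f)) <= 24 / kap * N.
    exact: (ler_wpM2l (c0 _) N4).
  lra.
have t7 : - (5 * M * lam ^+ 2 * Num.sg mu * ip (J u) f) <=
    kap / 128 * (lam ^+ 2 * w * ip u u) + 800 * M ^+ 2 / kap * N.
  have := @ip_young_le (- (5 * M * lam ^+ 2 * Num.sg mu)) (kap / 128 * (lam ^+ 2 * w))
    (800 * M ^+ 2 / kap * (lam ^+ 2 * wi)) (J u) f.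
  have kw : 0 < kap / 128 * (lam ^+ 2 * w).
    have l2 : 0 < lam ^+ 2 by lra.
    by have := mulr_gt0 kap0 (mulr_gt0 l2 w0); lra.
  rewrite J_iso => /(_ kw) h.
  rewrite -mulNr; apply: (le_trans (h _)); last by rewrite /N !mulrA.
  have -> : 4 * (kap / 128 * (lam ^+ 2 * w)) * (800 * M ^+ 2 / kap * (lam ^+ 2 * wi)) =
    (5 * M * lam ^+ 2) ^+ 2 * (w * wi) by field; rewrite gt_eqF.
  rewrite wwi mulr1 sqrrN [leLHS]exprMn.
  by rewrite sqr_sg mu_neq0 mulr1.
have t8 : `|mu| * (2 * lam * ip f u) <= `|mu| * (lam ^+ 2 * ip u u) + ip f f.
  have h := ip_ge0 (rscale lam u - f); rewrite !ipE (ipC u f) in h.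
  have : 0 <= `|mu| * (lam * (lam * ip u u) - lam * ip f u - (lam * ip f u - ip f f)).
    by rewrite mulr_ge0 //; lra.
  have : `|mu| * ip f f <= ip f f by rewrite ler_piMl.
  lra.
pose C1 := (824 * M ^+ 2 + 1184) / kap + M / 2 + 2.
pose D := dPhi + M * `|mu| * dPsi - 5 * M * lam ^+ 2 * Num.sg mu * dchi.
(* The three instances of [t2] leave [M |mu| X] and three copies of [M |mu| lam^2 |u|^2]. Here the
   former becomes two further copies, and [hC] turns all five into charge divergences and pairings
   with [f]; this is the 5 in the statement. *)
have hE : M * `|mu| * X <= M * `|mu| * dPsi + 2 * (M * `|mu| * lam ^+ 2 * ip u u) +
    2 * (M * ip f f).
  rewrite -!(mulrA M) -(mulrCA M) -(mulrCA M 2) -!mulrDr; apply: ler_wpM2l => //.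
  have mff : `|mu| * ip f f <= ip f f by rewrite ler_piMl.
  have : 0 <= `|mu| * (1 + mu ^+ 2) * ip u u.
    by rewrite !mulr_ge0 // addr_ge0 ?sqr_ge0.
  rewrite dPsiE /m -/X; lra.
have hC : M * `|mu| * lam ^+ 2 * ip u u =
    - (M * lam ^+ 2 * Num.sg mu * dchi) - M * lam ^+ 2 * Num.sg mu * ip (J u) f.
  by rewrite dchiE -sgmu; ring.
have hV : kap * (w * X) <= dPhi + 12 * del * (w * X) + 36 * del * (w * ip u u) +
    18 * del * (w * ip f f) + M * `|mu| * X + 3 * (M * `|mu| * lam ^+ 2 * ip u u) +
    kap / 4 * (w * X) + kap / 128 * (lam ^+ 2 * w * ip u u) +
    24 * M ^+ 2 / kap * N + 1184 / kap * N.
  rewrite mulrA; apply: (le_trans hessian); rewrite dPhiE.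
  have wX0 : 0 <= del * (w * X).
    by rewrite !mulr_ge0 // ltW.
  have := (t1 0, t1 1, t1 2%:R, t6 0, t6 1, t6 2%:R).
  case; case; case; case; case => a0 a1 a2 b0 b1 b2.
  have := (t2 0, t2 1, t2 2%:R, t3 0, t3 1, t3 2%:R).
  case; case; case; case; case => c0' c1 c2 d0 d1 d2.
  have := (t5 0 0, t5 0 1, t5 0 2%:R, t5 1 0, t5 1 1, t5 1 2%:R).
  case; case; case; case; case => e00 e01 e02 e10 e11 e12.
  have := (t5 2%:R 0, t5 2%:R 1, t5 2%:R 2%:R).
  case; case => e20 e21 e22.
  rewrite /X !sum3 in wX0 *.
  lra.
(* Of [kap w X], one quarter goes to [t3] and [t5], one quarter to the two terms [kap / 128] through
   the factor 16 of [mass_bound], and 0.13 to the terms in [del], since [1200 del = kap]. More than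
   a quarter remains. *)
have main : kap / 4 * (w * X) <= D + C1 * N.
  rewrite /D /C1.
  have k1 : del * (w * X) = kap * (w * X) / 1200 by rewrite -delk; field.
  have k2 : del * (w * ip u u) = kap * (w * ip u u) / 1200 by rewrite -delk; field.
  have k3 : del * (w * ip f f) = kap * (w * ip f f) / 1200 by rewrite -delk; field.
  have k4 : kap * (w * ip f f) <= w * ip f f.
    by rewrite ler_piMl // mulr_ge0 // ltW.
  have k5 : kap * (w * (lam ^+ 2 * ip u u)) <= kap * (w * (16 * (X + ip f f))).
    by rewrite ler_wpM2l ?ler_wpM2l // ltW.
  have k6 : kap * (w * (4 * ip u u)) <= kap * (w * (lam ^+ 2 * ip u u)).
    by rewrite ler_wpM2l ?ler_wpM2l ?ler_wpM2r // ltW.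
  have k7 : M * (4 * ip f f) <= M * N by rewrite ler_wpM2l //; lra.
  have k8 : 0 <= kap * (w * X) by rewrite !mulr_ge0 // ltW.
  have k9 : 0 <= kap * (w * ip f f) by rewrite !mulr_ge0 // ltW.
  lra.
have : 64 / kap * (kap / 4 * (w * X)) <= 64 / kap * (D + C1 * N).
  by rewrite ler_wpM2l ?c0.
have -> : 64 / kap * (kap / 4 * (w * X)) = 16 * (w * X) by field; rewrite gt_eqF.
have : w * (lam ^+ 2 * ip u u) <= w * (16 * (X + ip f f)) by rewrite ler_wpM2l // ltW.
rewrite /resolvent_const -/C1 -/D -/N; lra.
Qed.
End flux.
End real_inner_product.

(** * Radial weights *)

Section directional.
Context {R : realType} {V : normedModType R}.

Lemma is_derive_at (f : V -> R) (x v : V) (df : R) :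
  is_derive (0:R) (1:R) (fun u : R => f (x + u *: v)) df -> is_derive x v f df.
Proof. by move=> h; have /is_derive_line := h; rewrite scale0r addr0. Qed.

(** A chain rule that asks only for a directional derivative of [f], obtained on the line through
    [x]. *)
Lemma is_derive_comp_line (h : R -> R) (f : V -> R) (x v : V) (df dh : R) :
  is_derive x v f df -> is_derive (f x) 1 h dh ->
  is_derive x v (fun y => h (f y)) (dh * df).
Proof.
move=> hf hh; apply: is_derive_at.
have hf0 : is_derive (0:R) (1:R) (fun u : R => f (x + u *: v)) df.
  by apply: (@is_derive_line R V f x v 0 df).1; rewrite scale0r addr0.
apply: (@is_derive1_comp R h (fun u : R => f (x + u *: v))) => //.
by rewrite scale0r addr0.
Qed.

Lemma is_derive_ext (f g : V -> R) (x v : V) (df dg : R) :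
  is_derive x v f df -> f =1 g -> df = dg -> is_derive x v g dg.
Proof. by move=> h /funext <- <-. Qed.

(** The continuity that [integral_derivative0] asks of a derivative. A function with a derivative in
    the direction [v] at every point has it automatically. *)
Definition line_continuous (v : V) (f : V -> R) : Prop :=
  forall x, continuous (fun t : R => f (x + t *: v)).

Lemma line_continuousD v f g : line_continuous v f -> line_continuous v g ->
  line_continuous v (fun x => f x + g x).
Proof. by move=> hf hg x t; apply: cvgD; [exact: hf|exact: hg]. Qed.

Lemma line_continuousM v f g : line_continuous v f -> line_continuous v g ->
  line_continuous v (fun x => f x * g x).
Proof. by move=> hf hg x t; apply: cvgM; [exact: hf|exact: hg]. Qed.

Lemma line_continuous_cst v (c : R) : line_continuous v (fun=> c).
Proof. by move=> x t; exact: cvg_cst. Qed.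

Lemma line_continuousN v f : line_continuous v f ->
  line_continuous v (fun x => - f x).
Proof. by move=> hf x t; apply: cvgN; exact: hf. Qed.

Lemma line_continuous_sum v (I : Type) (s : seq I) (F : I -> V -> R) :
  (forall i, line_continuous v (F i)) ->
  line_continuous v (fun x => \sum_(i <- s) F i x).
Proof.
move=> hF; elim: s => [|i s ih].
  by rewrite (_ : (fun _ => _) = cst 0); [exact: line_continuous_cst|
    apply/funext => x; rewrite big_nil].
rewrite (_ : (fun _ => _) = (fun x => F i x + \sum_(i <- s) F i x)).
  exact: line_continuousD.
by apply/funext => x; rewrite big_cons.
Qed.
End directional.

Section weights.
Context {R : realType}.

Definition coord (j : 'I_3) (x : R3 R) : R :=
  if j == 0 then x.1.1 else if j == 1 then x.1.2 else x.2.

Lemma ord3_ind (P : 'I_3 -> Prop) : P 0 -> P 1 -> P 2%:R -> forall j, P j.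
Proof.
move=> p0 p1 p2 [[|[|[|//]]] h].
- by rewrite (_ : Ordinal h = 0) //; apply: val_inj.
- by rewrite (_ : Ordinal h = 1) //; apply: val_inj.
- by rewrite (_ : Ordinal h = 2%:R) //; apply: val_inj.
Qed.

Lemma coord_line (j k : 'I_3) (x : R3 R) (t : R) :
  coord j (x + t *: basis3 k) = coord j x + t * (j == k)%:R.
Proof.
by elim/ord3_ind: j; elim/ord3_ind: k; rewrite /coord /basis3 /=.
Qed.

Lemma is_derive_coord (j k : 'I_3) (x : R3 R) :
  is_derive x (basis3 k) (coord j) (j == k)%:R.
Proof.
apply: is_derive_at; under eq_fun do rewrite coord_line.
apply: is_derive_eq; rewrite scaler0 add0r /GRing.scale/=; ring.
Qed.

Variables (del theta : R).
Hypothesis del_gt0 : 0 < del.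
Hypothesis theta_gt : 2^-1 < theta.
Hypothesis theta_le1 : theta <= 1.

Definition sqn (x : R3 R) : R := \sum_(j < 3) coord j x ^+ 2.
Definition wq x : R := 1 + del ^+ 2 * sqn x.
(** All derivatives below are polynomials in these three powers of [q], in the partial derivatives
    [wc] of [q] and in the coordinates, so that [ring] and [field] can verify them. *)
Definition wP x : R := wq x `^ (- 2^-1).
Definition wS x : R := wq x `^ (- theta).
Definition wr x : R := (wq x)^-1.
Definition wc k x : R := 2 * del ^+ 2 * coord k x.

Lemma sqn_ge0 x : 0 <= sqn x.
Proof. by apply: sumr_ge0 => j _; exact: sqr_ge0. Qed.

Lemma wq_ge1 x : 1 <= wq x.
Proof. by rewrite lerDl mulr_ge0 ?sqr_ge0 ?sqn_ge0. Qed.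

Lemma wq_gt0 x : 0 < wq x.
Proof. exact: lt_le_trans (wq_ge1 x). Qed.

Lemma is_derive_wq k x : is_derive x (basis3 k) wq (wc k x).
Proof.
have hc j := is_derive_coord j k x.
have h : is_derive x (basis3 k) (fun y => 1 + del ^+ 2 * (coord 0 y * coord 0 y +
    coord 1 y * coord 1 y + coord 2%:R y * coord 2%:R y))
    (del ^+ 2 * (2 * coord 0 x * (0 == k)%:R + 2 * coord 1 x * (1 == k)%:R +
        2 * coord 2%:R x * (2%:R == k)%:R)).
  apply: is_derive_eq; rewrite /GRing.scale /=; ring.
apply: (is_derive_ext h); first by move=> y; rewrite /wq /sqn sum3 !expr2.
by rewrite /wc; elim/ord3_ind: k {hc h} => /=; ring.
Qed.

Lemma wr_powR x : wr x = wq x `^ (-1).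
Proof. by rewrite powR_inv1 // ltW // wq_gt0. Qed.

Lemma is_derive_wpow (p : R) k x :
  is_derive x (basis3 k) (fun y => wq y `^ p) (p * (wq x `^ p * wr x) * wc k x).
Proof.
have h := is_derive_comp_line (is_derive_wq k x) (is_derive1_powR p (wq_gt0 x)).
apply: (is_derive_ext h) => //; congr (_ * _ * _).
by rewrite wr_powR powRD // (gt_eqF (wq_gt0 x)) implybT.
Qed.

Lemma is_derive_wP k x : is_derive x (basis3 k) wP (- 2^-1 * (wP x * wr x) * wc k x).
Proof. exact: is_derive_wpow. Qed.

Lemma is_derive_wS k x : is_derive x (basis3 k) wS (- theta * (wS x * wr x) * wc k x).
Proof. exact: is_derive_wpow. Qed.

Lemma is_derive_wr k x : is_derive x (basis3 k) wr (- wr x ^+ 2 * wc k x).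
Proof.
apply: (is_derive_ext (is_derive_wpow (-1) k x)); first by move=> y; rewrite wr_powR.
by rewrite -wr_powR; ring.
Qed.

Lemma is_derive_wc j k x :
  is_derive x (basis3 k) (wc j) (2 * del ^+ 2 * (j == k)%:R).
Proof.
have hc := is_derive_coord j k x.
by rewrite /wc; apply: is_derive_eq; rewrite /GRing.scale /=; ring.
Qed.

(* The vector field [x a(q)] of the virial identity, [a(q) = 2 q^(-1/2) - q^(-theta)]
   with [q = 1 + del^2 |x|^2]: bounded since [a = O(q^(-1/2))], while its
   derivative is bounded below by [(2 theta - 1) q^(-theta)]. *)
Definition va x : R := 2 * wP x - wS x.
Definition va' x : R := - (wP x * wr x) + theta * (wS x * wr x).
Definition vg k x : R := coord k x * va x.
Definition vDg j k x : R := (j == k)%:R * va x + coord k x * wc j x * va' x.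
(** The divergence [3 a + 2 (q - 1) a'] of the field, expanded by means of
    [(q - 1) / q = 1 - 1 / q]; [vd'] is its derivative with respect to [q]. *)
Definition vd x : R := 4 * wP x - (3 - 2 * theta) * wS x + 2 * (wP x * wr x)
  - 2 * theta * (wS x * wr x).
Definition vd' x : R := - 2 * (wP x * wr x) + theta * (3 - 2 * theta) * (wS x * wr x)
  - 3 * (wP x * wr x ^+ 2) + 2 * theta * (theta + 1) * (wS x * wr x ^+ 2).
Definition vdd j x : R := wc j x * vd' x.

Lemma is_derive_va j x : is_derive x (basis3 j) va (wc j x * va' x).
Proof.
have hP := is_derive_wP j x; have hS := is_derive_wS j x.
by rewrite /va; apply: is_derive_eq; rewrite /GRing.scale /= /va'; field.
Qed.

Lemma is_derive_vg j k x : is_derive x (basis3 j) (vg k) (vDg j k x).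
Proof.
have ha := is_derive_va j x; have hc := is_derive_coord k j x.
rewrite /vg; apply: is_derive_eq; rewrite /GRing.scale /= /vDg (eq_sym j k); ring.
Qed.

Lemma is_derive_vd j x : is_derive x (basis3 j) vd (vdd j x).
Proof.
have hP := is_derive_wP j x; have hS := is_derive_wS j x.
have hr := is_derive_wr j x.
by rewrite /vd; apply: is_derive_eq; rewrite /GRing.scale /= /vdd /vd'; field.
Qed.

Lemma wqr x : wq x * wr x = 1.
Proof. by rewrite mulfV // gt_eqF // wq_gt0. Qed.

Lemma sqn_wr x : del ^+ 2 * sqn x * wr x = 1 - wr x.
Proof. by rewrite -(wqr x) /wq; ring. Qed.

Lemma vd_sum x : vd x = \sum_(j < 3) vDg j j x.
Proof.
have h := sqn_wr x; rewrite /sqn sum3 in h.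
rewrite sum3 /vDg /= /wc /vd /va /va'; set n := _ + _ + _ in h.
transitivity (3 * (2 * wP x - wS x) + 2 * (del ^+ 2 * n * wr x) * (theta * wS x - wP x)).
  by rewrite h; ring.
by rewrite /n; ring.
Qed.

Lemma wr_gt0 x : 0 < wr x. Proof. by rewrite invr_gt0 wq_gt0. Qed.

Lemma wr_le1 x : wr x <= 1.
Proof. by rewrite invf_le1 ?wq_gt0 // wq_ge1. Qed.

Lemma wP_gt0 x : 0 < wP x. Proof. by rewrite powR_gt0 // wq_gt0. Qed.

Lemma wS_gt0 x : 0 < wS x. Proof. by rewrite powR_gt0 // wq_gt0. Qed.

Lemma wP_sq x : wP x ^+ 2 = wr x.
Proof.
rewrite wr_powR expr2 /wP -powRD; last by rewrite (gt_eqF (wq_gt0 x)) implybT.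
by congr (_ `^ _); field.
Qed.

Lemma wS_le x : wS x <= wP x.
Proof. by rewrite ler_powR ?wq_ge1 // lerN2 ltW. Qed.

Lemma wr_leS x : wr x <= wS x.
Proof. by rewrite wr_powR ler_powR ?wq_ge1 // lerN2. Qed.

Lemma wP_le1 x : wP x <= 1.
Proof.
by rewrite -(powRr0 (wq x)) ler_powR ?wq_ge1 // oppr_le0 invr_ge0.
Qed.

Lemma coord_sq_le j x : coord j x ^+ 2 <= sqn x.
Proof.
rewrite /sqn sum3; elim/ord3_ind: j;
  have := sqr_ge0 (coord 0 x); have := sqr_ge0 (coord 1 x);
  have := sqr_ge0 (coord 2%:R x); lra.
Qed.

Lemma coord_wr j x : del ^+ 2 * coord j x ^+ 2 * wr x <= 1.
Proof.
have h := sqn_wr x; have r0 := wr_gt0 x.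
apply: (@le_trans _ _ (del ^+ 2 * sqn x * wr x)); last by rewrite h lerBlDr lerDl ltW.
by rewrite ler_pM2r // ler_wpM2l ?sqr_ge0 // coord_sq_le.
Qed.

Lemma theta_ge0 : 0 <= theta. Proof. by apply: ltW; apply: lt_trans theta_gt. Qed.

Lemma va'_le0 x : va' x <= 0.
Proof.
have h : theta * wS x <= wP x.
  by apply: le_trans (wS_le x); rewrite ler_piMl // ltW // wS_gt0.
have := ler_wpM2r (ltW (wr_gt0 x)) h; rewrite /va'; lra.
Qed.

Lemma va'_ge x : - (wP x * wr x) <= va' x.
Proof.
have h := mulr_ge0 theta_ge0 (mulr_ge0 (ltW (wS_gt0 x)) (ltW (wr_gt0 x))).
by rewrite /va' lerDl.
Qed.

Lemma va_bounds x : 0 <= va x <= 2 * wP x.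
Proof.
by have := wS_gt0 x; have := wS_le x; have := wP_gt0 x; rewrite /va; lra.
Qed.

Lemma sqr_le_norm (y z : R) : `|y| <= z -> y ^+ 2 <= z ^+ 2.
Proof.
move=> h; rewrite -(real_normK (num_real y)) ler_pXn2r // nnegrE //.
exact: le_trans h.
Qed.

(** [a^2 <= 4 / q], whereas [del^2 x_k^2 <= q]. *)
Lemma vg_le k x : vg k x ^+ 2 <= (2 / del) ^+ 2.
Proof.
have /andP[a0 a1] := va_bounds x.
have a2 : va x ^+ 2 <= 4 * wr x.
  rewrite -wP_sq -[4](_ : 2 ^+ 2 = _); last by rewrite -natrX.
  by rewrite -exprMn sqr_le_norm // ger0_norm.
have d2 : 0 < del ^+ 2 by rewrite exprn_gt0.
have dn : del != 0 by rewrite gt_eqF.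
rewrite /vg exprMn -(ler_pM2l d2).
have -> : del ^+ 2 * (2 / del) ^+ 2 = 4 by field.
apply: (@le_trans _ _ (del ^+ 2 * (coord k x ^+ 2 * (4 * wr x)))).
  by rewrite ler_wpM2l ?ler_wpM2l ?sqr_ge0.
by have := coord_wr k x; lra.
Qed.

Lemma vDg_le j k x : vDg j k x ^+ 2 <= 16.
Proof.
have -> : 16 = 4 ^+ 2 :> R by rewrite -natrX.
have /andP[a0 a1] := va_bounds x; have p1 := wP_le1 x; have p0 := wP_gt0 x.
have r0 := wr_gt0 x.
apply: sqr_le_norm; apply: (le_trans (ler_normD _ _)).
have h1 : `|(j == k)%:R * va x| <= 2.
  rewrite normrM (ger0_norm a0); have b : `|(j == k)%:R : R| <= 1.
    by case: (j == k); rewrite ?normr0 ?normr1.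
  have := ler_wpM2r a0 b; lra.
have h2 : `|coord k x * wc j x * va' x| <= 2.
  have c : `|del ^+ 2 * (coord k x * coord j x) * wr x| <= 1.
    have d2 : 0 <= del ^+ 2 * wr x by rewrite mulr_ge0 ?sqr_ge0 // ltW.
    have e1 := mulr_ge0 d2 (sqr_ge0 (coord k x - coord j x)).
    have e2 := mulr_ge0 d2 (sqr_ge0 (coord k x + coord j x)).
    have f1 := coord_wr j x; have f2 := coord_wr k x.
    by rewrite ler_norml; apply/andP; split; lra.
  have n : `|va' x| <= wP x * wr x.
    by rewrite ler0_norm ?va'_le0 // lerNl va'_ge.
  rewrite /wc normrM; apply: (le_trans (ler_wpM2l (normr_ge0 _) n)).
  rewrite -[wP x * wr x]ger0_norm; last by rewrite mulr_ge0 // ltW.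
  rewrite -normrM.
  have -> : coord k x * (2 * del ^+ 2 * coord j x) * (wP x * wr x) =
     (del ^+ 2 * (coord k x * coord j x) * wr x) * (2 * wP x) by ring.
  rewrite normrM [`|2 * _|]ger0_norm; last by rewrite mulr_ge0 // ltW.
  have := ler_wpM2r (_ : 0 <= 2 * wP x) c; rewrite mul1r => cc.
  by have := cc (mulr_ge0 (ler0n _ _) (ltW p0)); lra.
lra.
Qed.

Lemma vd_le x : vd x ^+ 2 <= 121.
Proof.
have -> : 121 = 11 ^+ 2 :> R by rewrite -natrX.
have p1 := wP_le1 x; have p0 := wP_gt0 x; have r0 := wr_gt0 x; have r1 := wr_le1 x.
have s0 := wS_gt0 x; have sp := wS_le x.
have pn := ltW p0; have rn := ltW r0; have sn := ltW s0.
have th0 := theta_ge0; have th1 := theta_le1.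
apply: sqr_le_norm.
have e1 : 0 <= wP x * wr x <= 1.
  by rewrite mulr_ge0 //= mulr_ile1.
have e2 : 0 <= wS x * wr x <= 1.
  by rewrite mulr_ge0 //= mulr_ile1 // (le_trans sp).
have e3 : 0 <= theta * (wS x * wr x) <= 1.
  by case/andP: e2 => *; rewrite mulr_ge0 //= mulr_ile1.
have e4 : 0 <= theta * wS x <= 1.
  by rewrite mulr_ge0 //= mulr_ile1 // (le_trans sp).
case/andP: e1 => *; case/andP: e2 => *; case/andP: e3 => *; case/andP: e4 => *.
by rewrite /vd ler_norml; apply/andP; split; lra.
Qed.

Lemma vd'_le x : `|vd' x| <= 11 * (wP x * wr x).
Proof.
have p1 := wP_le1 x; have p0 := wP_gt0 x; have r0 := wr_gt0 x; have r1 := wr_le1 x.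
have s0 := wS_gt0 x; have sp := wS_le x.
have pn := ltW p0; have rn := ltW r0; have sn := ltW s0.
have th0 := theta_ge0; have th1 := theta_le1.
have e1 : 0 <= wS x * wr x <= wP x * wr x by rewrite mulr_ge0 //= ler_wpM2r // ltW.
have e2 : 0 <= wP x * wr x ^+ 2 <= wP x * wr x.
  rewrite mulr_ge0 ?sqr_ge0 //= ler_wpM2l // expr2.
  by rewrite ler_piMl // ltW.
have e3 : 0 <= wS x * wr x ^+ 2 <= wP x * wr x.
  rewrite mulr_ge0 ?sqr_ge0 //=; case/andP: e2 => _; apply: le_trans.
  by rewrite ler_wpM2r // sqr_ge0.
have e4 : 0 <= theta * (3 - 2 * theta) <= 2.
  rewrite mulr_ge0 //=; last by lra.
  have := sqr_ge0 (theta - 1); have := sqr_ge0 theta; lra.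
have e5 : 0 <= theta * (theta + 1) <= 2.
  rewrite mulr_ge0 //=; last by lra.
  have : theta * theta <= 1 by rewrite mulr_ile1.
  lra.
have e6 : 0 <= theta * (3 - 2 * theta) * (wS x * wr x) <= 2 * (wP x * wr x).
  case/andP: e4 => a b; case/andP: e1 => c d.
  by rewrite mulr_ge0 //= ler_pM.
have e7 : 0 <= theta * (theta + 1) * (wS x * wr x ^+ 2) <= 2 * (wP x * wr x).
  case/andP: e5 => a b; case/andP: e3 => c d.
  by rewrite mulr_ge0 //= ler_pM.
case/andP: e2 => *; case/andP: e6 => *; case/andP: e7 => *.
by rewrite /vd' ler_norml; apply/andP; split; lra.
Qed.

(** The field varies on the scale [1 / del], so the gradient of its divergence gains a factor [del].
    It also decays at least like [1 / q <= q^(-theta)], hence it is absorbed by the Jacobian bound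
    when [del] is small against [2 theta - 1]. *)
Lemma vdd_le j x : vdd j x ^+ 2 <= (22 * del * wS x) ^+ 2.
Proof.
have r0 := wr_gt0 x; have d0 := del_gt0.
have h : vd' x ^+ 2 <= 121 * wr x ^+ 3.
  have -> : 121 * wr x ^+ 3 = (11 * (wP x * wr x)) ^+ 2.
    by rewrite !exprMn wP_sq; ring.
  exact: sqr_le_norm (vd'_le x).
rewrite /vdd /wc exprMn.
have c0 : 0 <= (2 * del ^+ 2 * coord j x) ^+ 2 by exact: sqr_ge0.
apply: (le_trans (ler_wpM2l c0 h)).
have -> : (2 * del ^+ 2 * coord j x) ^+ 2 * (121 * wr x ^+ 3) =
   (22 * del * wr x) ^+ 2 * (del ^+ 2 * coord j x ^+ 2 * wr x) by ring.
apply: (@le_trans _ _ ((22 * del * wr x) ^+ 2)).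
  by rewrite ler_piMr ?sqr_ge0 // coord_wr.
have rs := wr_leS x.
rewrite !(exprMn _ (22 * del)) ler_wpM2l ?sqr_ge0 //.
by rewrite sqr_le_norm // ger0_norm // ltW.
Qed.

(** The Jacobian is [a] on tangential directions and [a + 2 (q - 1) a'] on the radial one. As
    [a' <= 0], the radial value is the smaller; it equals [(2 theta - 1) q^(-theta) + 2 q^(-1)
    (q^(-1/2) - theta q^(-theta))], whose second summand is nonnegative. *)
Lemma hessian_ge (U : 'I_3 -> 'cV[R[i]]_4) x :
  (2 * theta - 1) * wS x * \sum_(k < 3) ip (U k) (U k) <=
  \sum_(j < 3) \sum_(k < 3) vDg j k x * ip (U j) (U k).
Proof.
have a'0 := va'_le0 x; have h := sqn_wr x; have r0 := wr_gt0 x.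
set X := \sum_(k < 3) ip (U k) (U k).
pose Y := \sum_(j < 3) \sum_(k < 3) coord j x * coord k x * ip (U j) (U k).
have -> : \sum_(j < 3) \sum_(k < 3) vDg j k x * ip (U j) (U k) =
    va x * X + 2 * del ^+ 2 * va' x * Y.
  by rewrite /X /Y /vDg /wc !sum3 /=; ring.
have XY : Y <= sqn x * X.
  have q1 := ip_ge0 (rscale (coord 0 x) (U 1) - rscale (coord 1 x) (U 0)).
  have q2 := ip_ge0 (rscale (coord 0 x) (U 2%:R) - rscale (coord 2%:R x) (U 0)).
  have q3 := ip_ge0 (rscale (coord 1 x) (U 2%:R) - rscale (coord 2%:R x) (U 1)).
  rewrite !ipE (ipC (U 1) (U 0)) in q1; rewrite !ipE (ipC (U 2%:R) (U 0)) in q2.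
  rewrite !ipE (ipC (U 2%:R) (U 1)) in q3.
  rewrite /X /Y /sqn !sum3 (ipC (U 1) (U 0)) (ipC (U 2%:R) (U 0)) (ipC (U 2%:R) (U 1)).
  lra.
have X0 : 0 <= X by apply: sumr_ge0 => k _; exact: ip_ge0.
have c0 : 2 * del ^+ 2 * va' x <= 0 by rewrite mulr_ge0_le0 // mulr_ge0 // sqr_ge0.
have := ler_wnM2l c0 XY.
have e : va x + 2 * del ^+ 2 * va' x * sqn x =
  (2 * theta - 1) * wS x + 2 * wr x * (wP x - theta * wS x).
  rewrite /va /va'.
  transitivity (2 * wP x - wS x + 2 * (del ^+ 2 * sqn x * wr x) * (theta * wS x - wP x)).
    by ring.
  by rewrite h; ring.
have p : 0 <= wP x - theta * wS x.
  rewrite subr_ge0; apply: le_trans (wS_le x).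
  by rewrite ler_piMl // ltW // wS_gt0.
have := mulr_ge0 (mulr_ge0 (mulr_ge0 (ler0n R 2) (ltW r0)) p) X0.
have := congr1 (fun y => y * X) e; lra.
Qed.

Lemma derivable_line_continuous3 j (f df : R3 R -> R) :
  (forall x, is_derive x (basis3 j) f (df x)) -> line_continuous (basis3 j) f.
Proof. by move=> h x; exact: (derivable_line_continuous (x := x) h). Qed.

Lemma line_continuous_wP j : line_continuous (basis3 j) wP.
Proof. exact: derivable_line_continuous3 (is_derive_wP j). Qed.
Lemma line_continuous_wS j : line_continuous (basis3 j) wS.
Proof. exact: derivable_line_continuous3 (is_derive_wS j). Qed.
Lemma line_continuous_wr j : line_continuous (basis3 j) wr.
Proof. exact: derivable_line_continuous3 (is_derive_wr j). Qed.
Lemma line_continuous_wc k j : line_continuous (basis3 j) (wc k).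
Proof. exact: derivable_line_continuous3 (is_derive_wc k j). Qed.
Lemma line_continuous_coord k j : line_continuous (basis3 j) (coord k).
Proof. exact: derivable_line_continuous3 (is_derive_coord k j). Qed.
End weights.

(** * The Dirac matrices as real-linear maps, and the square of the Dirac operator *)

Section dirac_algebra.
Context {R : realType}.
Local Notation V := 'cV[R[i]]_4.
Implicit Types (M : 'M[R[i]]_4) (a b v : V).

Lemma ip_herm a b : ip a b = complex.Re (\sum_(k < 4) conjc (a k 0) * b k 0).
Proof.
rewrite (raddf_sum (@complex.Re R)); apply: eq_bigr => k _.
by case: (a k 0) (b k 0) => [? ?] [? ?] /=; ring.
Qed.

Lemma ip_mull M a b : ip (M *m a) b = ip a ((map_mx conjc M^T) *m b).
Proof.
rewrite !ip_herm; congr (complex.Re _).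
under eq_bigr => k _ do rewrite mxE rmorph_sum mulr_suml.
rewrite exchange_big; apply: eq_bigr => k _ /=.
rewrite mxE mulr_sumr; apply: eq_bigr => l _.
by rewrite !mxE rmorphM /=; ring.
Qed.

Variables (alpha : 'I_4 -> 'M[R[i]]_4).
Hypothesis alpha_dirac : dirac_matrices alpha.

Definition ci : R[i] := 0 +i* 1.
(** The factor [-i] turns the Hermitian matrix into a skew isometry with square -1 and absorbs the
    [-i] of the differential operator. *)
Definition Am (j : 'I_3) : 'M[R[i]]_4 := - ci *: alpha (lift ord_max j).
Definition Bm : 'M[R[i]]_4 := alpha ord_max.
Definition Jm : 'M[R[i]]_4 := ci%:M.
Definition dA j v : V := Am j *m v.
Definition dB v : V := Bm *m v.
Definition dJ v : V := Jm *m v.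

Lemma ci_sq : ci * ci = - 1.
Proof. by apply/eqP; rewrite eq_complex /=; apply/andP; split; apply/eqP; ring. Qed.

Lemma alpha_adj j : map_mx conjc (alpha j)^T = alpha j.
Proof.
have /is_hermitianmxP := alpha_dirac.1 j; rewrite expr0 scale1r => e.
by rewrite [RHS]e.
Qed.

Lemma alpha_sq j : alpha j *m alpha j = 1%:M.
Proof.
have := alpha_dirac.2 j j; rewrite eqxx mulr1 -mulr2n => h.
have two : (2 : R[i]) != 0 by rewrite pnatr_eq0.
apply: (scalerI two); rewrite -scaler_nat in h; rewrite h.
by rewrite -scalemx1 .
Qed.

Lemma alpha_anti j k : j != k -> alpha j *m alpha k = - (alpha k *m alpha j).
Proof.
move=> jk; have := alpha_dirac.2 j k; rewrite (negbTE jk) mulr0.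
by move=> h; apply/eqP; rewrite -addr_eq0 h; apply/eqP/matrixP => x y; rewrite !mxE mul0rn.
Qed.

Lemma Am_sq j v : dA j (dA j v) = - v.
Proof.
have e : Am j *m Am j = - 1%:M.
  by rewrite /Am -scalemxAl -scalemxAr scalerA alpha_sq mulrNN ci_sq scaleN1r.
by rewrite /dA mulmxA e mulNmx mul1mx.
Qed.

Lemma Am_anti j k v : j != k -> dA j (dA k v) = - dA k (dA j v).
Proof.
move=> jk; have jk' : lift ord_max j != lift ord_max k by rewrite (inj_eq lift_inj).
have e : Am j *m Am k = - (Am k *m Am j).
  by rewrite /Am -!scalemxAl -!scalemxAr (alpha_anti jk') !scalerN.
by rewrite /dA !mulmxA e mulNmx.
Qed.

Lemma Am_B j v : dA j (dB v) = - dB (dA j v).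
Proof.
have jk : lift ord_max j != ord_max by rewrite eq_sym neq_lift.
have e : Am j *m Bm = - (Bm *m Am j).
  by rewrite /Am /Bm -!scalemxAl -!scalemxAr (alpha_anti jk) !scalerN.
by rewrite /dA /dB !mulmxA e mulNmx.
Qed.

Lemma Bm_sq v : dB (dB v) = v.
Proof. by rewrite /dB mulmxA alpha_sq mul1mx. Qed.

Lemma dJE v : dJ v = ci *: v. Proof. exact: mul_scalar_mx. Qed.

Lemma dA_skew j a b : ip (dA j a) b = - ip a (dA j b).
Proof.
rewrite ip_mull -ipNr /dA -mulNmx; congr (ip a (_ *m b)).
rewrite /Am linearZ /= map_mxZ alpha_adj -scaleNr; congr (_ *: _).
by apply/eqP; rewrite eq_complex /= !oppr0 !opprK !eqxx.
Qed.

Lemma dB_sym a b : ip (dB a) b = ip a (dB b).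
Proof. by rewrite ip_mull alpha_adj. Qed.

Lemma dJ_skew a b : ip (dJ a) b = - ip a (dJ b).
Proof.
rewrite ip_mull -ipNr /dJ -mulNmx; congr (ip a (_ *m b)).
apply/matrixP => x y; rewrite !mxE (eq_sym y x).
by case: (x == y); rewrite ?mulr0n ?mulr1n; apply/eqP; rewrite eq_complex /= !oppr0 ?eqxx.
Qed.

Lemma dA_iso j a : ip (dA j a) (dA j a) = ip a a.
Proof. by rewrite dA_skew Am_sq ipNr opprK. Qed.

Lemma dB_iso a : ip (dB a) (dB a) = ip a a.
Proof. by rewrite dB_sym Bm_sq. Qed.

Lemma dJ_iso a : ip (dJ a) (dJ a) = ip a a.
Proof. by rewrite dJ_skew !dJE scalerA ci_sq scaleN1r ipNr opprK. Qed.

Lemma dJB a : dJ (dB a) = dB (dJ a).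
Proof. by rewrite !dJE /dB scalemxAr. Qed.

Lemma dJA j a : dJ (dA j a) = dA j (dJ a).
Proof. by rewrite !dJE /dA scalemxAr. Qed.

Lemma scale_complexE (x y : R) a : (x +i* y) *: a = rscale x a + rscale y (dJ a).
Proof.
rewrite dJE /rscale scalerA -scalerDl; congr (_ *: _).
by apply/eqP; rewrite eq_complex /=; apply/andP; split; apply/eqP; ring.
Qed.

(** This supplies [eq_dW]. The mixed second derivatives cancel because the matrices anticommute
    while [UU] is symmetric; the diagonal ones give the Laplacian because each [A_j] has square
    -1. *)
Lemma dirac_square (lam mu : R) (u f : V) (U F : 'I_3 -> V) (UU : 'I_3 -> 'I_3 -> V) :
  (forall j k, UU j k = UU k j) ->
  f = \sum_(j < 3) dA j (U j) + dB u - (lam +i* mu) *: u ->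
  (forall k, F k = \sum_(j < 3) dA j (UU k j) + dB (U k) - (lam +i* mu) *: U k) ->
  \sum_(j < 3) (dA j (F j) + UU j j) =
  - (dB f + rscale lam f + rscale mu (dJ f)) + rscale (1 - lam ^+ 2 + mu ^+ 2) u
  - rscale (2 * lam * mu) (dJ u).
Proof.
move=> UUs fE FE; set z := lam +i* mu in fE FE.
have s : \sum_(j < 3) dA j (U j) = f - dB u + z *: u.
  by rewrite fE (addrAC _ (- (z *: u))) addrK subrK.
have h1 : \sum_(j < 3) (dA j (F j) + UU j j) =
    - dB (\sum_(j < 3) dA j (U j)) - z *: \sum_(j < 3) dA j (U j).
  have e j : dA j (F j) = \sum_(k < 3) dA j (dA k (UU j k)) - dB (dA j (U j))
      - z *: dA j (U j).
    by rewrite FE {1}/dA mulmxBr mulmxDr mulmx_sumr -scalemxAr -Am_B.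
  have e10 v : dA 1 (dA 0 v) = - dA 0 (dA 1 v) by exact: Am_anti.
  have e20 v : dA 2%:R (dA 0 v) = - dA 0 (dA 2%:R v) by exact: Am_anti.
  have e21 v : dA 2%:R (dA 1 v) = - dA 1 (dA 2%:R v) by exact: Am_anti.
  rewrite (eq_bigr _ (fun j _ => congr1 (fun v => v + UU j j) (e j))) !sum3.
  rewrite (Am_sq 0) (Am_sq 1) (Am_sq 2%:R) (UUs 1 0) (UUs 2%:R 0) (UUs 2%:R 1).
  rewrite e10 e20 e21.
  have -> : dB (dA 0 (U 0) + dA 1 (U 1) + dA 2%:R (U 2%:R)) =
     dB (dA 0 (U 0)) + dB (dA 1 (U 1)) + dB (dA 2%:R (U 2%:R)) by rewrite /dB !mulmxDr.
  rewrite !scalerDr.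
  move: (dB (dA 0 (U 0))) (dB (dA 1 (U 1))) (dB (dA 2%:R (U 2%:R)))
    (z *: dA 0 (U 0)) (z *: dA 1 (U 1)) (z *: dA 2%:R (U 2%:R))
    (dA 0 (dA 1 (UU 0 1))) (dA 0 (dA 2%:R (UU 0 2%:R)))
    (dA 1 (dA 2%:R (UU 1 2%:R))) (UU 0 0) (UU 1 1) (UU 2%:R 2%:R).
  move=> b0 b1 b2 c0 c1 c2 a1 a2 a3 u0 u1 u2.
  by apply/matrixP => x y; rewrite !mxE; ring.
have zz : z * z = (lam ^+ 2 - mu ^+ 2) +i* (2 * lam * mu).
  by apply/eqP; rewrite eq_complex /=; apply/andP; split; apply/eqP; ring.
rewrite h1 s.
have -> : dB f + rscale lam f + rscale mu (dJ f) = dB f + z *: f.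
  by rewrite -addrA -(scale_complexE lam mu f).
rewrite -[RHS]addrA.
have -> : rscale (1 - lam ^+ 2 + mu ^+ 2) u - rscale (2 * lam * mu) (dJ u) =
   u - (z * z) *: u.
  rewrite zz scale_complexE opprD addrA; congr (_ - _).
  rewrite /rscale -[X in _ = X - _]scale1r -scalerBl; congr (_ *: _).
  by apply/eqP; rewrite eq_complex /=; apply/andP; split; apply/eqP; ring.
rewrite {1}/dB mulmxDr mulmxBr -!/(dB _) Bm_sq.
have -> : dB (z *: u) = z *: dB u by rewrite /dB -scalemxAr.
rewrite !scalerDr scalerN scalerA -!/(dB _).
move: (dB f) (z *: f) (z *: dB u) ((z * z) *: u) => b1 b2 b3 b4.
by apply/matrixP => x y; rewrite !mxE; ring.
Qed.
End dirac_algebra.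

(** * The weighted estimate for smooth spinors *)

Section square_integrable.
Context {R : realType}.
Local Notation mR3 := (R3 (measurableTypeR R)).
Implicit Types (a b u v : spinor R) (c : R3 R -> R).

Definition sqint u : Prop := spinor_measurable u /\
  (\int[leb3]_x (ip (u x) (u x))%:E < +oo)%E.

Lemma spinor_measurableD u v : spinor_measurable u -> spinor_measurable v ->
  spinor_measurable (fun x => u x + v x).
Proof.
move=> mu mv k; have [m1 m2] := mu k; have [m3 m4] := mv k; split.
  rewrite (_ : (fun x => _) = (fun x => complex.Re (u x k 0)) \+ (fun x => complex.Re (v x k 0))).
    exact: measurable_funD.
  by apply/funext => x; rewrite /= mxE; case: (u x k 0) (v x k 0) => [? ?] [? ?].
rewrite (_ : (fun x => _) = (fun x => complex.Im (u x k 0)) \+ (fun x => complex.Im (v x k 0))).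
  exact: measurable_funD.
by apply/funext => x; rewrite /= mxE; case: (u x k 0) (v x k 0) => [? ?] [? ?].
Qed.

Lemma spinor_measurable_mx (M : 'M[R[i]]_4) u : spinor_measurable u ->
  spinor_measurable (fun x => M *m u x).
Proof.
move=> mu k; split.
  rewrite (_ : (fun x => _) = (fun x => \sum_(i < 4)
     (complex.Re (M k i) * complex.Re (u x i 0) - complex.Im (M k i) * complex.Im (u x i 0)))).
    apply: measurable_sum => i; have [m1 m2] := mu i.
    by apply: measurable_funB; apply: measurable_funM.
  apply/funext => x; rewrite mxE (raddf_sum (@complex.Re R)); apply: eq_bigr => i _.
  by case: (M k i) (u x i 0) => [? ?] [? ?].
rewrite (_ : (fun x => _) = (fun x => \sum_(i < 4)
   (complex.Re (M k i) * complex.Im (u x i 0) + complex.Im (M k i) * complex.Re (u x i 0)))).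
  apply: measurable_sum => i; have [m1 m2] := mu i.
  by apply: measurable_funD; apply: measurable_funM.
apply/funext => x; rewrite mxE (raddf_sum (@complex.Im R)); apply: eq_bigr => i _.
by case: (M k i) (u x i 0) => [? ?] [? ?].
Qed.

Lemma measurable_ip u v : spinor_measurable u -> spinor_measurable v ->
  measurable_fun setT (fun x => ip (u x) (v x)).
Proof.
move=> mu mv; apply: measurable_sum => k; have [m1 m2] := mu k; have [m3 m4] := mv k.
by apply: measurable_funD; apply: measurable_funM.
Qed.

Lemma ip_le_half (a b : 'cV[R[i]]_4) : `|ip a b| <= 2^-1 * (ip a a + ip b b).
Proof.
have := ip_ge0 (a + b); have := ip_ge0 (a - b); rewrite !ipE (ipC b a) => h1 h2.
by rewrite ler_norml; apply/andP; split; lra.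
Qed.

Lemma sqint_integrable u : sqint u ->
  leb3.-integrable [set: mR3] (fun x => (ip (u x) (u x))%:E).
Proof.
move=> [mu iu]; apply/integrableP; split.
  by apply/measurable_EFinP; exact: measurable_ip.
apply: le_lt_trans iu; rewrite le_eqVlt; apply/orP; left; apply/eqP.
by apply: eq_integral => x _; rewrite gee0_abs // lee_fin ip_ge0.
Qed.

Lemma integrable_coef_ip c u v (K : R) : measurable_fun setT c ->
  (forall x, `|c x| <= K) -> sqint u -> sqint v ->
  leb3.-integrable [set: mR3] (fun x => (c x * ip (u x) (v x))%:E).
Proof.
move=> mc cK su sv.
have K0 : 0 <= K := le_trans (normr_ge0 _) (cK 0).
have i1 : leb3.-integrable [set: mR3]
    (fun x => (K%:E * ((ip (u x) (u x))%:E + (ip (v x) (v x))%:E))%E).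
  by apply: integrableZl => //; apply: integrableD => //; exact: sqint_integrable.
apply: (le_integrable _ _ _ i1) => //.
  apply/measurable_EFinP; apply: measurable_funM => //.
  by apply: measurable_ip; [exact: su.1|exact: sv.1].
move=> x _; rewrite -EFinD -EFinM !abse_EFin lee_fin !normrM.
have n0 : 0 <= ip (u x) (u x) + ip (v x) (v x) by rewrite addr_ge0 ?ip_ge0.
rewrite (ger0_norm K0) (ger0_norm n0); apply: ler_pM => //.
by apply: le_trans (ip_le_half _ _) _; lra.
Qed.

Lemma sqint_dominated u v (K : R) : spinor_measurable u ->
  (forall x, ip (u x) (u x) <= K * ip (v x) (v x)) -> sqint v -> sqint u.
Proof.
move=> mu uv sv; split => //.
have i1 : leb3.-integrable [set: mR3] (fun x => (K%:E * (ip (v x) (v x))%:E)%E).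
  by apply: integrableZl => //; exact: sqint_integrable.
apply: (@le_lt_trans _ _ (\int[leb3]_x (K%:E * (ip (v x) (v x))%:E))%E).
  apply: ge0_le_integral => //.
  - by move=> x _; rewrite lee_fin ip_ge0.
  - by apply/measurable_EFinP; exact: measurable_ip.
  - exact: measurable_int i1.
  - by move=> x _; rewrite -EFinM lee_fin; exact: uv.
exact: (integrable_lty measurableT i1).
Qed.

Lemma sqintD u v : sqint u -> sqint v -> sqint (fun x => u x + v x).
Proof.
move=> su sv; split; first by apply: spinor_measurableD; [exact: su.1|exact: sv.1].
have i1 : leb3.-integrable [set: mR3]
    (fun x => (2%:E * ((ip (u x) (u x))%:E + (ip (v x) (v x))%:E))%E).
  by apply: integrableZl => //; apply: integrableD => //; exact: sqint_integrable.
apply: (@le_lt_trans _ _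
  (\int[leb3]_x (2%:E * ((ip (u x) (u x))%:E + (ip (v x) (v x))%:E)))%E).
  apply: ge0_le_integral => //.
  - by move=> x _; rewrite lee_fin ip_ge0.
  - apply/measurable_EFinP; apply: measurable_ip;
      by apply: spinor_measurableD; [exact: su.1|exact: sv.1].
  - exact: measurable_int i1.
  - move=> x _; rewrite -EFinD -EFinM lee_fin.
    by have := ip_ge0 (u x - v x); rewrite !ipE (ipC (v x)); lra.
exact: (integrable_lty measurableT i1).
Qed.

End square_integrable.

(** * Fluxes and their zero-mean divergences *)

Section flux_functions.
Context {R : realType}.
Local Notation mR3 := (R3 (measurableTypeR R)).
Implicit Types (a b u v : spinor R) (c : R3 R -> R) (j : 'I_3).

Definition sder j u v : Prop := forall x k,
  is_derive x (basis3 j) (fun y => complex.Re (u y k 0)) (complex.Re (v x k 0)) /\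
  is_derive x (basis3 j) (fun y => complex.Im (u y k 0)) (complex.Im (v x k 0)).

Definition scont j u : Prop := forall k,
  line_continuous (basis3 j) (fun y => complex.Re (u y k 0)) /\
  line_continuous (basis3 j) (fun y => complex.Im (u y k 0)).

Lemma sder_cont j u v : sder j u v -> scont j u.
Proof.
move=> h k; split.
  exact: derivable_line_continuous3 (fun x => (h x k).1).
exact: derivable_line_continuous3 (fun x => (h x k).2).
Qed.

Lemma ReD (z w : R[i]) : complex.Re (z + w) = complex.Re z + complex.Re w.
Proof. by case: z w => [? ?] [? ?]. Qed.
Lemma ImD (z w : R[i]) : complex.Im (z + w) = complex.Im z + complex.Im w.
Proof. by case: z w => [? ?] [? ?]. Qed.
Lemma ReM (z w : R[i]) : complex.Re (z * w) =
  complex.Re z * complex.Re w - complex.Im z * complex.Im w.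
Proof. by case: z w => [? ?] [? ?]. Qed.
Lemma ImM (z w : R[i]) : complex.Im (z * w) =
  complex.Re z * complex.Im w + complex.Im z * complex.Re w.
Proof. by case: z w => [? ?] [? ?]. Qed.

Lemma sderD j u u' v v' : sder j u u' -> sder j v v' ->
  sder j (fun x => u x + v x) (fun x => u' x + v' x).
Proof.
move=> hu hv x k; have [u1 u2] := hu x k; have [v1 v2] := hv x k; split.
  rewrite (_ : (fun y => _) = (fun y => complex.Re (u y k 0)) + (fun y => complex.Re (v y k 0))).
    by rewrite mxE ReD; exact: is_deriveD.
  by apply/funext => y; rewrite mxE ReD.
rewrite (_ : (fun y => _) = (fun y => complex.Im (u y k 0)) + (fun y => complex.Im (v y k 0))).
  by rewrite mxE ImD; exact: is_deriveD.
by apply/funext => y; rewrite mxE ImD.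
Qed.

Lemma sder_mx j (M : 'M[R[i]]_4) u u' : sder j u u' ->
  sder j (fun x => M *m u x) (fun x => M *m u' x).
Proof.
move=> hu x k; split.
  have h (i : 'I_4) : is_derive x (basis3 j)
     (fun y => complex.Re (M k i) * complex.Re (u y i 0) - complex.Im (M k i) * complex.Im (u y i 0))
     (complex.Re (M k i * u' x i 0)).
    have [u1 u2] := hu x i; rewrite ReM.
    apply: is_derive_eq; rewrite /GRing.scale /=; ring.
  have hs := is_derive_sum h.
  apply: (is_derive_ext hs) => [y|]; rewrite mxE (raddf_sum (@complex.Re R)) ?fct_sumE //.
  by apply: eq_bigr => i _ /=; rewrite ReM.
have h (i : 'I_4) : is_derive x (basis3 j)
   (fun y => complex.Re (M k i) * complex.Im (u y i 0) + complex.Im (M k i) * complex.Re (u y i 0))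
   (complex.Im (M k i * u' x i 0)).
  have [u1 u2] := hu x i; rewrite ImM.
  apply: is_derive_eq; rewrite /GRing.scale /=; ring.
have hs := is_derive_sum h.
apply: (is_derive_ext hs) => [y|]; rewrite mxE (raddf_sum (@complex.Im R)) ?fct_sumE //.
by apply: eq_bigr => i _ /=; rewrite ImM.
Qed.

Lemma scontD j u v : scont j u -> scont j v -> scont j (fun x => u x + v x).
Proof.
move=> hu hv k; have [u1 u2] := hu k; have [v1 v2] := hv k; split.
  rewrite (_ : (fun y => _) = (fun y => complex.Re (u y k 0) + complex.Re (v y k 0))).
    exact: line_continuousD.
  by apply/funext => y; rewrite mxE ReD.
rewrite (_ : (fun y => _) = (fun y => complex.Im (u y k 0) + complex.Im (v y k 0))).
  exact: line_continuousD.
by apply/funext => y; rewrite mxE ImD.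
Qed.

Lemma scont_mx j (M : 'M[R[i]]_4) u : scont j u -> scont j (fun x => M *m u x).
Proof.
move=> hu k; split.
  rewrite (_ : (fun y => _) = (fun y => \sum_(i < 4)
     (complex.Re (M k i) * complex.Re (u y i 0) - complex.Im (M k i) * complex.Im (u y i 0)))).
    apply: line_continuous_sum => i; have [u1 u2] := hu i.
    apply: line_continuousD; last apply: line_continuousN;
      by apply: line_continuousM => //; exact: line_continuous_cst.
  apply/funext => y; rewrite mxE (raddf_sum (@complex.Re R)).
  by apply: eq_bigr => i _ /=; rewrite ReM.
rewrite (_ : (fun y => _) = (fun y => \sum_(i < 4)
   (complex.Re (M k i) * complex.Im (u y i 0) + complex.Im (M k i) * complex.Re (u y i 0)))).
  apply: line_continuous_sum => i; have [u1 u2] := hu i.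
  by apply: line_continuousD; apply: line_continuousM => //; exact: line_continuous_cst.
apply/funext => y; rewrite mxE (raddf_sum (@complex.Im R)).
by apply: eq_bigr => i _ /=; rewrite ImM.
Qed.

Lemma is_derive_ip j u u' v v' x : sder j u u' -> sder j v v' ->
  is_derive x (basis3 j) (fun y => ip (u y) (v y)) (ip (u' x) (v x) + ip (u x) (v' x)).
Proof.
move=> hu hv.
have h (k : 'I_4) : is_derive x (basis3 j)
   (fun y => complex.Re (u y k 0) * complex.Re (v y k 0) +
      complex.Im (u y k 0) * complex.Im (v y k 0))
   ((complex.Re (u' x k 0) * complex.Re (v x k 0) +
      complex.Im (u' x k 0) * complex.Im (v x k 0)) +
    (complex.Re (u x k 0) * complex.Re (v' x k 0) +
      complex.Im (u x k 0) * complex.Im (v' x k 0))).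
  have [u1 u2] := hu x k; have [v1 v2] := hv x k.
  apply: is_derive_eq; rewrite /GRing.scale /=; ring.
have hs := is_derive_sum h.
by apply: (is_derive_ext hs) => [y|]; rewrite /ip ?fct_sumE // -big_split.
Qed.

Lemma line_continuous_ip j u v : scont j u -> scont j v ->
  line_continuous (basis3 j) (fun x => ip (u x) (v x)).
Proof.
move=> hu hv; apply: line_continuous_sum => k.
have [u1 u2] := hu k; have [v1 v2] := hv k.
by apply: line_continuousD; apply: line_continuousM.
Qed.

(** The regularity of a spinor that makes its pairings admissible as fluxes: derivative and function
    are square integrable, and the derivative is continuous along lines. *)
Record sgood j a a' : Prop := Sgood {
  sg_der : sder j a a'; sg_cont : scont j a';
  sg_int : sqint a; sg_int' : sqint a' }.

Lemma sgoodD j u u' v v' : sgood j u u' -> sgood j v v' ->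
  sgood j (fun x => u x + v x) (fun x => u' x + v' x).
Proof.
move=> [a b c d] [a' b' c' d'].
by split; [exact: sderD|exact: scontD|exact: sqintD|exact: sqintD].
Qed.

Lemma sqint_mx (M : 'M[R[i]]_4) (K : R) u :
  (forall a : 'cV[R[i]]_4, ip (M *m a) (M *m a) = K * ip a a) ->
  sqint u -> sqint (fun x => M *m u x).
Proof.
move=> hM su; apply: (@sqint_dominated _ _ u K) => //.
  exact: spinor_measurable_mx su.1.
by move=> x; rewrite hM.
Qed.

Lemma sgood_mx j (M : 'M[R[i]]_4) (K : R) u u' :
  (forall a : 'cV[R[i]]_4, ip (M *m a) (M *m a) = K * ip a a) ->
  sgood j u u' -> sgood j (fun x => M *m u x) (fun x => M *m u' x).
Proof.
move=> hM [a b c d]; split;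
  [exact: sder_mx|exact: scont_mx|exact: sqint_mx hM _|exact: sqint_mx hM _].
Qed.

Record coef j c (c' : R3 R -> R) : Prop := Coef {
  coef_der : forall x, is_derive x (basis3 j) c (c' x);
  coef_cont : line_continuous (basis3 j) c';
  coef_meas : measurable_fun setT c; coef_meas' : measurable_fun setT c';
  coef_bound : exists K, forall x, `|c x| <= K;
  coef_bound' : exists K, forall x, `|c' x| <= K }.

(** The hypotheses of [integral_derivative0], bundled so as to be stable under linear
    combinations. *)
Record flux j (T dT : R3 R -> R) : Prop := Flux {
  flux_der : forall x, is_derive x (basis3 j) T (dT x);
  flux_cont : line_continuous (basis3 j) dT;
  flux_int : leb3.-integrable [set: mR3] (EFin \o T);
  flux_int' : leb3.-integrable [set: mR3] (EFin \o dT) }.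

Lemma fluxD j T dT T' dT' : flux j T dT -> flux j T' dT' ->
  flux j (fun x => T x + T' x) (fun x => dT x + dT' x).
Proof.
move=> [a b c d] [a' b' c' d']; split.
- by move=> x; have := is_deriveD (a x) (a' x).
- exact: line_continuousD.
- by have := integrableD measurableT c c'.
- by have := integrableD measurableT d d'.
Qed.

Lemma fluxZ j (r : R) T dT : flux j T dT ->
  flux j (fun x => r * T x) (fun x => r * dT x).
Proof.
move=> [a b c d]; split.
- by move=> x; have := is_deriveZ r (a x).
- by apply: line_continuousM => //; exact: line_continuous_cst.
- by have := integrableZl measurableT r c.
- by have := integrableZl measurableT r d.
Qed.

Lemma flux_sum j n (T dT : 'I_n -> R3 R -> R) : (forall i, flux j (T i) (dT i)) ->
  flux j (fun x => \sum_(i < n) T i x) (fun x => \sum_(i < n) dT i x).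
Proof.
move=> h; elim: n T dT h => [|n ih] T dT h.
  rewrite (_ : (fun x => \sum_(i < 0) T i x) = cst 0); last first.
    by apply/funext => x; rewrite big_ord0.
  rewrite (_ : (fun x => \sum_(i < 0) dT i x) = cst 0); last first.
    by apply/funext => x; rewrite big_ord0.
  split.
  - by move=> x; exact: is_derive_cst.
  - exact: line_continuous_cst.
  - exact: integrable0.
  - exact: integrable0.
rewrite (_ : (fun x => _) = (fun x => \sum_(i < n) T (widen_ord (leqnSn n) i) x + T ord_max x)).
  rewrite (_ : (fun x => \sum_(i < n.+1) dT i x) =
      (fun x => \sum_(i < n) dT (widen_ord (leqnSn n) i) x + dT ord_max x)).
    by apply: fluxD => //; apply: ih.
  by apply/funext => x; rewrite big_ord_recr.
by apply/funext => x; rewrite big_ord_recr.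
Qed.

Lemma flux_eq j T dT T' dT' : flux j T dT -> T =1 T' -> dT =1 dT' -> flux j T' dT'.
Proof. by move=> h /funext <- /funext <-. Qed.

(** The building block of all three fluxes: a bounded coefficient times two square integrable
    factors is integrable, and the product rule stays within such terms. *)
Lemma flux_coef_ip j c c' u u' v v' : coef j c c' -> sgood j u u' -> sgood j v v' ->
  flux j (fun x => c x * ip (u x) (v x))
    (fun x => c' x * ip (u x) (v x) + c x * (ip (u' x) (v x) + ip (u x) (v' x))).
Proof.
move=> [cd cc mc mc' [K cK] [K' cK']] [ud uc ui ui'] [vd vc vi vi']; split.
- move=> x; have hi := is_derive_ip x ud vd.
  have := cd x => hc.
  have h := is_deriveM hc hi.
  by apply: (is_derive_ext h) => // ; rewrite /GRing.scale /=; ring.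
- have hu := sder_cont ud; have hv := sder_cont vd.
  apply: line_continuousD; apply: line_continuousM => //.
  + exact: line_continuous_ip.
  + exact: (derivable_line_continuous3 cd).
  + by apply: line_continuousD; exact: line_continuous_ip.
- exact: (integrable_coef_ip mc cK).
- rewrite (_ : _ \o _ = (fun x => (c' x * ip (u x) (v x))%:E +
     ((c x * ip (u' x) (v x))%:E + (c x * ip (u x) (v' x))%:E))%E); last first.
    by apply/funext => x /=; rewrite -!EFinD mulrDr.
  apply: integrableD => //; first exact: (integrable_coef_ip mc' cK').
  by apply: integrableD => //; exact: (integrable_coef_ip mc cK).
Qed.

Lemma flux_integral0 j T dT : flux j T dT -> (\int[leb3]_x (dT x)%:E = 0)%E.
Proof. by move=> [a b c d]; exact: integral_derivative0 a b c d. Qed.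

Lemma coef_cst j (r : R) : coef j (fun=> r) (fun=> 0).
Proof.
split.
- by move=> x; exact: is_derive_cst.
- exact: line_continuous_cst.
- exact: measurable_cst.
- exact: measurable_cst.
- by exists `|r|.
- by exists 0 => x; rewrite normr0.
Qed.
End flux_functions.

(** The form in which a pointwise bound up to a divergence is integrated, with one zero-mean term
    for each coordinate direction. *)
Lemma le_integral_zero_mean d (T : measurableType d) (R : realType)
    (m : {measure set T -> \bar R}) (h d1 d2 d3 r : T -> R) :
  m.-integrable setT (EFin \o h) -> m.-integrable setT (EFin \o r) ->
  m.-integrable setT (EFin \o d1) -> m.-integrable setT (EFin \o d2) ->
  m.-integrable setT (EFin \o d3) ->
  (\int[m]_x (d1 x)%:E = 0)%E -> (\int[m]_x (d2 x)%:E = 0)%E ->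
  (\int[m]_x (d3 x)%:E = 0)%E ->
  (forall x, h x <= d1 x + d2 x + d3 x + r x) ->
  (\int[m]_x (h x)%:E <= \int[m]_x (r x)%:E)%E.
Proof.
move=> ih ir i1 i2 i3 z1 z2 z3 hr.
have i12 := integrableD measurableT i1 i2.
have i123 := integrableD measurableT i12 i3.
have i4 := integrableD measurableT i123 ir.
apply: (@le_trans _ _ (\int[m]_x (((d1 x)%:E + (d2 x)%:E + (d3 x)%:E) + (r x)%:E))%E).
  apply: (le_integral measurableT ih i4) => x _.
  by rewrite /= -!EFinD lee_fin hr.
have e1 := integralD measurableT i123 ir.
have e2 := integralD measurableT i12 i3.
have e3 := integralD measurableT i1 i2.
by rewrite /= in e1 e2 e3; rewrite e1 e2 e3 z1 z2 z3 !add0e.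
Qed.

Section weight_coefficients.
Context {R : realType}.
Variables (del theta : R).
Hypothesis del_gt0 : 0 < del.
Hypothesis theta_gt : 2^-1 < theta.
Hypothesis theta_le1 : theta <= 1.

Lemma measurable_coord k : measurable_fun setT (@coord R k).
Proof.
elim/ord3_ind: k; rewrite /coord /=.
- exact: (measurableT_comp measurable_fst measurable_fst).
- exact: (measurableT_comp measurable_snd measurable_fst).
- exact: measurable_snd.
Qed.

Lemma measurable_sqn : measurable_fun setT (@sqn R).
Proof.
by apply: measurable_sum => k; apply: measurable_funX; exact: measurable_coord.
Qed.

Lemma measurable_wpow (p : R) : measurable_fun setT (fun x => wq del x `^ p).
Proof.
apply: (measurableT_comp (measurable_powR p)).
by apply: measurable_funD => //; apply: measurable_funM => //; exact: measurable_sqn.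
Qed.

Lemma measurable_wr : measurable_fun setT (wr del).
Proof.
rewrite (_ : wr del = (fun x => wq del x `^ (-1))); first exact: measurable_wpow.
by apply/funext => x; rewrite wr_powR.
Qed.

Lemma measurable_wc k : measurable_fun setT (wc del k).
Proof. by apply: measurable_funM => //; exact: measurable_coord. Qed.

Lemma bounded_of_sqr (f : R3 R -> R) (z : R) : (forall x, f x ^+ 2 <= z) ->
  exists K, forall x, `|f x| <= K.
Proof.
move=> h; exists (1 + z) => x.
have := h x; have := sqr_ge0 (`|f x| - 1); have := normr_ge0 (f x).
by rewrite -(real_normK (num_real (f x))) !expr2; lra.
Qed.

Lemma coef_vg j k : coef j (vg del theta k) (vDg del theta j k).
Proof.
have mP : measurable_fun setT (wP del) by exact: measurable_wpow.
have mS : measurable_fun setT (wS del theta) by exact: measurable_wpow.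
have mr := measurable_wr.
have ma : measurable_fun setT (va del theta).
  by apply: measurable_funB => //; apply: measurable_funM.
split.
- by move=> x; exact: is_derive_vg.
- have lP := @line_continuous_wP R del j; have lS := @line_continuous_wS R del theta j.
  have lr := @line_continuous_wr R del j.
  have lc (r : R) : line_continuous (basis3 j) (fun=> r) by exact: line_continuous_cst.
  apply: line_continuousD.
    apply: line_continuousM => //; apply: line_continuousD; last exact: line_continuousN.
    exact: line_continuousM.
  apply: line_continuousM.
    by apply: line_continuousM; [exact: line_continuous_coord|exact: line_continuous_wc].
  apply: line_continuousD; first by apply: line_continuousN; exact: line_continuousM.
  by apply: line_continuousM => //; exact: line_continuousM.
- by apply: measurable_funM => //; exact: measurable_coord.
- apply: measurable_funD; first by apply: measurable_funM.
  apply: measurable_funM.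
    by apply: measurable_funM; [exact: measurable_coord|exact: measurable_wc].
  apply: measurable_funD.
    by apply: measurable_funN; exact: measurable_funM.
  by apply: measurable_funM => //; exact: measurable_funM.
- exact: (bounded_of_sqr (vg_le del_gt0 theta_gt k)).
- exact: (bounded_of_sqr (vDg_le _ theta_gt theta_le1 j k)).
Qed.

Lemma coef_vd j : coef j (vd del theta) (vdd del theta j).
Proof.
have mP : measurable_fun setT (wP del) by exact: measurable_wpow.
have mS : measurable_fun setT (wS del theta) by exact: measurable_wpow.
have mr := measurable_wr.
have lP := @line_continuous_wP R del j; have lS := @line_continuous_wS R del theta j.
have lr := @line_continuous_wr R del j.
have lr2 : line_continuous (basis3 j) (fun x => wr del x ^+ 2).
  rewrite (_ : (fun x => _) = (fun x => wr del x * wr del x)); first exact: line_continuousM.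
  by apply/funext => x; rewrite expr2.
have lc (r : R) : line_continuous (basis3 j) (fun=> r) by exact: line_continuous_cst.
split.
- by move=> x; exact: is_derive_vd.
- apply: line_continuousM; first exact: line_continuous_wc.
  apply: line_continuousD; first apply: line_continuousD; first apply: line_continuousD.
  + by apply: line_continuousM => //; exact: line_continuousM.
  + by apply: line_continuousM => //; exact: line_continuousM.
  + by apply: line_continuousN; apply: line_continuousM => //; exact: line_continuousM.
  + by apply: line_continuousM => //; exact: line_continuousM.
- apply: measurable_funB; first apply: measurable_funD; first apply: measurable_funB.
  + exact: measurable_funM.
  + exact: measurable_funM.
  + by apply: measurable_funM => //; exact: measurable_funM.
  + by apply: measurable_funM => //; exact: measurable_funM.
- apply: measurable_funM; first exact: measurable_wc.
  apply: measurable_funD; first apply: measurable_funB; first apply: measurable_funD.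
  + by apply: measurable_funM => //; exact: measurable_funM.
  + by apply: measurable_funM => //; exact: measurable_funM.
  + apply: measurable_funM => //; apply: measurable_funM => //; exact: measurable_funX.
  + apply: measurable_funM => //; apply: measurable_funM => //; exact: measurable_funX.
- exact: (bounded_of_sqr (vd_le _ theta_gt theta_le1)).
- apply: (@bounded_of_sqr _ ((22 * del) ^+ 2)) => x.
  apply: (le_trans (vdd_le del_gt0 theta_gt theta_le1 j x)).
  rewrite [leLHS]exprMn ler_piMr ?sqr_ge0 //.
  have s0 := wS_gt0 del theta x.
  have s1 : wS del theta x <= 1 := le_trans (wS_le _ theta_gt x) (wP_le1 _ x).
  by rewrite expr_le1 // ltW.
Qed.
End weight_coefficients.

Section smooth_estimate.
Context {R : realType}.
Local Notation mR3 := (R3 (measurableTypeR R)).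
Variable (alpha : 'I_4 -> 'M[R[i]]_4).
Hypothesis alpha_dirac : dirac_matrices alpha.
Variable (theta : R).
Hypothesis theta_gt : 2^-1 < theta.
Hypothesis theta_le1 : theta <= 1.

(* The value of [(H_0 - z) u] in terms of the values of [u] and its derivatives. *)
Definition dirac_symbol (z : R[i]) (u : 'cV[R[i]]_4) (U : 'I_3 -> 'cV[R[i]]_4) :=
  \sum_(j < 3) dA alpha j (U j) + dB alpha u - z *: u.

Let kap := 2 * theta - 1.
(** The ratio prescribed by [delE]; [M] is then the bound of the field from [vg_le]. *)
Let del := kap / 1200.
Let M := 2 / del.
Definition smooth_const : R := resolvent_const kap M.

Let kap_gt0 : 0 < kap. Proof. by rewrite /kap; move: theta_gt; lra. Qed.
Let del_gt0 : 0 < del. Proof. by apply: divr_gt0 kap_gt0 _; rewrite ltr0n. Qed.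

Lemma ip_scale (z : R[i]) (a : 'cV[R[i]]_4) : ip (z%:M *m a) (z%:M *m a) =
  (complex.Re z ^+ 2 + complex.Im z ^+ 2) * ip a a.
Proof.
rewrite mul_scalar_mx; case: z => x y; rewrite scale_complexE !ipE /= (ipC a (dJ a)).
by rewrite (ip_Jself (@dJ_skew R)) dJ_iso; ring.
Qed.

Variables (lam mu : R).
Hypothesis lam_ge : 4 <= lam ^+ 2.
Hypothesis mu_neq0 : mu != 0.
Hypothesis mu_le1 : `|mu| <= 1.
Variables (u : spinor R) (U : 'I_3 -> spinor R) (UU : 'I_3 -> 'I_3 -> spinor R).
Hypothesis uU : forall k, sgood k u (U k).
Hypothesis UUU : forall j k, sgood k (U j) (UU k j).
Hypothesis UU_sym : forall j k x, UU j k x = UU k j x.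

Let z := lam +i* mu.
Let f x := dirac_symbol z (u x) (U ^~ x).
Let F k x := dirac_symbol z (U k x) (fun j => UU k j x).
Let W j x := dA alpha j (f x) + U j x.
Let dW j x := dA alpha j (F j x) + UU j j x.

Let sgood_f k : sgood k f (F k).
Proof.
have h : sgood k (fun x => (dA alpha 0 (U 0 x) + dA alpha 1 (U 1 x) +
      dA alpha 2%:R (U 2%:R x)) + dB alpha (u x) + (- z)%:M *m u x)
    (fun x => (dA alpha 0 (UU k 0 x) + dA alpha 1 (UU k 1 x) +
      dA alpha 2%:R (UU k 2%:R x)) + dB alpha (U k x) + (- z)%:M *m U k x).
  have hA j : sgood k (fun x => dA alpha j (U j x)) (fun x => dA alpha j (UU k j x)).
    by apply: (@sgood_mx _ _ _ 1) => // a; rewrite mul1r; exact: dA_iso.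
  have hB : sgood k (fun x => dB alpha (u x)) (fun x => dB alpha (U k x)).
    by apply: (@sgood_mx _ _ _ 1) => // a; rewrite mul1r; exact: dB_iso.
  by do !apply: sgoodD => //; apply: sgood_mx (uU k) => a; exact: ip_scale.
rewrite (_ : f = (fun x => (dA alpha 0 (U 0 x) + dA alpha 1 (U 1 x) +
      dA alpha 2%:R (U 2%:R x)) + dB alpha (u x) + (- z)%:M *m u x)).
  rewrite (_ : F k = (fun x => (dA alpha 0 (UU k 0 x) + dA alpha 1 (UU k 1 x) +
      dA alpha 2%:R (UU k 2%:R x)) + dB alpha (U k x) + (- z)%:M *m U k x)) //.
  by apply/funext => x; rewrite /F /dirac_symbol sum3 mul_scalar_mx scaleNr.
by apply/funext => x; rewrite /f /dirac_symbol sum3 mul_scalar_mx scaleNr.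
Qed.

Let sgood_W j : sgood j (W j) (dW j).
Proof.
apply: sgoodD; last exact: UUU.
by apply: (@sgood_mx _ _ _ 1) => // a; rewrite mul1r; exact: dA_iso.
Qed.

Let m := 1 - lam ^+ 2 + mu ^+ 2.
Let g := vg del theta.
Let Dg := vDg del theta.
Let d := vd del theta.
Let dd := vdd del theta.

Let dPhi j x := \sum_(k < 3) (Dg j k x * ip (W j x) (U k x) +
      g k x * (ip (dW j x) (U k x) + ip (W j x) (UU j k x))) +
    2^-1 * (dd j x * ip (W j x) (u x) +
      d x * (ip (dW j x) (u x) + ip (W j x) (U j x))) +
    2^-1 * Dg j j x * (ip (f x) (f x) - \sum_(k < 3) ip (U k x) (U k x)
      - m * ip (u x) (u x)) +
    g j x * (ip (f x) (F j x) - \sum_(k < 3) ip (U k x) (UU j k x)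
      - m * ip (u x) (U j x)).
Let dPsi j x := ip (dW j x) (u x) + ip (W j x) (U j x).
Let dchi j x := ip (dJ (U j x)) (dA alpha j (u x)) + ip (dJ (u x)) (dA alpha j (U j x)).

Let flux_ip j c c' a a' b b' := @flux_coef_ip R j c c' a a' b b'.

Let flux_Phi j : exists T, flux j T (dPhi j).
Proof.
(* [T1] and [T2] pair [W] with the multiplier [g . grad u + (div g / 2) u]; [T3] to [T5] make up
   [g_j / 2] times [|f|^2 - |grad u|^2 - m |u|^2]. *)
pose T1 := flux_sum (fun k : 'I_3 => flux_coef_ip
  (coef_vg del_gt0 theta_gt theta_le1 j k) (sgood_W j) (UUU k j)).
pose T2 := fluxZ 2^-1 (flux_coef_ip (coef_vd del_gt0 theta_gt theta_le1 j)
  (sgood_W j) (uU j)).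
pose gj := coef_vg del_gt0 theta_gt theta_le1 j j.
pose T3 := fluxZ 2^-1 (flux_coef_ip gj (sgood_f j) (sgood_f j)).
pose T4 := fluxZ (- 2^-1) (flux_sum (fun k : 'I_3 => flux_coef_ip gj (UUU k j) (UUU k j))).
pose T5 := fluxZ (- 2^-1 * m) (flux_coef_ip gj (uU j) (uU j)).
eexists; apply: (flux_eq (fluxD (fluxD T1 T2) (fluxD T3 (fluxD T4 T5)))) => x.
  by [].
rewrite /dPhi /= !sum3 (ipC (F j x) (f x)) (ipC (U j x) (u x)).
rewrite (ipC (UU j 0 x) (U 0 x)) (ipC (UU j 1 x) (U 1 x)) (ipC (UU j 2%:R x) (U 2%:R x)).
rewrite /g /Dg /d /dd; by field.
Qed.

Let flux_Psi j : exists T, flux j T (dPsi j).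
Proof.
eexists; apply: (flux_eq (flux_coef_ip (coef_cst j 1) (sgood_W j) (uU j))) => x.
  by [].
by rewrite /dPsi /= mul0r add0r mul1r.
Qed.

Let flux_chi j : exists T, flux j T (dchi j).
Proof.
have hJ : sgood j (fun x => dJ (u x)) (fun x => dJ (U j x)).
  by apply: (@sgood_mx _ _ _ 1) => // a; rewrite mul1r; exact: dJ_iso.
have hA : sgood j (fun x => dA alpha j (u x)) (fun x => dA alpha j (U j x)).
  by apply: (@sgood_mx _ _ _ 1) => // a; rewrite mul1r; exact: dA_iso.
eexists; apply: (flux_eq (flux_coef_ip (coef_cst j 1) hJ hA)) => x.
  by [].
by rewrite /dchi /= mul0r add0r mul1r.
Qed.

Let w := wS del theta.

Let pointwise x : lam ^+ 2 * w x * ip (u x) (u x) <=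
  64 / kap * (\sum_(j < 3) dPhi j x + M * `|mu| * \sum_(j < 3) dPsi j x
    - 5 * M * lam ^+ 2 * Num.sg mu * (- 2^-1 * \sum_(j < 3) dchi j x)) +
  smooth_const * (lam ^+ 2 * (w x)^-1 * ip (f x) (f x)).
Proof.
have w0 : 0 < w x by exact: wS_gt0.
have w1 : w x <= 1 := le_trans (wS_le _ theta_gt x) (wP_le1 _ x).
have M0 : 0 <= M by rewrite divr_ge0 // ltW.
have z_eq (a : 'cV[R[i]]_4) : z *: a = rscale lam a + rscale mu (dJ a).
  exact: scale_complexE.
have eqf : \sum_(j < 3) dA alpha j (U j x) =
    f x - dB alpha (u x) + rscale lam (u x) + rscale mu (dJ (u x)).
  by rewrite -addrA -z_eq /f /dirac_symbol (addrAC _ (- (z *: u x))) addrK subrK.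
have eqF k : \sum_(j < 3) dA alpha j (UU k j x) =
    F k x - dB alpha (U k x) + rscale lam (U k x) + rscale mu (dJ (U k x)).
  by rewrite -addrA -z_eq /F /dirac_symbol (addrAC _ (- (z *: U k x))) addrK subrK.
have eqW := dirac_square alpha_dirac (fun j k => UU_sym j k x) (erefl (f x))
  (fun k => erefl (F k x)).
apply: (@pointwise_bound R (dA alpha) (dB alpha) (@dJ R) (dA_iso alpha_dirac)
  (dB_iso alpha_dirac) (@dJ_skew R) (@dJ_iso R) lam mu (u x) (f x) (U ^~ x) eqf
  (g ^~ x) (fun j k => Dg j k x) (d x) (dd ^~ x) kap del (w x) (w x)^-1 M) => //.
- by rewrite /del; field.
- by rewrite /kap; move: theta_le1; lra.
- by rewrite mulfV // gt_eqF.
- by move=> k; exact: vg_le.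
- by move=> j k; exact: vDg_le.
- exact: vd_le.
- by move=> j; exact: vdd_le.
- exact: hessian_ge.
- exact: (@virial_identity R (dA alpha) (dB alpha) (@dJ R) (dA_skew alpha_dirac)
    (dB_sym alpha_dirac) (@dJ_skew R) lam mu (u x) (f x) (U ^~ x) (F ^~ x)
    (W ^~ x) (dW ^~ x) (fun j k => UU j k x) (fun j k => UU_sym j k x) eqf eqF
    (fun j => erefl) eqW (g ^~ x) (fun j k => Dg j k x) (d x) (dd ^~ x)
    (vd_sum del theta x)).
- exact: (@energy_identity R (dA alpha) (dB alpha) (@dJ R) (dA_skew alpha_dirac)
    (dB_sym alpha_dirac) (@dJ_skew R) lam mu (u x) (f x) (U ^~ x)
    (W ^~ x) (dW ^~ x) eqf (fun j => erefl) eqW).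
- exact: (@charge_identity R (dA alpha) (dB alpha) (@dJ R) (dA_skew alpha_dirac)
    (dB_sym alpha_dirac) (@dJ_skew R) (@dJ_iso R) (dJB alpha) (dJA alpha)
    lam mu (u x) (f x) (U ^~ x) eqf).
Qed.

Lemma smooth_const_gt0 : 0 < smooth_const.
Proof.
have M0 : 0 <= M by rewrite divr_ge0 // ltW.
rewrite /smooth_const /resolvent_const; apply: ltr_wpDl; last by rewrite ltr0n.
apply: mulr_ge0; first by apply: divr_ge0; [exact: ler0n|exact: ltW].
apply: addr_ge0; last exact: ler0n.
apply: addr_ge0; last by apply: divr_ge0; [exact: M0|exact: ler0n].
apply: divr_ge0; last exact: ltW.
apply: addr_ge0; last exact: ler0n.
by apply: mulr_ge0; [exact: ler0n|exact: sqr_ge0].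
Qed.

Lemma smooth_bound :
  (\int[leb3]_x (w x * ip (u x) (u x))%:E <=
   smooth_const%:E * \int[leb3]_x ((w x)^-1 * ip (f x) (f x))%:E)%E.
Proof.
have C0 := smooth_const_gt0; have l0 : 0 < lam ^+ 2 by move: lam_ge; lra.
have w0 x : 0 < w x by exact: wS_gt0.
have mw : measurable_fun setT w by exact: measurable_wpow.
have su := (sg_int (uU 0)); have sf := sg_int (sgood_f 0).
have mf : measurable_fun [set: mR3] (fun x => ((w x)^-1 * ip (f x) (f x))%:E).
  apply/measurable_EFinP; apply: measurable_funM; last exact: measurable_ip sf.1 sf.1.
  rewrite (_ : (fun x => _) = (fun x => wq del x `^ theta)); first exact: measurable_wpow.
  by apply/funext => x; rewrite /w /wS powRN invrK.
have ge0f x : (0 <= ((w x)^-1 * ip (f x) (f x))%:E)%E.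
  by rewrite lee_fin mulr_ge0 ?ip_ge0 // invr_ge0 ltW.
(* The weight on [f] is unbounded, so the right side may be infinite; the bound is then trivial. *)
have [fy|fy] := eqVneq (\int[leb3]_x ((w x)^-1 * ip (f x) (f x))%:E)%E +oo%E.
  by rewrite fy gt0_muley ?lte_fin // leey.
have fi : leb3.-integrable [set: mR3] (fun x => ((w x)^-1 * ip (f x) (f x))%:E).
  apply/integrableP; split => //.
  under eq_integral do rewrite gee0_abs //.
  by rewrite ltey.
have [T1 hT1] := choice flux_Phi; have [T2 hT2] := choice flux_Psi.
have [T3 hT3] := choice flux_chi.
(* The pointwise bound divided by [lam^2]. The factor [2^-1] and the sign before [dchi] come from
   the normalisation of [charge_identity]. *)
pose k := 64 / (kap * lam ^+ 2).
pose dT j x := k * (dPhi j x + (M * `|mu| * dPsi j x +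
  (5 * M * lam ^+ 2 * Num.sg mu * 2^-1) * dchi j x)).
have hT j : flux j _ (dT j) :=
  fluxZ k (fluxD (hT1 j) (fluxD (fluxZ _ (hT2 j)) (fluxZ _ (hT3 j)))).
have iT j : leb3.-integrable [set: mR3] (EFin \o dT j) := flux_int' (hT j).
have zT j : (\int[leb3]_x (dT j x)%:E = 0)%E := flux_integral0 (hT j).
have pw x : w x * ip (u x) (u x) <=
    dT 0 x + dT 1 x + dT 2%:R x + smooth_const * ((w x)^-1 * ip (f x) (f x)).
  rewrite -(ler_pM2l l0) mulrA; apply: (le_trans (pointwise x)).
  rewrite le_eqVlt; apply/orP; left; apply/eqP.
  have lam0 : lam != 0 by rewrite -sqrf_eq0 gt_eqF.
  have kap0 : kap != 0 by rewrite gt_eqF.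
  rewrite /dT /k !sum3.
  move: (dPhi 0 x) (dPhi 1 x) (dPhi 2%:R x) (dPsi 0 x) (dPsi 1 x) (dPsi 2%:R x)
    (dchi 0 x) (dchi 1 x) (dchi 2%:R x) (ip (f x) (f x)) (w x)^-1 kap kap0.
  move=> p1 p2 p3 e1 e2 e3 c1 c2 c3 ff wi kp kp0.
  by field; rewrite lam0 kp0.
have iu : leb3.-integrable [set: mR3] (fun x => (w x * ip (u x) (u x))%:E).
  apply: (integrable_coef_ip mw (K := 1)) => // x.
  rewrite (ger0_norm (ltW (w0 x))).
  exact: le_trans (wS_le _ theta_gt x) (wP_le1 _ x).
have ri : leb3.-integrable [set: mR3]
    (EFin \o (fun x => smooth_const * ((w x)^-1 * ip (f x) (f x)))).
  by have := integrableZl measurableT smooth_const fi.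
apply: (le_trans (le_integral_zero_mean iu ri (iT 0) (iT 1) (iT 2%:R)
  (zT 0) (zT 1) (zT 2%:R) pw)).
have := integralZl measurableT fi smooth_const => /= <-.
by under eq_integral do rewrite EFinM.
Qed.
End smooth_estimate.

(** * Mollifiers *)

Section smooth_one_variable.
Context {R : realType}.
Implicit Types (f g : R -> R) (p : {poly R}).

Fixpoint smooth (n : nat) f : Prop :=
  if n is m.+1 then (forall x, derivable f x 1) /\ smooth m (derive1 f) else True.

Lemma smoothS n f f' : (forall x, is_derive x (1:R) f (f' x)) -> smooth n f' ->
  smooth n.+1 f.
Proof.
move=> h sf; split=> [x|]; first by have [] := h x.
suff -> : (derive1 f) = f' by [].
by apply/funext => x; rewrite derive1E; have [_ ->] := h x.
Qed.

Lemma smooth_is_derive n f x : smooth n.+1 f -> is_derive x (1:R) f ((derive1 f) x).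
Proof. by move=> [h _]; split; [exact: h|rewrite derive1E]. Qed.

Lemma smoothW n f : smooth n.+1 f -> smooth n f.
Proof. by elim: n f => //= n ih f [h [h' s]]; split => //; apply: ih; split. Qed.

Lemma smoothD n f g : smooth n f -> smooth n g -> smooth n (fun x => f x + g x).
Proof.
elim: n f g => [//|n ih] f g sf sg; apply: (@smoothS _ _ (fun x => (derive1 f) x + (derive1 g) x)).
  move=> x; have df := smooth_is_derive x sf; have dg := smooth_is_derive x sg.
  exact: is_deriveD.
by apply: ih; [exact: sf.2|exact: sg.2].
Qed.

Lemma smoothM n f g : smooth n f -> smooth n g -> smooth n (fun x => f x * g x).
Proof.
elim: n f g => [//|n ih] f g sf sg.
apply: (@smoothS _ _ (fun x => (derive1 f) x * g x + f x * (derive1 g) x)).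
  move=> x; have df := smooth_is_derive x sf; have dg := smooth_is_derive x sg.
  by apply: is_derive_eq; rewrite /GRing.scale /=; ring.
by apply: smoothD; apply: ih; [exact: sf.2|exact: smoothW|exact: smoothW|exact: sg.2].
Qed.

Lemma smooth_affine n f (a b : R) : smooth n f -> smooth n (fun x => f (a * x + b)).
Proof.
move=> sf.
suff h (c : R) m : smooth m f -> smooth m (fun x => c * f (a * x + b)).
  by rewrite (_ : (fun x => _) = (fun x => 1 * f (a * x + b)));
    [exact: h|apply/funext => x; rewrite mul1r].
elim: m f c {sf} => [//|m ih] f0 c sf.
apply: (@smoothS _ _ (fun x => (c * a) * (derive1 f0) (a * x + b))); last exact: ih sf.2.
move=> x; have df := smooth_is_derive (a * x + b) sf.
have h : is_derive x (1:R) (fun x => a * x + b) a.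
  by apply: is_derive_eq; rewrite /GRing.scale /=; ring.
have h2 : is_derive x (1:R) (fun x => f0 (a * x + b)) ((derive1 f0) (a * x + b) * a).
  exact: (@is_derive1_comp R f0 (fun x => a * x + b)).
by apply: is_derive_eq; rewrite /GRing.scale /=; ring.
Qed.

Lemma smooth_continuous f : smooth 1 f -> continuous f.
Proof.
move=> sf x; apply: differentiable_continuous; apply/derivable1_diffP; exact: sf.1.
Qed.

(* x |-> p(1/x) exp(-1/x) for x > 0; closed under derivation. *)
Definition flat p (x : R) : R := if 0 < x then p.[x^-1] * expR (- x^-1) else 0.

(** With [t = 1 / x], the derivative in [x] is [- t^2] times the derivative of [p(t) exp(-t)] in
    [t]. *)
Definition flat_deriv p : {poly R} := 'X^2 * (p - p^`()).

Lemma flat_le0 p x : x <= 0 -> flat p x = 0.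
Proof. by move=> x0; rewrite /flat ltNge x0. Qed.

(** [exp t >= t^(m+2) / (m+2)!] beats a polynomial with [m] coefficients by two powers of
    [t = 1 / x]. The quadratic bound gives the derivative 0 at the origin. *)
Lemma flat_sq_bound p : exists2 K, 0 <= K & forall x, `|x| <= 1 -> `|flat p x| <= K * x ^+ 2.
Proof.
pose m := size p; pose K1 := \sum_(i < m) `|p`_i|.
have K10 : 0 <= K1 by apply: sumr_ge0.
exists (K1 * (m.+2)`!%:R); first by rewrite mulr_ge0.
move=> x x1; have [x0|x0] := leP x 0.
  by rewrite flat_le0 // normr0 mulr_ge0 ?sqr_ge0 // mulr_ge0 // ler0n.
rewrite gtr0_norm // in x1.
rewrite /flat x0; set t := x^-1.
have t1 : 1 <= t by rewrite invf_ge1.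
have t0 : 0 < t by exact: lt_le_trans t1.
have pt : `|p.[t]| <= K1 * t ^+ m.
  rewrite horner_coef; apply: (le_trans (ler_norm_sum _ _ _)).
  rewrite mulr_suml; apply: ler_sum => i _; rewrite normrM ler_wpM2l //.
  by rewrite normrX gtr0_norm // ler_weXn2l // ltnW.
have et : expR (- t) <= (m.+2)`!%:R / t ^+ m.+2.
  have f0 : 0 < (m.+2)`!%:R :> R by rewrite ltr0n fact_gt0.
  have := expR_ge1Dxn m.+1 (ltW t0); rewrite -[leRHS]invrK -expRN => h.
  rewrite -[leLHS]invrK -[leRHS]invrK lef_pV2 ?posrE ?invr_gt0 ?expR_gt0 //.
    by rewrite invf_div; apply: le_trans h; rewrite lerDr.
  by rewrite divr_gt0 // exprn_gt0.
rewrite normrM (gtr0_norm (expR_gt0 _)).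
apply: (le_trans (ler_pM (normr_ge0 _) (expR_ge0 _) pt et)).
have -> : x ^+ 2 = t ^- 2 by rewrite /t exprVn invrK.
have -> : t ^+ m.+2 = t ^+ m * t ^+ 2 by rewrite -exprD addn2.
rewrite le_eqVlt; apply/orP; left; apply/eqP; field.
by rewrite expf_neq0 ?gt_eqF.
Qed.

Lemma is_derive_flat p x : is_derive x (1:R) (flat p) (flat (flat_deriv p) x).
Proof.
have [x0|x0|->] := ltgtP x 0.
- rewrite flat_le0 ?ltW //.
  apply: (@near_eq_is_derive _ _ _ (cst 0)).
  near=> y; rewrite flat_le0 //; apply: ltW; near: y; exact: lt_nbhsl.
- have h : is_derive x (1:R) (fun y => p.[y^-1] * expR (- y^-1)) (flat (flat_deriv p) x).
    have xn : x != 0 by rewrite gt_eqF.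
    have hV : is_derive x (1:R) (fun y : R => y^-1) (- x ^- 2).
      have := @is_deriveV R id x 1 1 xn (is_derive_id x 1).
      by rewrite /GRing.scale /= mulr1.
    have hp : is_derive x (1:R) (fun y => p.[y^-1]) (p^`().[x^-1] * - x ^- 2).
      exact: (@is_derive1_comp R (horner p) (fun y => y^-1)).
    have hN : is_derive x (1:R) (fun y : R => - y^-1) (x ^- 2).
      by have := is_deriveN hV; rewrite opprK.
    have he : is_derive x (1:R) (fun y => expR (- y^-1)) (expR (- x^-1) * x ^- 2).
      exact: (@is_derive1_comp R expR (fun y => - y^-1)).
    rewrite /flat x0 /flat_deriv hornerM hornerXn hornerD hornerN exprVn.
    by apply: is_derive_eq; rewrite /GRing.scale /=; ring.
  apply: near_eq_is_derive h; near=> y; rewrite /flat ifT //; near: y; exact: lt_nbhsr.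
- rewrite flat_le0 //; have [K K0 hK] := flat_sq_bound p.
  have h : h^-1 *: ((flat p \o shift 0) (h *: (1:R)) - flat p 0) @[h --> 0^'] --> (0:R).
    apply/cvgrPdist_le => e e0.
    near=> h; rewrite (flat_le0 _ (lexx 0)) subr0 sub0r normrN /= addr0.
    have -> : h *: (1:R) = h by rewrite /GRing.scale /= mulr1.
    have h0 : h != 0 by near: h; exact: nbhs_dnbhs_neq.
    have h1 : `|h| <= 1 by near: h; apply: dnbhs0_le.
    have h2 : `|h| <= e / (K + 1).
      by near: h; apply: dnbhs0_le; rewrite divr_gt0 // ltr_wpDl.
    rewrite normrZ normfV ler_pdivrMl ?normr_gt0 //.
    apply: (le_trans (hK _ h1)); rewrite -(real_normK (num_real h)) expr2 mulrA mulrC.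
    rewrite ler_wpM2l //.
    have K1 : 0 < K + 1 by rewrite ltr_wpDl.
    move: h2; rewrite ler_pdivlMr // => h2.
    have := normr_ge0 h; lra.
  split; first by apply/cvg_ex; exists 0.
  by apply/cvg_lim.
Unshelve. all: by end_near. Qed.

Lemma smooth_flat n p : smooth n (flat p).
Proof.
by elim: n p => [//|n ih] p; apply: smoothS (ih (flat_deriv p)); exact: is_derive_flat.
Qed.

Definition bump (x : R) : R := flat 1 x * flat 1 (1 - x).

Lemma smooth_bump n : smooth n bump.
Proof.
apply: smoothM; first exact: smooth_flat.
rewrite (_ : (fun x => _) = (fun x => flat 1 (-1 * x + 1))).
  by apply: smooth_affine; exact: smooth_flat.
by apply/funext => x; rewrite mulN1r addrC.
Qed.

Lemma bump_ge0 x : 0 <= bump x.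
Proof.
have h y : 0 <= flat 1 y by rewrite /flat hornerC mul1r; case: ifP => // _; exact: expR_ge0.
exact: mulr_ge0.
Qed.

Lemma bump_gt0 x : 0 < x < 1 -> 0 < bump x.
Proof.
case/andP=> x0 x1; rewrite /bump /flat subr_gt0 x0 x1 !hornerC !mul1r.
by rewrite mulr_gt0 ?expR_gt0.
Qed.

Lemma bump_eq0 x : ~~ (0 < x < 1) -> bump x = 0.
Proof.
rewrite negb_and -!leNgt /bump => /orP[h|h].
  by rewrite flat_le0 ?mul0r.
by rewrite [X in _ * X]flat_le0 ?mulr0 // subr_le0.
Qed.

(* This symmetry makes the mollifiers even up to a translation, so that they have
   mass 1 in either variable of the kernel. *)
Lemma bump_sym x : bump (1 - x) = bump x.
Proof. by rewrite /bump subKr mulrC. Qed.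
End smooth_one_variable.

(** * Tensor products of one-variable test functions *)

Section tensors.
Context {R : realType}.
Local Notation mR := (measurableTypeR R).
Local Notation mR3 := (R3 mR).
Implicit Types (phi psi : 'I_3 -> R -> R) (x y : R3 R).

(** One fixed support for all kernels: convolution then moves points by at most 1 in each
    coordinate, so weights need only be comparable at that distance. *)
Definition unit_test (f : R -> R) : Prop :=
  (forall n, smooth n f) /\ forall t : R, ~~ (0 <= t <= 1) -> f t = 0.

Definition tens phi x : R :=
  phi 0 (coord 0 x) * phi 1 (coord 1 x) * phi 2%:R (coord 2%:R x).

Definition dtens (j : 'I_3) phi (i : 'I_3) : R -> R :=
  if i == j then derive1 (phi i) else phi i.

Lemma unit_test_derive f : unit_test f -> unit_test (derive1 f).
Proof.
move=> [sf f0]; split=> [n|x x01]; first exact: (sf n.+1).2.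
suff h : is_derive x (1:R) f 0 by rewrite derive1E; have [_ ->] := h.
apply: (@near_eq_is_derive _ _ _ (cst 0)).
move: x01; rewrite negb_and -!ltNge => /orP[h|h]; near=> y; apply/esym/f0;
  rewrite negb_and -!ltNge; apply/orP; [left|right]; near: y;
  [exact: lt_nbhsl|exact: lt_nbhsr].
Unshelve. all: by end_near. Qed.

Lemma unit_test_bounded f : unit_test f -> exists2 K, 0 <= K & forall t, `|f t| <= K.
Proof.
move=> [sf f0]; have cf := smooth_continuous (sf 1%N).
have cn : {within `[(0:R), 1], continuous (fun t => `|f t|)}.
  by apply: continuous_subspaceT => t; apply: continuous_comp; [exact: cf|exact: norm_continuous].
have [c _ hc] := EVT_max (@ler01 R) cn.
exists `|f c| => // x; have [x01|x01] := boolP (0 <= x <= 1); last by rewrite f0 // normr0.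
by apply: hc; rewrite in_itv.
Qed.

Lemma unit_test_measurable f : unit_test f -> measurable_fun [set: mR] f.
Proof. by move=> [sf _]; apply: continuous_measurable_fun; exact: smooth_continuous (sf 1%N). Qed.

Lemma unit_test_dtens j phi : (forall i, unit_test (phi i)) ->
  forall i, unit_test (dtens j phi i).
Proof. by move=> h i; rewrite /dtens; case: eqP => _ //; exact: unit_test_derive. Qed.

(** The origin of the symmetry of second derivatives of mollified spinors: derivatives in different
    directions act on different factors of the kernel. *)
Lemma dtensC j k phi : dtens j (dtens k phi) = dtens k (dtens j phi).
Proof.
apply/funext => i; rewrite /dtens.
by case: (i == j) (i == k) => [] [].
Qed.

Lemma is_derive_tens j phi x : (forall i, smooth 1 (phi i)) ->
  is_derive x (basis3 j) (tens phi) (tens (dtens j phi) x).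
Proof.
move=> sphi.
have h (i : 'I_3) : is_derive x (basis3 j) (fun y => phi i (coord i y))
    (derive1 (phi i) (coord i x) * (i == j)%:R).
  apply: is_derive_comp_line; first exact: is_derive_coord.
  exact: smooth_is_derive.
have h0 := h 0; have h1 := h 1; have h2 := h 2%:R.
rewrite /tens /dtens; apply: is_derive_eq; rewrite /GRing.scale /=.
by elim/ord3_ind: j {h h0 h1 h2} => /=; ring.
Qed.

Lemma measurable_tens phi : (forall i, measurable_fun [set: mR] (phi i)) ->
  measurable_fun [set: mR3] (tens phi).
Proof.
move=> h; apply: measurable_funM; first apply: measurable_funM.
- by apply: (measurableT_comp (h 0)); exact: measurable_coord.
- by apply: (measurableT_comp (h 1)); exact: measurable_coord.
- by apply: (measurableT_comp (h 2%:R)); exact: measurable_coord.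
Qed.

Lemma tens_bounded phi : (forall i, unit_test (phi i)) ->
  exists2 K, 0 <= K & forall x, `|tens phi x| <= K.
Proof.
move=> h; have [K0 k0 b0] := unit_test_bounded (h 0).
have [K1 k1 b1] := unit_test_bounded (h 1).
have [K2 k2 b2] := unit_test_bounded (h 2%:R).
exists (K0 * K1 * K2) => [|x]; first by rewrite !mulr_ge0.
by rewrite /tens !normrM !ler_pM ?mulr_ge0.
Qed.

Lemma tens_support phi x : (forall i, unit_test (phi i)) ->
  tens phi x != 0 -> forall i, 0 <= coord i x <= 1.
Proof.
move=> h; apply: contraNP => /existsNP[i /negP hi]; apply/eqP.
by move: hi; elim/ord3_ind: i => hi; rewrite /tens (proj2 (h _) _ hi) ?mul0r ?mulr0 ?mul0r.
Qed.

Definition cube x (r : R) : set mR3 :=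
  (`[x.1.1 - r, x.1.1 + r]%classic `*` `[x.1.2 - r, x.1.2 + r]%classic) `*`
  `[x.2 - r, x.2 + r]%classic.

Lemma cubeP x r y : cube x r y <-> forall i, `|coord i y - coord i x| <= r.
Proof.
rewrite /cube /= !in_itv /=; split.
  move=> [[h1 h2] h3]; elim/ord3_ind; rewrite /coord /= ler_distl //.
move=> h; have := h 0; have := h 1; have := h 2%:R; rewrite /coord /= !ler_distl.
by move=> h3 h2 h1.
Qed.

Lemma measurable_cube x r : measurable (cube x r).
Proof. by apply: measurableX; first apply: measurableX; exact: measurable_itv. Qed.

Lemma leb3_cube x r : (leb3 (cube x r) < +oo)%E.
Proof.
rewrite leb3E /sleb3 /= /cube.
have m a b : measurable (`[a, b]%classic : set mR) by exact: measurable_itv.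
have l a b : (@lebesgue_measure R `[a, b]%classic < +oo)%E.
  by rewrite lebesgue_measure_itv /=; case: ifP => // _; rewrite -EFinB ltry.
have e1 := @product_measure1E _ _ _ _ _ (@sleb2 R) (@sleb R) _ _
  (measurableX (m (x.1.1 - r) (x.1.1 + r)) (m (x.1.2 - r) (x.1.2 + r)))
  (m (x.2 - r) (x.2 + r)).
have e2 := @product_measure1E _ _ _ _ _ (@sleb R) (@sleb R) _ _
  (m (x.1.1 - r) (x.1.1 + r)) (m (x.1.2 - r) (x.1.2 + r)).
rewrite [ltLHS]e1 /= e2 !lte_mul_pinfty ?ge0_fin_numE ?mule_ge0 ?l //.
by rewrite lte_mul_pinfty ?ge0_fin_numE ?l.
Qed.

Lemma integrable_cube x r : leb3.-integrable [set: mR3] (fun y => (\1_(cube x r) y)%:E).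
Proof.
apply/integrableP; split.
  by apply/measurable_EFinP; exact: measurable_indic (measurable_cube x r).
under eq_integral do rewrite gee0_abs ?lee_fin //.
by rewrite integral_indic ?setIT; [exact: leb3_cube|exact: measurableT|exact: measurable_cube].
Qed.
End tensors.

(** * Convolution and the weighted Schur test *)

(** Tonelli's measurability applied to the positive and negative parts, so no joint integrability is
    asked of [k]. *)
Lemma measurable_Rintegral_snd d1 d2 (T1 : measurableType d1) (T2 : measurableType d2)
    {R : realType} (m : {sigma_finite_measure set T2 -> \bar R}) (k : T1 * T2 -> R) :
  measurable_fun setT k ->
  measurable_fun setT (fun x => Rintegral m setT (fun y => k (x, y))).
Proof.
move=> mk; rewrite /Rintegral.
have mk' : measurable_fun setT (EFin \o k) by exact/measurable_EFinP.
apply: (measurableT_comp (fine_measurable measurableT)).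
rewrite (_ : (fun x => _) = (fun x => fubini_F m ((EFin \o k)^\+)%E x -
  fubini_F m ((EFin \o k)^\-)%E x)%E).
  apply: emeasurable_funB; apply: measurable_fun_fubini_tonelli_F => //.
    exact: measurable_funepos.
  exact: measurable_funeneg.
apply/funext => x; rewrite integralE; congr (_ - _)%E; apply: eq_integral => y _.
  by rewrite !funeposE.
by rewrite !funenegE.
Qed.

Section weighted_cauchy_schwarz.
Context d (T : measurableType d) {R : realType} (m : {measure set T -> \bar R}).

(** Cauchy-Schwarz for the measure with density [|r|], from [2 |h| <= s + h^2 / s] integrated with
    one well-chosen [s]. *)
Lemma weighted_cauchy_schwarz (r h : T -> R) (A : R) :
  measurable_fun setT r -> measurable_fun setT h -> 0 < A ->
  (\int[m]_x (`|r x|)%:E <= A%:E)%E ->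
  m.-integrable setT (EFin \o (fun x => r x * h x)) ->
  (((\int[m]_x (r x * h x)) ^+ 2)%:E <= A%:E * \int[m]_x (`|r x| * h x ^+ 2)%:E)%E.
Proof.
move=> mr mh A0 rA ih.
have mrh : measurable_fun setT (fun x => `|r x| * h x ^+ 2).
  by apply: measurable_funM; [exact: measurableT_comp|exact: measurable_funX].
have [By|By] := eqVneq (\int[m]_x (`|r x| * h x ^+ 2)%:E)%E +oo%E.
  by rewrite By gt0_muley ?lte_fin // leey.
have iB : m.-integrable setT (EFin \o (fun x => `|r x| * h x ^+ 2)).
  apply/integrableP; split; first exact/measurable_EFinP.
  rewrite (_ : (\int[m]_x _)%E = (\int[m]_x (`|r x| * h x ^+ 2)%:E)%E) ?ltey //.
  by apply: eq_integral => x _; rewrite gee0_abs // lee_fin mulr_ge0 ?sqr_ge0.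
have iA : m.-integrable setT (EFin \o (fun x => `|r x|)).
  apply/integrableP; split; first by apply/measurable_EFinP; exact: measurableT_comp.
  rewrite (_ : (\int[m]_x _)%E = (\int[m]_x (`|r x|)%:E)%E).
    by apply: le_lt_trans rA _; rewrite ltry.
  by apply: eq_integral => x _; rewrite gee0_abs // lee_fin.
pose b := \int[m]_x (`|r x| * h x ^+ 2); pose a := \int[m]_x `|r x|.
have bE : (\int[m]_x (`|r x| * h x ^+ 2)%:E)%E = b%:E.
  by rewrite /b /Rintegral fineK //; exact: (integrable_fin_num measurableT iB).
have aA : a <= A.
  rewrite -lee_fin /a /Rintegral fineK; first exact: rA.
  exact: (integrable_fin_num measurableT iA).
rewrite bE -EFinM lee_fin; set c := \int[m]_x (r x * h x).
have b0 : 0 <= b by apply: Rintegral_ge0 => x _; rewrite mulr_ge0 ?sqr_ge0.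
have [->|c0] := eqVneq c 0; first by rewrite expr0n mulr_ge0 // ltW.
have cn : 0 < `|c| by rewrite normr_gt0.
(* With this [s] the term [s a] is at most [|c|], which leaves [|c| <= A b / |c|]. *)
pose s := `|c| / A; have s0 : 0 < s by rewrite divr_gt0.
have h1 : 2 * `|c| <= s * a + s^-1 * b.
  have i1 : m.-integrable setT (EFin \o (fun x => s * `|r x|)).
    by have := integrableZl measurableT s iA.
  have i2 : m.-integrable setT (EFin \o (fun x => s^-1 * (`|r x| * h x ^+ 2))).
    by have := integrableZl measurableT s^-1 iB.
  have i3 : m.-integrable setT (EFin \o (fun x => `|r x * h x|)).
    by have := integrable_norm ih.
  have i4 : m.-integrable setT (EFin \o (fun x => 2 * `|r x * h x|)).
    by have := integrableZl measurableT 2 i3.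
  have i5 : m.-integrable setT (EFin \o (fun x => s * `|r x| + s^-1 * (`|r x| * h x ^+ 2))).
    by have := integrableD measurableT i1 i2.
  rewrite /a /b -(RintegralZl _ measurableT iA) -(RintegralZl _ measurableT iB).
  rewrite -(RintegralD measurableT i1 i2).
  apply: (@le_trans _ _ (2 * \int[m]_x `|r x * h x|)).
    by rewrite ler_wpM2l //; exact: le_normr_Rintegral.
  rewrite -(RintegralZl _ measurableT i3); apply: le_Rintegral => // x _.
  rewrite normrM -(real_normK (num_real (h x))).
  have q : 0 <= s^-1 * (`|r x| * (s - `|h x|) ^+ 2).
    by apply: mulr_ge0; [rewrite invr_ge0 ltW|rewrite mulr_ge0 ?sqr_ge0].
  rewrite -subr_ge0; apply: (le_trans q); rewrite le_eqVlt; apply/orP; left; apply/eqP.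
  by field; rewrite gt_eqF.
have h2 : 2 * `|c| <= `|c| + A * b / `|c|.
  apply: (le_trans h1); apply: lerD.
    rewrite /s -mulrA -[leRHS]mulr1 ler_wpM2l //.
    by rewrite mulrC ler_pdivrMr // mul1r.
  by rewrite /s invf_div mulrAC.
have h3 : `|c| <= A * b / `|c| by lra.
by rewrite -(real_normK (num_real c)) expr2 -ler_pdivlMr.
Qed.
End weighted_cauchy_schwarz.

Section convolution.
Context {R : realType}.
Local Notation mR := (measurableTypeR R).
Local Notation mR3 := (R3 mR).
Implicit Types (phi psi : 'I_3 -> R -> R) (x y : R3 R) (h : R3 R -> R).

Definition sqi h : Prop := measurable_fun [set: mR3] h /\
  (\int[leb3]_x (h x ^+ 2)%:E < +oo)%E.

Definition conv (rho h : R3 R -> R) x : R := Rintegral leb3 setT (fun y => rho (x - y) * h y).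

Lemma coordB i x y : coord i (x - y) = coord i x - coord i y.
Proof. by elim/ord3_ind: i. Qed.

Lemma measurable_subR3 : measurable_fun [set: mR3 * mR3] (fun p : mR3 * mR3 => p.1 - p.2 : mR3).
Proof.
apply/measurable_fun_pairP; split => /=.
  apply/measurable_fun_pairP; split => /=.
    apply: measurable_funB.
      exact: (measurableT_comp measurable_fst (measurableT_comp measurable_fst measurable_fst)).
    exact: (measurableT_comp measurable_fst (measurableT_comp measurable_fst measurable_snd)).
  apply: measurable_funB.
    exact: (measurableT_comp measurable_snd (measurableT_comp measurable_fst measurable_fst)).
  exact: (measurableT_comp measurable_snd (measurableT_comp measurable_fst measurable_snd)).
apply: measurable_funB.
  exact: (measurableT_comp measurable_snd measurable_fst).
exact: (measurableT_comp measurable_snd measurable_snd).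
Qed.

Lemma measurable_subl x : measurable_fun [set: mR3] (fun y : mR3 => x - y : mR3).
Proof. exact: (measurableT_comp measurable_subR3 (measurable_pair1 (x : mR3))). Qed.

Lemma sqi_integrable h : sqi h ->
  leb3.-integrable [set: mR3] (EFin \o (fun y => h y ^+ 2)).
Proof.
move=> [mh ih]; apply/integrableP; split.
  by apply/measurable_EFinP; exact: measurable_funX.
apply: le_lt_trans ih; rewrite le_eqVlt; apply/orP; left; apply/eqP.
by apply: eq_integral => x _; rewrite gee0_abs // lee_fin sqr_ge0.
Qed.

Lemma integrable_majorant x (r K : R) h : sqi h -> leb3.-integrable [set: mR3]
  (EFin \o (fun y => K * (\1_(cube x r) y + h y ^+ 2))).
Proof.
move=> sh; have i1 := integrableD measurableT (integrable_cube x r) (sqi_integrable sh).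
by have := integrableZl measurableT K i1.
Qed.

(** [|h| <= 1 + h^2] turns a bounded kernel with bounded support and a square integrable [h] into an
    integrable majorant. *)
Lemma majorant_le x (r K : R) (rho : R3 R -> R) h y : 0 <= K ->
  `|rho y| <= K -> (rho y != 0 -> cube x r y) ->
  `|rho y * h y| <= K * (\1_(cube x r) y + h y ^+ 2).
Proof.
move=> K0 rK rc; have [->|r0] := eqVneq (rho y) 0.
  by rewrite mul0r normr0 mulr_ge0 // addr_ge0 ?sqr_ge0 // indicE.
rewrite indicE (mem_set (rc r0)) normrM; apply: ler_pM => //=.
rewrite -(real_normK (num_real (h y))).
have := sqr_ge0 (`|h y| - 2^-1); lra.
Qed.

Lemma measurable_conv_kernel phi x : (forall i, unit_test (phi i)) ->
  measurable_fun [set: mR3] (fun y => tens phi (x - y)).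
Proof.
move=> tp; apply: (measurableT_comp _ (measurable_subl x)).
by apply: measurable_tens => i; exact: unit_test_measurable.
Qed.

Lemma conv_integrable phi h x : (forall i, unit_test (phi i)) -> sqi h ->
  leb3.-integrable [set: mR3] (EFin \o (fun y => tens phi (x - y) * h y)).
Proof.
move=> tp sh; have [K K0 hK] := tens_bounded tp.
apply: (le_integrable _ _ _ (integrable_majorant x 1 K sh)) => //.
  apply/measurable_EFinP; apply: measurable_funM; last exact: sh.1.
  exact: measurable_conv_kernel.
move=> y _; rewrite !abse_EFin lee_fin [leRHS]ger0_norm; last first.
  by rewrite mulr_ge0 // addr_ge0 ?sqr_ge0 // indicE.
apply: (majorant_le (rho := fun y => tens phi (x - y))) => // t0.
apply/cubeP => i; have := tens_support tp t0 i; rewrite coordB ler_norml => /andP[a b].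
by apply/andP; split; lra.
Qed.

Lemma is_derive_conv j phi h x : (forall i, unit_test (phi i)) -> sqi h ->
  is_derive x (basis3 j) (conv (tens phi) h) (conv (tens (dtens j phi)) h x).
Proof.
move=> tp sh; apply: is_derive_at.
pose f (t : R) (y : R3 R) := tens phi (x + t *: basis3 j - y) * h y.
have tdp := unit_test_dtens j tp; have [K K0 hK] := tens_bounded tdp.
have fd (t : R) y : is_derive t (1:R) (f ^~ y) (tens (dtens j phi) (x + t *: basis3 j - y) * h y).
  have h1 : is_derive t (1:R) (fun u : R => tens phi ((x - y) + u *: basis3 j))
      (tens (dtens j phi) ((x - y) + t *: basis3 j)).
    apply: (@is_derive_line R _ (tens phi) (x - y) (basis3 j) t _).1.
    by apply: is_derive_tens => i; exact: (tp i).1.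
  have h2 : is_derive t (1:R) (fun u : R => tens phi (x + u *: basis3 j - y))
      (tens (dtens j phi) (x + t *: basis3 j - y)).
    rewrite (addrAC x (t *: _)).
    by rewrite (_ : (fun u : R => _) = (fun u : R => tens phi ((x - y) + u *: basis3 j))) //;
      apply/funext => u; rewrite addrAC.
  by apply: is_derive_eq; rewrite /GRing.scale /=; ring.
have I0 : `](-1), 1[%classic (0 : R) by rewrite /= in_itv /=; apply/andP; split; lra.
have fi t : `](-1), 1[%classic t -> leb3.-integrable [set: mR3] (EFin \o f t).
  by move=> _; exact: conv_integrable.
have fder t y : `](-1), 1[%classic t -> [set: mR3] y -> derivable (f ^~ y) t 1.
  by move=> _ _; have [] := fd t y.
have f1E t y : partial1of2 f t y = tens (dtens j phi) (x + t *: basis3 j - y) * h y.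
  by rewrite partial1of2E; have [_ ->] := fd t y.
(* Radius 2: the kernel reaches distance 1 from [x + t e_j], and [|t| < 1]. This majorant is uniform
   in [t], as differentiation under the integral requires. *)
have G0 y : 0 <= K * (\1_(cube x 2) y + h y ^+ 2).
  by rewrite mulr_ge0 // addr_ge0 ?sqr_ge0 // indicE.
have Gub t y : `](-1), 1[%classic t -> [set: mR3] y ->
    `|partial1of2 f t y| <= K * (\1_(cube x 2) y + h y ^+ 2).
  rewrite /= in_itv /= => /andP[t1 t2] _; rewrite f1E.
  apply: (majorant_le (rho := fun y => tens (dtens j phi) (x + t *: basis3 j - y))) => // t0.
  apply/cubeP => i; have := tens_support tdp t0 i.
  rewrite coordB coord_line ler_norml => /andP[a b].
  by case: (i == j) a b => /=; rewrite ?mulr1 ?mulr0 => a b; apply/andP; split; lra.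
have D := @derivable_under_integral _ _ _ leb3 f setT measurableT 0 (-1) 1 I0 fi fder
  _ G0 (integrable_majorant x 2 K sh) Gub.
have V := @differentiation_under_integral _ _ _ leb3 f setT measurableT 0 (-1) 1 I0 fi fder
  _ G0 (integrable_majorant x 2 K sh) Gub.
split; first exact: D.
rewrite -derive1E [LHS]V; apply: eq_Rintegral => y _.
by rewrite f1E scale0r addr0.
Qed.

Lemma convD phi h1 h2 x : (forall i, unit_test (phi i)) -> sqi h1 -> sqi h2 ->
  conv (tens phi) (fun y => h1 y + h2 y) x = conv (tens phi) h1 x + conv (tens phi) h2 x.
Proof.
move=> tp s1 s2; rewrite /conv -RintegralD //; try exact: conv_integrable.
by apply: eq_Rintegral => y _; rewrite mulrDr.
Qed.

Lemma convZ phi h (c : R) x : (forall i, unit_test (phi i)) -> sqi h ->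
  conv (tens phi) (fun y => c * h y) x = c * conv (tens phi) h x.
Proof.
move=> tp s1; rewrite /conv -RintegralZl //; last exact: conv_integrable.
by apply: eq_Rintegral => y _; rewrite mulrCA.
Qed.

Lemma measurable_conv (rho h : R3 R -> R) : measurable_fun [set: mR3] rho ->
  measurable_fun [set: mR3] h -> measurable_fun [set: mR3] (conv rho h).
Proof.
move=> mr mh.
apply: (@measurable_Rintegral_snd _ _ mR3 mR3 R sleb3 (fun p => rho (p.1 - p.2) * h p.2)).
apply: measurable_funM.
  exact: (measurableT_comp mr measurable_subR3).
exact: (measurableT_comp mh measurable_snd).
Qed.
End convolution.

Section schur_test.
Context d (T : measurableType d) {R : realType}.
Variables (m : {sigma_finite_measure set T -> \bar R}) (k : T * T -> R).
Variables (w h : T -> R) (A A' Kw : R).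
Hypothesis mk : measurable_fun setT k.
Hypothesis mw : measurable_fun setT w.
Hypothesis mh : measurable_fun setT h.
Hypothesis A0 : 0 < A.
Hypothesis A'0 : 0 <= A'.
Hypothesis Kw0 : 0 <= Kw.
Hypothesis w0 : forall x, 0 <= w x.
Hypothesis kA : forall x, (\int[m]_y (`|k (x, y)|)%:E <= A%:E)%E.
Hypothesis kA' : forall y, (\int[m]_x (`|k (x, y)|)%:E <= A'%:E)%E.
Hypothesis kw : forall x y, k (x, y) != 0 -> w x <= Kw * w y.
Hypothesis kh : forall x, m.-integrable setT (EFin \o (fun y => k (x, y) * h y)).

(** Cauchy-Schwarz against [|k|] in [y], and Tonelli to integrate [|k|] in [x]. By [kw] the weight
    at [x] is replaced by the weight at [y] wherever the kernel is nonzero. *)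
Lemma schur_test :
  (\int[m]_x (w x * (Rintegral m setT (fun y => k (x, y) * h y)) ^+ 2)%:E <=
   (A * A' * Kw)%:E * \int[m]_x (w x * h x ^+ 2)%:E)%E.
Proof.
pose F (p : T * T) : R := `|k p| * (Kw * (w p.2 * h p.2 ^+ 2)).
have mwh : measurable_fun setT (fun y => w y * h y ^+ 2).
  by apply: measurable_funM => //; exact: measurable_funX.
have mF : measurable_fun setT (EFin \o F).
  apply/measurable_EFinP; apply: measurable_funM; first exact: measurableT_comp.
  by apply: measurable_funM => //; exact: (measurableT_comp mwh measurable_snd).
have F0 p : (0 <= (EFin \o F) p)%E.
  by rewrite lee_fin; do 3 (apply: mulr_ge0 => //); exact: sqr_ge0.
have mkx x : measurable_fun setT (fun y => k (x, y)).
  exact: (measurableT_comp mk (measurable_pair1 x)).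
have mky y : measurable_fun setT (fun x => k (x, y)).
  exact: (measurableT_comp mk (measurable_pair2 y)).
have pw x : ((w x * (Rintegral m setT (fun y => k (x, y) * h y)) ^+ 2)%:E <=
    A%:E * \int[m]_y (F (x, y))%:E)%E.
  have cs := weighted_cauchy_schwarz (mkx x) mh A0 (kA x) (kh x).
  have mkh : measurable_fun setT (fun y => (`|k (x, y)| * h y ^+ 2)%:E).
    apply/measurable_EFinP; apply: measurable_funM; first exact: measurableT_comp.
    exact: measurable_funX.
  have kh0 y : (0 <= (`|k (x, y)| * h y ^+ 2)%:E)%E by rewrite lee_fin mulr_ge0 ?sqr_ge0.
  apply: (@le_trans _ _ ((w x)%:E * (A%:E * \int[m]_y (`|k (x, y)| * h y ^+ 2)%:E))%E).
    by rewrite EFinM lee_wpmul2l // lee_fin.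
  rewrite muleCA lee_wpmul2l ?lee_fin ?(ltW A0) //.
  rewrite -ge0_integralZl_EFin //.
  apply: ge0_le_integral => //.
  - by move=> y _; apply: mule_ge0 (kh0 y); rewrite lee_fin.
  - exact: measurable_funeM.
  - exact: (measurableT_comp mF (measurable_pair1 x)).
  - move=> y _; rewrite -EFinM lee_fin /F /=.
    have [->|kn] := eqVneq (k (x, y)) 0; first by rewrite normr0 !(mul0r, mulr0).
    rewrite mulrCA ler_wpM2l // mulrA ler_wpM2r ?sqr_ge0 //; exact: kw.
apply: (@le_trans _ _ (\int[m]_x (A%:E * \int[m]_y (F (x, y))%:E))%E).
  apply: ge0_le_integral => //.
  - by move=> x _; rewrite lee_fin mulr_ge0 // sqr_ge0.
  - apply/measurable_EFinP; apply: measurable_funM => //; apply: measurable_funX.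
    apply: (@measurable_Rintegral_snd _ _ T T R m (fun p => k p * h p.2)).
    by apply: measurable_funM => //; exact: (measurableT_comp mh measurable_snd).
  - by apply: measurable_funeM; exact: (measurable_fun_fubini_tonelli_F _ mF F0).
rewrite ge0_integralZl_EFin ?(ltW A0) //; last 2 first.
  by move=> x _; apply: integral_ge0 => y _; exact: F0.
  exact: (measurable_fun_fubini_tonelli_F _ mF F0).
have -> := @fubini_tonelli _ _ T T R m m (EFin \o F) mF F0.
rewrite -mulrA EFinM -muleA lee_wpmul2l ?lee_fin ?(ltW A0) //.
rewrite -ge0_integralZl_EFin ?mulr_ge0 //; last 2 first.
  by move=> x _; rewrite lee_fin mulr_ge0 ?sqr_ge0.
  exact/measurable_EFinP.
apply: ge0_le_integral => //.
- by move=> y _; apply: integral_ge0 => x _; exact: F0.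
- exact: (measurable_fun_fubini_tonelli_G _ mF F0).
- by apply: measurable_funeM; exact/measurable_EFinP.
- move=> y _.
  have c0 : 0 <= Kw * (w y * h y ^+ 2).
    by do 2 (apply: mulr_ge0 => //); exact: sqr_ge0.
  rewrite (_ : (\int[m]_x _)%E =
    ((Kw * (w y * h y ^+ 2))%:E * \int[m]_x (`|k (x, y)|)%:E)%E); last first.
    rewrite -ge0_integralZl_EFin //; last by apply/measurable_EFinP; exact: measurableT_comp.
    by apply: eq_integral => x _; rewrite /F /= EFinM muleC.
  apply: (@le_trans _ _ ((Kw * (w y * h y ^+ 2))%:E * A'%:E)%E).
    by rewrite lee_wpmul2l ?lee_fin.
  by rewrite -!EFinM lee_fin le_eqVlt; apply/orP; left; apply/eqP; ring.
Qed.
End schur_test.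

Section mollifier.
Context {R : realType}.
Local Notation mR := (measurableTypeR R).
Local Notation mR3 := (R3 mR).
Implicit Types (phi : 'I_3 -> R -> R) (x y : R3 R) (h : R3 R -> R).

Lemma leb3_cubeE x r : 0 < r -> leb3 (cube x r) = ((2 * r) ^+ 3)%:E.
Proof.
move=> r0; rewrite leb3E /sleb3 /= /cube.
have m a b : measurable (`[a, b]%classic : set mR) by exact: measurable_itv.
have l (a : R) : (@lebesgue_measure R `[(a - r)%R, (a + r)%R]%classic = (2 * r)%:E)%E.
  rewrite lebesgue_measure_itv /= lte_fin ifT; last by lra.
  by rewrite -EFinB; congr EFin; ring.
have e1 := @product_measure1E _ _ _ _ _ (@sleb2 R) (@sleb R) _ _
  (measurableX (m (x.1.1 - r) (x.1.1 + r)) (m (x.1.2 - r) (x.1.2 + r)))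
  (m (x.2 - r) (x.2 + r)).
have e2 := @product_measure1E _ _ _ _ _ (@sleb R) (@sleb R) _ _
  (m (x.1.1 - r) (x.1.1 + r)) (m (x.1.2 - r) (x.1.2 + r)).
rewrite [LHS]e1 /= e2.
transitivity ((2 * r)%:E * (2 * r)%:E * (2 * r)%:E)%E.
  by congr (_ * _ * _)%E; exact: l.
by rewrite -!EFinM; congr EFin; ring.
Qed.

Lemma tens_kernel_bound phi : (forall i, unit_test (phi i)) ->
  exists2 A, 0 < A & (forall x, (\int[leb3]_y (`|tens phi (x - y)|)%:E <= A%:E)%E) /\
     forall y, (\int[leb3]_x (`|tens phi (x - y)|)%:E <= A%:E)%E.
Proof.
move=> tp; have [K K0 hK] := tens_bounded tp.
have mt := measurable_tens (fun i => unit_test_measurable (tp i)).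
(* The supremum times the volume of a cube of side 2; the summand 1 makes the constant positive even
   if the kernel vanishes. *)
exists (K * 2 ^+ 3 + 1) => [|]; first by rewrite ltr_wpDl ?mulr_ge0 ?exprn_ge0.
have cl z (f : R3 R -> R) : measurable_fun [set: mR3] f -> (forall y, `|f y| <= K) ->
    (forall y, f y != 0 -> cube z 1 y) ->
    (\int[leb3]_y (`|f y|)%:E <= (K * 2 ^+ 3 + 1)%:E)%E.
  move=> mf fK fc; apply: (@le_trans _ _ (\int[leb3]_y (K%:E * (\1_(cube z 1) y)%:E))%E).
    apply: ge0_le_integral => //.
    - by apply/measurable_EFinP; exact: measurableT_comp.
    - by apply: measurable_funeM; apply/measurable_EFinP; exact: measurable_indic (measurable_cube z 1).
    - move=> y _; rewrite -EFinM lee_fin.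
      have [->|r0] := eqVneq (f y) 0; first by rewrite normr0 mulr_ge0 // indicE.
      by rewrite indicE (mem_set (fc _ r0)) mulr1.
  rewrite ge0_integralZl_EFin //; last first.
    by apply/measurable_EFinP; exact: measurable_indic (measurable_cube z 1).
  rewrite integral_indic ?setIT; [|exact: measurableT|exact: measurable_cube].
  by rewrite leb3_cubeE // -EFinM lee_fin mulr1 lerDl.
have co (z : R3 R) i : 0 <= coord i z <= 1 -> `|coord i z| <= 1.
  by rewrite ler_norml => /andP[a b]; apply/andP; split; lra.
split=> [x|y].
  apply: (cl x) => // [|y t0]; first exact: measurable_conv_kernel.
  apply/cubeP => i; have := co _ _ (tens_support tp t0 i).
  by rewrite coordB distrC.
apply: (cl y) => // [|x t0]; first exact: (measurableT_comp mt (measurable_shift3 (- y))).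
apply/cubeP => i; have := co _ _ (tens_support tp t0 i).
by rewrite coordB.
Qed.

Section weighted_bound.
Variables (w : R3 R -> R) (Kw : R).
Hypothesis mw : measurable_fun [set: mR3] w.
Hypothesis w1 : forall x, 1 <= w x.
Hypothesis wK : forall x y, (forall i, `|coord i (x - y)| <= 1) -> w x <= Kw * w y.

Let w0 x : 0 <= w x. Proof. by apply: le_trans (w1 x). Qed.
Let Kw0 : 0 <= Kw.
Proof.
have h : w 0 <= Kw * w 0.
  by apply: wK => i; rewrite subr0 (_ : coord i 0 = 0) ?normr0 //; elim/ord3_ind: i.
rewrite leNgt; apply/negP => k0; have := lt_le_trans (lt_le_trans ltr01 (w1 0)) h.
by rewrite ltNge mulr_le0_ge0 // ltW.
Qed.

Lemma conv_weighted_le phi h (A : R) : (forall i, unit_test (phi i)) -> 0 < A ->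
  (forall x, (\int[leb3]_y (`|tens phi (x - y)|)%:E <= A%:E)%E) ->
  (forall y, (\int[leb3]_x (`|tens phi (x - y)|)%:E <= A%:E)%E) -> sqi h ->
  (\int[leb3]_x (w x * conv (tens phi) h x ^+ 2)%:E <=
   (A * A * Kw)%:E * \int[leb3]_x (w x * h x ^+ 2)%:E)%E.
Proof.
move=> tp A0 hA hA' sh.
have mt := measurable_tens (fun i => unit_test_measurable (tp i)).
apply: (@schur_test _ mR3 R sleb3 (fun p => tens phi (p.1 - p.2)) w h A A Kw) => //.
- exact: (measurableT_comp mt measurable_subR3).
- exact: sh.1.
- exact: ltW.
- move=> x y /= t0; apply: wK => i; have := tens_support tp t0 i.
  by rewrite ler_norml => /andP[a b]; apply/andP; split; lra.
- by move=> x; exact: conv_integrable.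
Qed.
End weighted_bound.
End mollifier.

(** * Normalised mollifiers *)

Section standard_mollifier.
Context {R : realType}.
Local Notation mR := (measurableTypeR R).
Local Notation mR3 := (R3 mR).
Implicit Types (phi : 'I_3 -> R -> R) (x y z : R3 R) (h : R3 R -> R).

Lemma smooth_cst n (c : R) : smooth n (fun=> c).
Proof.
elim: n c => [//|n ih] c; apply: (@smoothS _ _ _ (fun=> 0)) (ih 0) => x.

Qed.

(** The normalising constant sits in the first coordinate only, so that it occurs exactly once in
    the tensor product. *)
Definition scaled_bump (c : R) (n : nat) (i : 'I_3) (t : R) : R :=
  (if i == 0 then c else 1) * bump (n.+1%:R * t).

Lemma scaled_bump_test c n i : unit_test (scaled_bump c n i).
Proof.
split=> [k|t t01].
  apply: smoothM; first exact: smooth_cst.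
  rewrite (_ : (fun t => _) = (fun t => bump (n.+1%:R * t + 0))); last first.
    by apply/funext => t; rewrite addr0.
  exact: (smooth_affine _ _ (smooth_bump k)).
rewrite /scaled_bump bump_eq0 ?mulr0 //; apply: contra t01 => /andP[a b].
have n1 : 1 <= n.+1%:R :> R by rewrite ler1n.
have t0 : 0 < t by move: a; rewrite pmulr_rgt0.
rewrite (ltW t0) /=; apply: le_trans (ltW b); rewrite -[leLHS]mul1r ler_wpM2r //.
exact: ltW.
Qed.

Lemma tens_scaled_bump c n z : tens (scaled_bump c n) z = c * tens (scaled_bump 1 n) z.
Proof. by rewrite /tens /scaled_bump /=; ring. Qed.

Lemma tens_scaled_bump_ge0 n z : 0 <= tens (scaled_bump 1 n) z.
Proof. by rewrite /tens /scaled_bump /= !mul1r; apply: mulr_ge0; first apply: mulr_ge0; exact: bump_ge0. Qed.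

Lemma scaled_bump_support c n z : tens (scaled_bump c n) z != 0 ->
  forall i, 0 < coord i z < n.+1%:R^-1.
Proof.
apply: contraNP => /existsNP[i /negP hi]; apply/eqP.
have h0 : bump (n.+1%:R * coord i z) = 0.
  rewrite bump_eq0 //; apply: contra hi => /andP[a b].
  move: a; rewrite pmulr_rgt0 // => -> /=.
  by rewrite -[ltRHS]mul1r ltr_pdivlMr // mulrC.
by move: h0; elim/ord3_ind: i {hi} => h0; rewrite /tens /scaled_bump h0 !(mulr0, mul0r).
Qed.

Lemma measurable_tens_bump c n : measurable_fun [set: mR3] (tens (scaled_bump c n)).
Proof. by apply: measurable_tens => i; exact: unit_test_measurable (scaled_bump_test c n i). Qed.

Lemma bump_lower_bound : exists2 b : R, 0 < b & forall t, 4^-1 <= t <= 3 / 4 -> b <= bump t.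
Proof.
have le1 : (4^-1 : R) <= 3 / 4 by lra.
have cf : {within `[(4^-1 : R), 3 / 4], continuous bump}.
  by apply: continuous_subspaceT; exact: smooth_continuous (smooth_bump 1).
have [c cI hc] := EVT_min le1 cf.
exists (bump c); last by move=> t tI; apply: hc; rewrite in_itv.
by apply: bump_gt0; move: cI; rewrite in_itv /= => /andP[a b]; apply/andP; split; lra.
Qed.

Definition bump_mass n : R := Rintegral leb3 setT (fun y => tens (scaled_bump 1 n) (0 - y)).

Lemma bump_massE n :
  (\int[leb3]_y (tens (scaled_bump 1 n) (0 - y))%:E)%E = (bump_mass n)%:E.
Proof.
have [A A0 [h _]] := tens_kernel_bound (scaled_bump_test 1 n).
rewrite /bump_mass /Rintegral fineK // ge0_fin_numE; last first.
  by apply: integral_ge0 => y _; rewrite lee_fin tens_scaled_bump_ge0.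
apply: le_lt_trans (ltry A); apply: le_trans (h 0).
rewrite le_eqVlt; apply/orP; left; apply/eqP; apply: eq_integral => y _.
by rewrite ger0_norm // tens_scaled_bump_ge0.
Qed.

Lemma bump_mass_gt0 n : 0 < bump_mass n.
Proof.
have [b b0 hb] := bump_lower_bound.
have M0 : 0 < n.+1%:R :> R by rewrite ltr0n.
(* In the cube of centre [z] and half-side [r], each coordinate of [- y] lies between [r] and [3 r].
   Multiplied by [n + 1] it falls in [[1/4, 3/4]], where the bump has a positive lower bound. *)
pose r : R := (4 * n.+1%:R)^-1; have r0 : 0 < r by rewrite invr_gt0 mulr_gt0.
pose z : R3 R := (- (2 * r), - (2 * r), - (2 * r)).
rewrite -lte_fin -bump_massE.
apply: (@lt_le_trans _ _ (\int[leb3]_y ((b ^+ 3)%:E * (\1_(cube z r) y)%:E))%E).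
  rewrite ge0_integralZl_EFin //; first last.
  - exact: exprn_ge0 (ltW b0).
  - by apply/measurable_EFinP; exact: measurable_indic (measurable_cube z r).
  rewrite integral_indic ?setIT; [|exact: measurableT|exact: measurable_cube].
  rewrite leb3_cubeE // -EFinM lte_fin; apply: mulr_gt0; first by rewrite exprn_gt0.
  by rewrite exprn_gt0 // mulr_gt0.
apply: ge0_le_integral => //.
- by move=> y _; rewrite -EFinM lee_fin mulr_ge0 ?(exprn_ge0 _ (ltW b0)) ?indicE.
- by apply: measurable_funeM; apply/measurable_EFinP; exact: measurable_indic (measurable_cube z r).
- by apply/measurable_EFinP; exact: measurable_conv_kernel (scaled_bump_test 1 n).
move=> y _; rewrite -EFinM lee_fin indicE.
have [/set_mem/cubeP yc|_] := boolP (y \in cube z r); last by rewrite mulr0 tens_scaled_bump_ge0.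
have hi i : b <= bump (n.+1%:R * coord i (0 - y)).
  apply: hb; have := yc i; rewrite (_ : coord i z = - (2 * r)); last by elim/ord3_ind: i.
  rewrite coordB (_ : coord i 0 = 0); last by elim/ord3_ind: i.
  have rE : n.+1%:R * r = 4^-1 by rewrite /r invfM mulrCA divff ?mulr1 // gt_eqF.
  rewrite ler_norml => /andP[/(ler_wpM2l (ltW M0)) p1 /(ler_wpM2l (ltW M0)) p2].
  move: p1 p2; rewrite mulrN rE mulrDr mulrN mulrN [_ * (2 * r)]mulrCA rE opprK sub0r mulrN.
  by move=> p1 p2; apply/andP; split; lra.
rewrite mulr1 /tens /scaled_bump /= !mul1r exprS expr2 mulrA.
have b0' := ltW b0; apply: ler_pM => //; first by rewrite mulr_ge0.
exact: ler_pM.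
Qed.

Definition mol n : 'I_3 -> R -> R := scaled_bump (bump_mass n)^-1 n.

Lemma mol_test n i : unit_test (mol n i). Proof. exact: scaled_bump_test. Qed.

Lemma mol_ge0 n z : 0 <= tens (mol n) z.
Proof.
by rewrite /mol tens_scaled_bump mulr_ge0 ?tens_scaled_bump_ge0 // invr_ge0 (ltW (bump_mass_gt0 n)).
Qed.

Lemma mol_mass n x : (\int[leb3]_y (tens (mol n) (x - y))%:E = 1)%E.
Proof.
have m0 c : measurable_fun [set: mR3] (fun y => (tens (scaled_bump c n) (0 - y))%:E).
  by apply/measurable_EFinP; exact: measurable_conv_kernel (scaled_bump_test c n).
have e : (\int[leb3]_y (tens (mol n) (0 - y))%:E = 1)%E.
  rewrite /mol; under eq_integral do rewrite tens_scaled_bump EFinM.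
  rewrite ge0_integralZl_EFin //.
  - by rewrite bump_massE -EFinM mulVf // gt_eqF // bump_mass_gt0.
  - by move=> y _; rewrite lee_fin tens_scaled_bump_ge0.
  - by rewrite invr_ge0 (ltW (bump_mass_gt0 n)).
have h0 y : (0 <= (tens (mol n) (0 - y))%:E)%E by rewrite lee_fin mol_ge0.
rewrite -[RHS]e -(ge0_integral_shift (- x) (m0 _) h0).
by apply: eq_integral => y _; rewrite opprD opprK addrA add0r addrC.
Qed.

Lemma mol_mass_r n y : (\int[leb3]_x (tens (mol n) (x - y))%:E = 1)%E.
Proof.
have mt := measurable_tens_bump (bump_mass n)^-1 n.
have m0 : measurable_fun [set: mR3] (fun x => (tens (mol n) x)%:E) by exact/measurable_EFinP.
have h0 x : (0 <= (tens (mol n) x)%:E)%E by rewrite lee_fin mol_ge0.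
have -> := ge0_integral_shift (- y) m0 h0.
(* The mollifier takes the same value at [e - x] as at [x], so its integral in [x] is the one
   already computed in the other variable. *)
pose e : R3 R := (n.+1%:R^-1, n.+1%:R^-1, n.+1%:R^-1).
rewrite -(mol_mass n e); apply: eq_integral => x _; congr EFin.
have hb i (t : R) : bump (n.+1%:R * t) = bump (n.+1%:R * (coord i e - t)).
  rewrite -bump_sym (_ : coord i e = n.+1%:R^-1); last by elim/ord3_ind: i.
  by rewrite mulrBr divff // gt_eqF.
by rewrite /tens /mol /scaled_bump !coordB -!hb.
Qed.

Lemma mol_mass_norm n : (forall x, (\int[leb3]_y (`|tens (mol n) (x - y)|)%:E <= 1%:E)%E) /\
  (forall y, (\int[leb3]_x (`|tens (mol n) (x - y)|)%:E <= 1%:E)%E).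
Proof.
split=> x; rewrite le_eqVlt; apply/orP; left; apply/eqP.
  by rewrite -[RHS](mol_mass n x); apply: eq_integral => y _; rewrite ger0_norm // mol_ge0.
by rewrite -[RHS](mol_mass_r n x); apply: eq_integral => y _; rewrite ger0_norm // mol_ge0.
Qed.
End standard_mollifier.

(** * Convergence of mollifications in weighted spaces *)

Import HBNNSimple.

Section mollification_density.
Context {R : realType}.
Local Notation mR := (measurableTypeR R).
Local Notation mR3 := (R3 mR).
Implicit Types (x y z : R3 R) (g h : R3 R -> R).
Variables (w : R3 R -> R) (Kw : R).
Hypothesis mw : measurable_fun [set: mR3] w.
Hypothesis w1 : forall x, 1 <= w x.
Hypothesis wK : forall x y, (forall i, `|coord i (x - y)| <= 1) -> w x <= Kw * w y.
Hypothesis wI : forall r, (\int[leb3]_x (w x * \1_(cube (0 : R3 R) r) x)%:E < +oo)%E.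

Let w0 x : 0 <= w x. Proof. by apply: le_trans (w1 x). Qed.

Let Kw0 : 0 <= Kw.
Proof.
have h : w 0 <= Kw * w 0.
  by apply: wK => i; rewrite subr0 (_ : coord i 0 = 0) ?normr0 //; elim/ord3_ind: i.
rewrite leNgt; apply/negP => k0; have := lt_le_trans (lt_le_trans ltr01 (w1 0)) h.
by rewrite ltNge mulr_le0_ge0 // ltW.
Qed.

Definition wsq h : \bar R := (\int[leb3]_x (w x * h x ^+ 2)%:E)%E.

Definition wsqi h : Prop := measurable_fun [set: mR3] h /\ (wsq h < +oo)%E.

Definition moll n h : R3 R -> R := conv (tens (mol n)) h.

(** The class to be shown equal to the whole weighted space: it is linear, closed under dominated
    pointwise limits, and contains the indicators of a generating pi-system. *)
Definition moll_cvg h : Prop := wsqi h /\ forall e : R, 0 < e ->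
  exists N, forall n, (N <= n)%N -> (wsq (fun x => (moll n h x - h x)%R) <= e%:E)%E.

Lemma wsq_pos h x : (0 <= (w x * h x ^+ 2)%:E)%E.
Proof. by rewrite lee_fin mulr_ge0 ?sqr_ge0. Qed.

Lemma wsq_ge0 h : (0 <= wsq h)%E.
Proof. by apply: integral_ge0 => x _; exact: wsq_pos. Qed.

Lemma measurable_wsq h : measurable_fun [set: mR3] h ->
  measurable_fun [set: mR3] (fun x => (w x * h x ^+ 2)%:E).
Proof.
by move=> mh; apply/measurable_EFinP; apply: measurable_funM => //; exact: measurable_funX.
Qed.

Lemma wsq_le g h : measurable_fun [set: mR3] g -> measurable_fun [set: mR3] h ->
  (forall x, `|g x| <= `|h x|) -> (wsq g <= wsq h)%E.
Proof.
move=> mg mh gh; apply: ge0_le_integral => //; try exact: measurable_wsq.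
- by move=> x _; exact: wsq_pos.
- move=> x _; rewrite lee_fin ler_wpM2l //.
  by rewrite -(real_normK (num_real (g x))) -(real_normK (num_real (h x))) lerXn2r ?nnegrE.
Qed.

Lemma wsqD g h : measurable_fun [set: mR3] g -> measurable_fun [set: mR3] h ->
  (wsq (fun x => (g x + h x)%R) <= 2%:E * (wsq g + wsq h))%E.
Proof.
move=> mg mh.
have mgh := measurable_funD mg mh.
rewrite /wsq -ge0_integralD //; try exact: measurable_wsq; try by move=> x _; exact: wsq_pos.
rewrite -ge0_integralZl_EFin //; first last.
- by apply: emeasurable_funD; exact: measurable_wsq.
- by move=> x _; rewrite adde_ge0 // wsq_pos.
apply: ge0_le_integral => //.
- by move=> x _; exact: (wsq_pos (fun x => g x + h x)).
- exact: (measurable_wsq mgh).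
- by apply: measurable_funeM; apply: emeasurable_funD; exact: measurable_wsq.
move=> x _; rewrite -EFinD -EFinM lee_fin -mulrDr [leRHS]mulrCA ler_wpM2l //.
have := sqr_ge0 (g x - h x); rewrite -subr_ge0 => p; rewrite -subr_ge0.
by apply: (le_trans p); rewrite le_eqVlt; apply/orP; left; apply/eqP; ring.
Qed.

Lemma wsqZ (c : R) h : measurable_fun [set: mR3] h ->
  wsq (fun x => c * h x) = ((c ^+ 2)%:E * wsq h)%E.
Proof.
move=> mh; rewrite /wsq -ge0_integralZl_EFin ?sqr_ge0 //; last exact: measurable_wsq.
  by apply: eq_integral => x _; rewrite -EFinM; congr EFin; ring.
by move=> x _; exact: wsq_pos.
Qed.

Lemma wsqi_sqi h : wsqi h -> sqi h.
Proof.
move=> [mh ih]; split=> //; apply: le_lt_trans ih.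
apply: ge0_le_integral => //.
- by move=> x _; rewrite lee_fin sqr_ge0.
- by apply/measurable_EFinP; exact: measurable_funX.
- exact: measurable_wsq.
- by move=> x _; rewrite lee_fin -[leLHS]mul1r ler_wpM2r ?sqr_ge0.
Qed.

Lemma wsqiD g h : wsqi g -> wsqi h -> wsqi (fun x => g x + h x).
Proof.
move=> [mg ig] [mh ih]; split; first exact: measurable_funD.
apply: le_lt_trans (wsqD mg mh) _.
by rewrite lte_mul_pinfty // ?lee_fin // lte_add_pinfty.
Qed.

Lemma wsqiZ c h : wsqi h -> wsqi (fun x => c * h x).
Proof.
move=> [mh ih]; split; first exact: measurable_funM.
by rewrite wsqZ // lte_mul_pinfty // lee_fin sqr_ge0.
Qed.

Lemma measurable_moll n h : measurable_fun [set: mR3] h -> measurable_fun [set: mR3] (moll n h).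
Proof.
by move=> mh; apply: measurable_conv => //;
   apply: measurable_tens => i; exact: unit_test_measurable (mol_test n i).
Qed.

Lemma wsq_moll n h : sqi h -> (wsq (moll n h) <= Kw%:E * wsq h)%E.
Proof.
move=> sh; have [h1 h2] := mol_mass_norm (R := R) n.
by have := conv_weighted_le mw w1 wK (mol_test n) ltr01 h1 h2 sh; rewrite !mul1r.
Qed.

Lemma mollD n g h x : wsqi g -> wsqi h ->
  moll n (fun y => g y + h y) x = moll n g x + moll n h x.
Proof. by move=> /wsqi_sqi sg /wsqi_sqi sh; apply: convD => // i; exact: mol_test. Qed.

Lemma mollZ n c h x : wsqi h -> moll n (fun y => c * h y) x = c * moll n h x.
Proof. by move=> /wsqi_sqi sh; apply: convZ => // i; exact: mol_test. Qed.

Lemma moll_cvgD g h : moll_cvg g -> moll_cvg h -> moll_cvg (fun x => g x + h x).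
Proof.
move=> [sg cg] [sh ch]; split=> [|e e0]; first exact: wsqiD.
have e4 : 0 < e / 4 by rewrite divr_gt0.
have [N1 h1] := cg _ e4; have [N2 h2] := ch _ e4.
exists (maxn N1 N2) => n; rewrite geq_max => /andP[n1 n2].
have mg := measurable_moll n sg.1; have mh := measurable_moll n sh.1.
rewrite (_ : (fun x => _) = (fun x => (moll n g x - g x) + (moll n h x - h x))); last first.
  by apply/funext => x; rewrite mollD //; ring.
apply: le_trans (wsqD (measurable_funB mg sg.1) (measurable_funB mh sh.1)) _.
apply: (@le_trans _ _ (2%:E * ((e / 4)%:E + (e / 4)%:E))%E).
  by apply: lee_wpmul2l; [rewrite lee_fin|apply: leeD; [exact: h1|exact: h2]].
by rewrite -EFinD -EFinM lee_fin; lra.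
Qed.

Lemma moll_cvgZ c h : moll_cvg h -> moll_cvg (fun x => c * h x).
Proof.
move=> [sh ch]; split=> [|e e0]; first exact: wsqiZ.
have c0 : 0 < c ^+ 2 + 1 by rewrite ltr_wpDl ?sqr_ge0.
have [N hN] := ch (e / (c ^+ 2 + 1)) (divr_gt0 e0 c0).
exists N => n nN'; have nN := hN n nN'; have mh := measurable_moll n sh.1.
rewrite (_ : (fun x => _) = (fun x => c * (moll n h x - h x))); last first.
  by apply/funext => x; rewrite mollZ // mulrBr.
rewrite wsqZ; last exact: (measurable_funB mh sh.1).
apply: (@le_trans _ _ ((c ^+ 2)%:E * (e / (c ^+ 2 + 1))%:E)%E).
  by apply: lee_wpmul2l; [rewrite lee_fin sqr_ge0|exact: nN].
rewrite -EFinM lee_fin mulrCA ler_piMr ?(ltW e0) // ler_pdivrMr // mul1r.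
by rewrite lerDl.
Qed.

Lemma wsq_dominated (g_ : nat -> R3 R -> R) g : (forall k, measurable_fun [set: mR3] (g_ k)) ->
  wsqi g -> (forall k x, `|g_ k x| <= g x) -> (forall x, g_ ^~ x @ \oo --> (0 : R)) ->
  forall e : R, 0 < e -> exists N, forall k, (N <= k)%N -> (wsq (g_ k) <= e%:E)%E.
Proof.
move=> mg [mg' ig] gg g0 e e0.
have ige : leb3.-integrable [set: mR3] (fun x => (w x * g x ^+ 2)%:E).
  apply/integrableP; split; first exact: measurable_wsq.
  apply: le_lt_trans ig; rewrite le_eqVlt; apply/orP; left; apply/eqP.
  by apply: eq_integral => x _; rewrite gee0_abs // wsq_pos.
have c : (wsq (g_ k) @[k --> \oo] --> 0%E)%classic.
  rewrite (_ : 0%E = (\int[leb3]_(x in [set: mR3]) (cst 0%E : R3 R -> \bar R) x)%E); last first.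
    by rewrite integral_cst //= mul0e.
  apply: (dominated_cvg measurableT _ _ _ ige).
  - by move=> k; exact: measurable_wsq.
  - move=> x _; apply: cvg_EFin.
      by apply: nearW.
    rewrite /=.
    have h1 : (fun k => w x * g_ k x ^+ 2) @ \oo --> w x * (0 * 0).
      by apply: cvgM; [exact: cvg_cst|apply: cvgM; exact: g0].
    by rewrite !mulr0 in h1; exact: h1.
  - by move=> x _.
  - move=> k x _; rewrite gee0_abs ?wsq_pos // lee_fin ler_wpM2l //.
    rewrite -(real_normK (num_real (g_ k x))) lerXn2r ?nnegrE //.
    by apply: le_trans (gg k x).
have [hf hc] := (fine_cvgP _ _).1 c.
have := hc; move/cvgrPdist_le => /(_ e e0) he.
have [N _ hN] : \forall k \near \oo, (wsq (g_ k) <= e%:E)%E.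
  near=> k.
  have kf : wsq (g_ k) \is a fin_num by near: k.
  rewrite -(fineK kf) lee_fin.
  have : `|0 - fine (wsq (g_ k))| <= e by near: k.
  by rewrite sub0r normrN ger0_norm // fine_ge0 // wsq_ge0.
by exists N => k; exact: hN.
Unshelve. all: by end_near. Qed.

(** With [d = h_k - h] small in norm, the mollification error of [h] is that of [h_k], plus [d],
    minus the mollification of [d]. The last is small because mollification is bounded uniformly in
    [n]. *)
Lemma moll_cvg_dominated (h_ : nat -> R3 R -> R) g h : (forall k, moll_cvg (h_ k)) ->
  measurable_fun [set: mR3] h -> wsqi g -> (forall k x, `|h_ k x| <= g x) ->
  (forall x, h_ ^~ x @ \oo --> h x) -> moll_cvg h.
Proof.
move=> ch mh sg hg hh.
have hgx x : `|h x| <= g x.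
  have c : (fun k => `|h_ k x|) @ \oo --> `|h x| by exact: cvg_norm (hh x).
  rewrite -(cvg_lim (@Rhausdorff R) c); apply: limr_le; first by apply/cvg_ex; exists `|h x|.
  by apply: nearW => k.
have sh : wsqi h.
  split=> //; apply: le_lt_trans sg.2; apply: wsq_le => // [|x]; first exact: sg.1.
  exact: le_trans (hgx x) (ler_norm _).
pose d k x := h_ k x - h x.
have sd k : wsqi (d k).
  have := wsqiD (ch k).1 (wsqiZ (-1) sh).
  by rewrite (_ : (fun x => h_ k x + -1 * h x) = d k) //; apply/funext => x; rewrite mulN1r.
split=> // e e0.
(* Chosen so that [2 (Kw t + 2 (e / 8 + t)) = e] for [t = e / (4 (Kw + 2))]; the outer factors 2
   come from [wsqD]. *)
have K2 : 0 < 4 * (Kw + 2) by rewrite mulr_gt0 // ltr_wpDl.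
have ed : 0 < e / (4 * (Kw + 2)) by rewrite divr_gt0.
have [k0 hk0] : exists N, forall k, (N <= k)%N -> (wsq (d k) <= (e / (4 * (Kw + 2)))%:E)%E.
  apply: (@wsq_dominated d (fun x => 2 * g x)) => //.
  - by move=> k; exact: (sd k).1.
  - exact: wsqiZ.
  - move=> k x; rewrite mulrDl !mul1r; apply: le_trans (ler_normB _ _) _.
    by apply: lerD; [exact: hg|exact: hgx].
  - move=> x; have c : (fun k => h_ k x - h x) @ \oo --> h x - h x.
      by apply: cvgB; [exact: hh|exact: cvg_cst].
    by rewrite subrr in c; exact: c.
have hd := hk0 _ (leqnn k0); move: hd (sd k0) (ch k0); set dk := d k0; set hk := h_ k0.
move=> hd sdk [shk chk].
have e8 : 0 < e / 8 by rewrite divr_gt0.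
have [N hN] := chk _ e8; exists N => n nN; have hn := hN n nN.
have mdk := measurable_moll n sdk.1; have mhk := measurable_moll n shk.1.
have mN : measurable_fun [set: mR3] (fun x => -1 * moll n dk x) by exact: measurable_funM.
have mB := measurable_funB mhk shk.1; have mA := measurable_funD mB sdk.1.
rewrite (_ : (fun x => _) = (fun x => -1 * moll n dk x + ((moll n hk x - hk x) + dk x))); last first.
  apply/funext => x.
  rewrite (_ : h = (fun y => hk y + -1 * dk y)); last first.
    by apply/funext => y; rewrite /dk /d /hk; ring.
  rewrite mollD //; last exact: wsqiZ.
  by rewrite mollZ // /dk /d /hk; ring.
have b1 : (wsq (fun x => (-1 * moll n dk x)%R) <= (Kw * (e / (4 * (Kw + 2))))%:E)%E.
  rewrite wsqZ // sqrrN expr1n mul1e; apply: le_trans (wsq_moll n (wsqi_sqi sdk)) _.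
  by rewrite EFinM; apply: lee_wpmul2l => //; rewrite lee_fin.
have b2 : (wsq (fun x => ((moll n hk x - hk x) + dk x)%R) <=
    (2 * (e / 8 + e / (4 * (Kw + 2))))%:E)%E.
  apply: le_trans (wsqD mB sdk.1) _; rewrite EFinM [X in (_ <= _ * X)%E]EFinD.
  by apply: lee_wpmul2l; [rewrite lee_fin|apply: leeD].
apply: le_trans (wsqD mN mA) _.
apply: (@le_trans _ _ (2%:E * ((Kw * (e / (4 * (Kw + 2))))%:E + (2 * (e / 8 + e / (4 * (Kw + 2))))%:E))%E).
  by apply: lee_wpmul2l; [rewrite lee_fin|apply: leeD].
rewrite -EFinD -EFinM lee_fin le_eqVlt; apply/orP; left; apply/eqP.
have K2' : Kw + 2 != 0 by rewrite gt_eqF // ltr_wpDl.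
by field.
Qed.

(* The mollifiers are supported in ]0, 1/n[^3, so they recover the indicator
   of such a set at every point; these sets form a pi-system
   generating the Borel sets. *)
Definition left_constant (A : set mR3) : Prop := measurable A /\
  forall x, exists2 delta : R, 0 < delta &
    forall y, (forall i, 0 < coord i (x - y) < delta) -> (A y <-> A x).

Lemma left_constantI A B : left_constant A -> left_constant B -> left_constant (A `&` B).
Proof.
move=> [mA hA] [mB hB]; split=> [|x]; first exact: measurableI.
have [d1 p1 h1] := hA x; have [d2 p2 h2] := hB x.
exists (Num.min d1 d2) => [|y hy]; first by rewrite lt_min p1 p2.
have k1 := h1 y _; have k2 := h2 y _.
rewrite /setI /= k1 ?k2 // => i; have /andP[a] := hy i; rewrite lt_min => /andP[b c];
  by rewrite a.
Qed.

(** The half-space must be closed on this side: the nearby points considered have smaller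
    coordinates than [x], so they stay inside when [x] lies on the boundary. *)
Lemma left_constant_coord i (b : R) : left_constant [set x | coord i x <= b].
Proof.
split=> [|x].
  rewrite (_ : [set _ | _] = coord i @^-1` `]-oo, b]).
    by rewrite -[X in measurable X]setTI; apply: measurable_coord => //; exact: measurable_itv.
  by apply/seteqP; split=> x; rewrite /= in_itv.
have [xb|bx] := leP (coord i x) b.
  exists 1 => // y /(_ i); rewrite coordB => /andP[h _] /=; split=> // _; lra.
exists (coord i x - b); first by rewrite subr_gt0.
move=> y /(_ i); rewrite coordB => /andP[_ h] /=; split; last by rewrite leNgt bx.
by move=> h'; exfalso; lra.
Qed.

(** Half-open, so as to be left constant. *)
Definition box (k : nat) : set mR3 := [set x | forall i, - k%:R < coord i x <= k%:R].

Lemma left_constantC A : left_constant A -> left_constant (~` A).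
Proof.
move=> [mA hA]; split=> [|x]; first exact: measurableC.
have [d d0 h] := hA x; exists d => // y hy; have := h y hy; rewrite /setC /=; tauto.
Qed.

Lemma left_constant_box k : left_constant (box k).
Proof.
have h i : left_constant ([set x | coord i x <= k%:R] `&` ~` [set x | coord i x <= - k%:R]).
  by apply: left_constantI; [|apply: left_constantC]; exact: left_constant_coord.
rewrite (_ : box k = ([set x | coord 0 x <= k%:R] `&` ~` [set x | coord 0 x <= - k%:R]) `&`
  ([set x | coord 1 x <= k%:R] `&` ~` [set x | coord 1 x <= - k%:R]) `&`
  ([set x | coord 2%:R x <= k%:R] `&` ~` [set x | coord 2%:R x <= - k%:R])).
  by do 2 (apply: left_constantI => //).
have e (a : R) : (~ (a <= - k%:R)) <-> (- k%:R < a).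
  by rewrite ltNge; split => /negP.
apply/seteqP; split=> x; rewrite /box /setI /setC /= !e.
  by move=> hx; have := hx 0; have := hx 1; have := hx 2%:R;
    do 3 (case/andP=> ? ?).
by move=> [[[a1 b1] [a2 b2]] [a3 b3]]; elim/ord3_ind; apply/andP.
Qed.

Lemma box_cube k : box k `<=` cube (0 : R3 R) k%:R.
Proof.
move=> x hx; apply/cubeP => i; rewrite (_ : coord i 0 = 0); last by elim/ord3_ind: i.
by rewrite subr0 ler_norml; have /andP[a b] := hx i; rewrite b andbT ltW.
Qed.

Lemma wsqi_cube r : wsqi (\1_(cube (0 : R3 R) r)).
Proof.
split; first exact: measurable_indic (measurable_cube _ r).
apply: le_lt_trans (wI r); rewrite le_eqVlt; apply/orP; left; apply/eqP.
by apply: eq_integral => x _; rewrite indicE; case: (x \in _); rewrite ?expr1n ?expr0n.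
Qed.

Lemma wsqi_indic A r : measurable A -> A `<=` cube (0 : R3 R) r -> wsqi (\1_A).
Proof.
move=> mA Ar; have [mc ic] := wsqi_cube r; have mi := measurable_indic mA.
split=> //; apply: le_lt_trans ic; apply: wsq_le => // x; rewrite !indicE.
by have [/set_mem/Ar/mem_set->|] := boolP (x \in A); rewrite ?normr0.
Qed.

(** Once the support of the kernel is smaller than the [delta] of [x], the mollified indicator
    equals its value at [x] exactly. Domination is by the cube one unit larger, since the kernel
    moves points by at most 1. *)
Lemma moll_cvg_left_constant A k : left_constant A -> A `<=` box k -> moll_cvg (\1_A).
Proof.
move=> lA Ak; have [mA hA] := lA.
have sA : wsqi (\1_A) := wsqi_indic mA (subset_trans Ak (@box_cube k)).
split=> //; have mi := measurable_indic mA.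
have sA' := wsqi_sqi sA.
apply: (@wsq_dominated _ (\1_(cube (0 : R3 R) k.+1%:R))).
- by move=> n; apply: measurable_funB => //; exact: measurable_moll.
- exact: wsqi_cube.
- move=> n x.
  have m0 : 0 <= moll n \1_A x.
    by apply: Rintegral_ge0 => y _; rewrite mulr_ge0 ?mol_ge0 // indicE.
  have m1 : moll n \1_A x <= 1.
    have im := conv_integrable x (mol_test n) sA'.
    rewrite -lee_fin /moll /conv /Rintegral fineK; last exact: (integrable_fin_num measurableT im).
    rewrite -(mol_mass n x); apply: ge0_le_integral => //.
    + by move=> y _; rewrite lee_fin mulr_ge0 ?mol_ge0 // indicE.
    + exact: measurable_int im.
    + by apply/measurable_EFinP; exact: measurable_conv_kernel (mol_test n).
    + move=> y _; rewrite lee_fin indicE -[leRHS]mulr1 ler_wpM2l ?mol_ge0 //.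
      by case: (y \in A).
  rewrite [X in _ <= X]indicE.
  have [_|/negP xc] := boolP (x \in _).
    rewrite indicE; case: (x \in A) => /=; rewrite ler_norml; apply/andP; split; lra.
  have -> : moll n \1_A x = 0.
    rewrite /moll /conv (_ : (fun y => _) = cst 0) ?Rintegral_cst ?mul0r //.
    apply/funext => y /=; apply/eqP; rewrite mulf_eq0; apply/negPn/negP.
    rewrite negb_or => /andP[t0]; rewrite indicE.
    have [/set_mem/Ak yA _|_] := boolP (y \in A); last by rewrite eqxx.
    apply: xc; apply/mem_set/cubeP => i.
    rewrite (_ : coord i 0 = 0); last by elim/ord3_ind: i.
    have := tens_support (mol_test n) t0 i; rewrite coordB subr0 ler_norml => /andP[a b].
    by have /andP[c d] := yA i; rewrite -natr1; apply/andP; split; lra.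
  rewrite indicE (_ : x \in A = false) ?subrr ?normr0 //; apply/negP => /set_mem/Ak/box_cube xk.
  apply: xc; apply/mem_set/cubeP => i; have /cubeP/(_ i) h := xk; apply: le_trans h _.
  by rewrite ler_nat.
- move=> x; have [d d0 hd] := hA x.
  apply: cvg_near_cst.
  have := near_infty_natSinv_lt (PosNum d0); apply: filterS => n /= nd.
  apply/eqP; rewrite subr_eq0; apply/eqP.
  rewrite /moll /conv.
  rewrite (_ : (fun y => _) = (fun y => \1_A x * tens (mol n) (x - y))); last first.
    apply/funext => y; have [->|t0] := eqVneq (tens (mol n) (x - y)) 0.
      by rewrite mul0r mulr0.
    rewrite mulrC; congr (_ * _).
    have e : A y <-> A x.
      apply: hd => i; have /andP[a b] := scaled_bump_support t0 i; rewrite a /=.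
      exact: lt_trans nd.
    by rewrite !indicE; congr (_%:R); congr nat_of_bool; apply/idP/idP => /set_mem/e/mem_set.
  have im : leb3.-integrable [set: mR3] (EFin \o (fun y => tens (mol n) (x - y))).
    apply/integrableP; split.
      by apply/measurable_EFinP; exact: measurable_conv_kernel (mol_test n).
    have [h1 _] := mol_mass_norm (R := R) n.
    by apply: le_lt_trans (h1 x) _; rewrite ltry.
  by rewrite RintegralZl // /Rintegral mol_mass /= mulr1.
Qed.

(** Dynkin's lemma. The intersection with [box k] keeps weighted norms finite and provides the
    dominating function for increasing unions. *)
Lemma moll_cvg_indic A k : <<s left_constant >> A -> measurable A ->
  moll_cvg (\1_(A `&` box k)).
Proof.
pose H := [set A | measurable A /\ moll_cvg (\1_(A `&` box k))].
have [mb _] := left_constant_box k.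
have sb : wsqi (\1_(box k)) := wsqi_indic mb (@box_cube k).
have HG : left_constant `<=` H.
  move=> B lB; split; first exact: lB.1.
  apply: (@moll_cvg_left_constant _ k); last by move=> x [].
  exact: left_constantI (left_constant_box k).
have HL : lambda_system setT H.
  split=> //.
  - by apply: HG; split=> // x; exists 1.
  - move=> B C CB [mB hB] [mC hC]; split; first exact: measurableD.
    rewrite (_ : \1_(_ `&` _) = (fun x => \1_(B `&` box k) x + -1 * \1_(C `&` box k) x)).
      by apply: moll_cvgD => //; exact: moll_cvgZ.
    apply/funext => x; rewrite !indicE (in_setI x (B `\` C)) classical_sets.in_setD (in_setI x B) (in_setI x C).
    have := CB x; case: (boolP (x \in C)) => [/[dup]/set_mem Cx _ /(_ Cx)/mem_set ->|_ _].
      by case: (x \in box k) => /=; ring.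
    by case: (x \in B); case: (x \in box k) => /=; ring.
  - move=> F ndF HF; have mF : measurable (\bigcup_i F i).
      by apply: bigcup_measurable => i _; exact: (HF i).1.
    split=> //; apply: (@moll_cvg_dominated (fun i => \1_(F i `&` box k)) (\1_(box k))) => //.
    + by move=> i; exact: (HF i).2.
    + by apply: measurable_indic; exact: measurableI.
    + move=> i x; rewrite !indicE in_setI; case: (x \in box k); rewrite ?andbF ?andbT.
        by case: (x \in F i); rewrite ?normr0 ?normr1.
      by rewrite normr0.
    + move=> x; apply: cvg_near_cst.
      have [[i _ Fi]|nF] := pselect ((\bigcup_i F i) x); last first.
        apply: nearW => i; rewrite !indicE (in_setI x (F i)) (in_setI x (\bigcup_i F i)).
        by rewrite (memNset nF) (memNset (_ : ~ F i x)) // => Fi; apply: nF; exists i.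
      exists i => // j /= ij; rewrite !indicE (in_setI x (F j)) (in_setI x (\bigcup_i F i)).
      rewrite (mem_set (_ : (\bigcup_i F i) x)); last by exists i.
      by rewrite (mem_set (subsetPset _ _ (ndF _ _ ij) _ Fi)).
move=> sA mA.
have GI : setI_closed left_constant by move=> B C; exact: left_constantI.
by have [] := lambda_system_subset GI HL HG (fun X _ => @subsetT _ X) sA.
Qed.

(** The Borel sets of the line are generated by the intervals []a, b]], whose preimages under a
    coordinate are left constant; the product structure is generated by such preimages. *)
Lemma measurable_left_constant A : measurable A -> <<s left_constant >> A.
Proof.
set S := <<s left_constant >>.
have sS : sigma_algebra setT S by exact: smallest_sigma_algebra.
have c1 i (B : set mR) : measurable B -> S (coord i @^-1` B).
  have := sigma_algebra_image (coord i : mR3 -> mR) sS.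
  move=> sI mB; have := smallest_sub sI _ mB; rewrite /image_set_system /= setTI; apply.
  move=> _ [[a b] _ <-] /=; rewrite setTI; apply: sub_sigma_algebra.
  rewrite (_ : _ @^-1` _ = [set x | coord i x <= b] `&` ~` [set x | coord i x <= a]).
    by apply: left_constantI; [|apply: left_constantC]; exact: left_constant_coord.
  apply/seteqP; split=> x; rewrite /preimage /setC /setI /= in_itv /= ltNge.
    by case/andP=> /negP.
  by case=> -> /negP ->.
have c2 (B : set (mR * mR)) : measurable B -> S (@fst (R * R) R @^-1` B).
  have := sigma_algebra_image (@fst (R * R) R) sS.
  move=> sI mB; have := smallest_sub sI _ mB; rewrite /image_set_system /= setTI; apply.
  move=> _ [[C mC <-]|[C mC <-]] /=; rewrite !setTI.
    exact: (c1 0 _ mC).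
  exact: (c1 1 _ mC).
move=> mA; have := smallest_sub sS _ mA; apply.
move=> _ [[C mC <-]|[C mC <-]] /=; rewrite !setTI.
  exact: (c2 _ mC).
exact: (c1 2%:R _ mC).
Qed.

Lemma moll_cvg_measurable A k : measurable A -> moll_cvg (\1_(A `&` box k)).
Proof. by move=> mA; apply: moll_cvg_indic => //; exact: measurable_left_constant. Qed.

Lemma moll_cvg_sum n (h_ : nat -> R3 R -> R) : (forall k, moll_cvg (h_ k)) ->
  moll_cvg (fun x => \sum_(k < n) h_ k x).
Proof.
move=> ch; elim: n => [|n ih].
  rewrite (_ : (fun x => _) = (fun x => 0 * h_ 0%N x)); first exact: moll_cvgZ.
  by apply/funext => x; rewrite big_ord0 mul0r.
rewrite (_ : (fun x => _) = (fun x => \sum_(k < n) h_ k x + h_ n x)); first exact: moll_cvgD.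
by apply/funext => x; rewrite big_ord_recr.
Qed.

Lemma moll_cvg_ge0 h : wsqi h -> (forall x, 0 <= h x) -> moll_cvg h.
Proof.
move=> sh h0; have mh : measurable_fun [set: mR3] (EFin \o h) by apply/measurable_EFinP; exact: sh.1.
(* The explicit dyadic approximation is used because it displays the simple function as a finite sum
   of indicators of level sets. Multiplying it by the indicator of [box k] gives a summable bound on
   each term. *)
pose f n : R3 R -> R := approx setT (EFin \o h : mR3 -> \bar R) n.
have fE n : f n = nnsfun_approx measurableT mh n by rewrite nnsfun_approxE.
have f0 n x : 0 <= f n x by rewrite fE.
have fc x : f ^~ x @ \oo --> h x.
  have : (EFin \o nnsfun_approx measurableT mh ^~ x) @ \oo --> (EFin \o h) x.
    by apply: cvg_nnsfun_approx => // y _; rewrite lee_fin.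
  move=> /(fine_cvgP _ _).1[_]; rewrite (_ : fine \o _ = f ^~ x) //.
  by apply/funext => n; rewrite /= fE.
have fh n x : f n x <= h x.
  rewrite -(cvg_lim (@Rhausdorff R) (fc x)); apply: nondecreasing_cvgn_le.
    move=> a b ab; rewrite !fE; have /lefP := nd_nnsfun_approx measurableT mh ab; exact.
  by apply/cvg_ex; exists (h x).
have boxT x : \forall k \near \oo, box k x.
  suff hi i : \forall k \near \oo, - k%:R < coord i x <= k%:R.
    have := hi 0; have := hi 1; have := hi 2%:R; move=> h2 h1 h00.
    near=> k; elim/ord3_ind.
    - by near: k; exact: h00.
    - by near: k; exact: h1.
    - by near: k; exact: h2.
  near=> k; have : `|coord i x| < k%:R by near: k; exact: nbhs_infty_gtr.
  by rewrite ltr_norml => /andP[-> /ltW ->].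
have fk k : moll_cvg (fun x => f k x * \1_(box k) x).
  pose A j := dyadic_approx setT (EFin \o h : mR3 -> \bar R) k j.
  pose B := integer_approx setT (EFin \o h : mR3 -> \bar R) k.
  rewrite (_ : (fun x => _) = (fun x =>
     \sum_(j < k * 2 ^ k) (j%:R * 2 ^- k) * \1_(A j `&` box k) x + k%:R * \1_(B `&` box k) x)).
    apply: moll_cvgD.
      apply: (@moll_cvg_sum _ (fun j x => (j%:R * 2 ^- k) * \1_(A j `&` box k) x)) => j.
      apply: moll_cvgZ; apply: moll_cvg_measurable; rewrite /A /dyadic_approx.
      case: ifPn => // _; rewrite -preimage_comp.
      by apply: (mh) => //; apply/measurable_image_EFin; exact: measurable_itv.
    apply: moll_cvgZ; apply: moll_cvg_measurable; rewrite /B /integer_approx.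
    exact: emeasurable_fun_c_infty.
  apply/funext => x; rewrite /f /approx mulrDl mulr_suml.
  have bE (a b : bool) : (a && b)%:R = a%:R * b%:R :> R.
    by case: a; rewrite ?mul1r ?mul0r.
  congr (_ + _); last by rewrite !indicE (in_setI x B) (bE (x \in B)) mulrA.
  by apply: eq_bigr => j _; rewrite !indicE (in_setI x (A j)) (bE (x \in A j)) mulrA.
apply: (@moll_cvg_dominated (fun k x => f k x * \1_(box k) x) h) => //.
- exact: sh.1.
- move=> k x; rewrite normrM (ger0_norm (f0 k x)) indicE.
  by case: (x \in _); rewrite ?normr0 ?normr1 ?mulr1 ?mulr0.
- move=> x; rewrite -[h x]mulr1; apply: cvgM; first exact: fc.
  apply: cvg_near_cst; have := boxT x; apply: filterS => k bx.
  by rewrite indicE mem_set.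
Unshelve. all: by end_near. Qed.

Lemma mollification_density h : wsqi h -> moll_cvg h.
Proof.
move=> sh; have mh := sh.1.
have hp (g : R3 R -> R) : measurable_fun [set: mR3] g -> (forall x, `|g x| <= `|h x|) ->
    (forall x, 0 <= g x) -> moll_cvg g.
  move=> mg gh; apply: moll_cvg_ge0; split=> //.
  by apply: le_lt_trans sh.2; exact: wsq_le.
have mp : measurable_fun [set: mR3] (fun x => Num.max (h x) 0).
  by apply: measurable_maxr => //; exact: measurable_cst.
have mn : measurable_fun [set: mR3] (fun x => Num.max (- h x) 0).
  by apply: measurable_maxr; [exact: measurableT_comp|exact: measurable_cst].
rewrite (_ : h = (fun x => Num.max (h x) 0 + -1 * Num.max (- h x) 0)); last first.
  apply/funext => x; rewrite mulN1r.
  by have [h0|h0] := leP 0 (h x); have [h1|h1] := leP 0 (- h x); lra.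
apply: moll_cvgD; last apply: moll_cvgZ.
  by apply: hp => // x; [have [h0|h0] := leP (h x) 0; rewrite ?normr0|rewrite le_max lexx orbT].
by apply: hp => // x; [have [h0|h0] := leP (- h x) 0; rewrite ?normr0 ?normrN|rewrite le_max lexx orbT].
Qed.
End mollification_density.

(** * Convolution and density for spinors *)

Section spinor_convolution.
Context {R : realType}.
Local Notation mR := (measurableTypeR R).
Local Notation mR3 := (R3 mR).
Local Notation V := 'cV[R[i]]_4.
Implicit Types (phi : 'I_3 -> R -> R) (x y z : R3 R) (h rho : R3 R -> R).
Implicit Types (a b : V) (u v : spinor R) (p : bool * 'I_4).

(** The eight real coordinates under one finite index type, so that scalar results transfer by a
    single sum. *)
Definition cmp p a : R := if p.1 then complex.Im (a p.2 0) else complex.Re (a p.2 0).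

Lemma ip_cmp a b : ip a b = \sum_p cmp p a * cmp p b.
Proof.
rewrite -(pair_bigA _ (fun c k => cmp (c, k) a * cmp (c, k) b)) /= big_bool.
by rewrite -big_split; apply: eq_bigr => k _; rewrite addrC.
Qed.

Lemma cmp_ext a b : (forall p, cmp p a = cmp p b) -> a = b.
Proof.
move=> h; apply/matrixP => k l; rewrite (ord1 l).
have := h (false, k); have := h (true, k); rewrite /cmp /=.
by case: (a k 0) (b k 0) => [? ?] [? ?] /= -> ->.
Qed.

Lemma cmpD p a b : cmp p (a + b) = cmp p a + cmp p b.
Proof. by rewrite /cmp mxE; case: p => -[] k /=; case: (a k 0) (b k 0) => [? ?] [? ?]. Qed.

Lemma cmpN p a : cmp p (- a) = - cmp p a.
Proof. by rewrite /cmp mxE; case: p => -[] k /=; case: (a k 0) => [? ?]. Qed.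

Lemma cmpB p a b : cmp p (a - b) = cmp p a - cmp p b.
Proof. by rewrite cmpD cmpN. Qed.

Lemma ip_ext a b : (forall c, ip c a = ip c b) -> a = b.
Proof.
move=> h; apply: cmp_ext => p.
have /eqP : ip (a - b) (a - b) = 0 by rewrite ipBr !h subrr.
rewrite ip_cmp psumr_eq0 => [/allP/(_ p)|q _]; last by rewrite -expr2 sqr_ge0.
by rewrite mem_index_enum => /(_ isT) /=; rewrite mulf_eq0 orbb cmpB subr_eq0 => /eqP.
Qed.

Lemma spinor_measurableP u :
  spinor_measurable u <-> forall p, measurable_fun [set: mR3] (fun x => cmp p (u x)).
Proof.
split=> [mu [[] k]|h k]; [exact: (mu k).2|exact: (mu k).1|].
by split; [exact: (h (false, k))|exact: (h (true, k))].
Qed.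

Lemma cmp_sq_le p a : cmp p a ^+ 2 <= ip a a.
Proof.
rewrite ip_cmp (bigD1 p) //= -expr2 lerDl.
by apply: sumr_ge0 => q _; rewrite -expr2 sqr_ge0.
Qed.

Lemma sqint_cmp u p : sqint u -> sqi (fun x => cmp p (u x)).
Proof.
move=> [mu iu]; have mp := (spinor_measurableP u).1 mu p; split=> //.
apply: le_lt_trans iu; apply: ge0_le_integral => //.
- by move=> x _; rewrite lee_fin sqr_ge0.
- by apply/measurable_EFinP; exact: measurable_funX.
- by apply/measurable_EFinP; exact: measurable_ip.
- by move=> x _; rewrite lee_fin cmp_sq_le.
Qed.

Definition sconv rho u x : V :=
  \col_k (conv rho (fun y => cmp (false, k) (u y)) x +i* conv rho (fun y => cmp (true, k) (u y)) x).

Lemma cmp_sconv rho u x p : cmp p (sconv rho u x) = conv rho (fun y => cmp p (u y)) x.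
Proof. by case: p => -[] k; rewrite /cmp /sconv !mxE. Qed.

Lemma sqi0 : sqi (fun=> (0 : R)).
Proof.
split; first exact: measurable_cst.
by under eq_integral do rewrite expr0n /=; rewrite integral0 ltry.
Qed.

Lemma sqiZ c h : sqi h -> sqi (fun x => c * h x).
Proof.
move=> [mh ih]; split; first exact: measurable_funM.
under eq_integral do rewrite exprMn EFinM.
rewrite ge0_integralZl_EFin ?sqr_ge0 //.
- by rewrite lte_mul_pinfty // lee_fin sqr_ge0.
- by move=> x _; rewrite lee_fin sqr_ge0.
- by apply/measurable_EFinP; exact: measurable_funX.
Qed.

Lemma sqiD h h' : sqi h -> sqi h' -> sqi (fun x => h x + h' x).
Proof.
move=> sh sh'; split; first exact: measurable_funD sh.1 sh'.1.
have i1 := integrableZl measurableT 2 (integrableD measurableT (sqi_integrable sh) (sqi_integrable sh')).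
apply: le_lt_trans (integrable_lty measurableT i1).
apply: ge0_le_integral => //.
- by move=> x _; rewrite lee_fin sqr_ge0.
- by apply/measurable_EFinP; apply: measurable_funX; exact: measurable_funD sh.1 sh'.1.
- exact: measurable_int i1.
- move=> x _; rewrite /= -EFinD -EFinM lee_fin -subr_ge0.
  by rewrite (_ : _ - _ = (h x - h' x) ^+ 2) ?sqr_ge0 //; ring.
Qed.

Lemma conv_sum (I : finType) (h_ : I -> R3 R -> R) phi x : (forall i, unit_test (phi i)) ->
  (forall i, sqi (h_ i)) ->
  conv (tens phi) (fun y => \sum_i h_ i y) x = \sum_i conv (tens phi) (h_ i) x.
Proof.
move=> tp sh.
have h (r : seq I) : sqi (fun y => \sum_(i <- r) h_ i y) /\
    conv (tens phi) (fun y => \sum_(i <- r) h_ i y) x = \sum_(i <- r) conv (tens phi) (h_ i) x.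
  elim: r => [|i r [s1 e1]].
    rewrite big_nil (_ : (fun y => _) = (fun=> 0)); last by apply/funext => y; rewrite big_nil.
    split; first exact: sqi0.
    rewrite /conv (_ : (fun y => _) = cst 0); last by apply/funext => y; rewrite mulr0.
    by rewrite Rintegral_cst ?mul0r.
  rewrite big_cons (_ : (fun y => _) = (fun y => h_ i y + \sum_(i <- r) h_ i y)); last first.
    by apply/funext => y; rewrite big_cons.
  by split; [exact: sqiD|rewrite convD // e1].
exact: (h _).2.
Qed.

Lemma ip_sconv phi u x a : (forall i, unit_test (phi i)) -> sqint u ->
  ip a (sconv (tens phi) u x) = conv (tens phi) (fun y => ip a (u y)) x.
Proof.
move=> tp su; rewrite ip_cmp.
rewrite (_ : (fun y => _) = (fun y => \sum_p cmp p a * cmp p (u y))); last first.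
  by apply/funext => y; rewrite ip_cmp.
rewrite conv_sum //; last by move=> p; apply: sqiZ; exact: sqint_cmp.
by apply: eq_bigr => p _; rewrite cmp_sconv convZ //; exact: sqint_cmp.
Qed.

Lemma sqi_ip u a : sqint u -> sqi (fun y => ip a (u y)).
Proof.
move=> su; have h (r : seq (bool * 'I_4)%type) : sqi (fun y => \sum_(p <- r) cmp p a * cmp p (u y)).
  elim: r => [|i r s1].
    rewrite (_ : (fun y => _) = (fun=> 0)); first exact: sqi0.
    by apply/funext => y; rewrite big_nil.
  rewrite (_ : (fun y => _) = (fun y => cmp i a * cmp i (u y) + \sum_(p <- r) cmp p a * cmp p (u y))).
    by apply: sqiD => //; apply: sqiZ; exact: sqint_cmp.
  by apply/funext => y; rewrite big_cons.
by rewrite (_ : (fun y => _) = (fun y => \sum_p cmp p a * cmp p (u y))); [exact: h|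
  apply/funext => y; rewrite ip_cmp].
Qed.

Lemma sconvD phi u v x : (forall i, unit_test (phi i)) -> sqint u -> sqint v ->
  sconv (tens phi) (fun y => u y + v y) x = sconv (tens phi) u x + sconv (tens phi) v x.
Proof.
move=> tp su sv; apply: ip_ext => a; rewrite ipDr !ip_sconv //; last exact: sqintD.
rewrite -convD //; try exact: sqi_ip.
by congr conv; apply/funext => y; rewrite ipDr.
Qed.

(** Tested against a constant vector, the matrix passes to its adjoint acting on that vector, which
    reduces the claim to scalar convolution. *)
Lemma sconv_mx phi (M : 'M[R[i]]_4) u x : (forall i, unit_test (phi i)) -> sqint u ->
  sqint (fun y => M *m u y) ->
  sconv (tens phi) (fun y => M *m u y) x = M *m sconv (tens phi) u x.
Proof.
move=> tp su sMu; apply: ip_ext => a.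
have ipM (b : V) : ip a (M *m b) = ip (map_mx conjc M^T *m a) b.
  by rewrite ipC ip_mull ipC.
rewrite ip_sconv // ipM ip_sconv //.
by congr conv; apply/funext => y; rewrite ipM.
Qed.

Section weighted_spinor_norm.
Variables (w : R3 R -> R).
Hypothesis mw : measurable_fun [set: mR3] w.
Hypothesis w0 : forall x, 0 <= w x.

Definition wip u : \bar R := (\int[leb3]_x (w x * ip (u x) (u x))%:E)%E.

Lemma wip_pos u x : (0 <= (w x * ip (u x) (u x))%:E)%E.
Proof. by rewrite lee_fin mulr_ge0 ?ip_ge0. Qed.

Lemma wip_ge0 u : (0 <= wip u)%E.
Proof. by apply: integral_ge0 => x _; exact: wip_pos. Qed.

Lemma measurable_wip u : spinor_measurable u ->
  measurable_fun [set: mR3] (fun x => (w x * ip (u x) (u x))%:E).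
Proof. by move=> mu; apply/measurable_EFinP; apply: measurable_funM => //; exact: measurable_ip. Qed.

Lemma wip_sum u : spinor_measurable u -> (wip u = \sum_p wsq w (fun x => cmp p (u x)))%E.
Proof.
move=> mu; have mp := (spinor_measurableP u).1 mu.
rewrite /wip /wsq -ge0_integral_sum //.
- by apply: eq_integral => x _; rewrite ip_cmp mulr_sumr -sumEFin.
- by move=> p; apply/measurable_EFinP; apply: measurable_funM => //; exact: measurable_funX.
- by move=> p x _; rewrite lee_fin mulr_ge0 ?sqr_ge0.
Qed.

Lemma wip_leD u v : spinor_measurable u -> spinor_measurable v ->
  (wip (fun x => u x + v x)%R <= 2%:E * (wip u + wip v))%E.
Proof.
move=> mu mv; have muv := spinor_measurableD mu mv.
rewrite /wip -ge0_integralD //; try exact: measurable_wip; try by move=> x _; exact: wip_pos.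
rewrite -ge0_integralZl_EFin //; first last.
- by apply: emeasurable_funD; exact: measurable_wip.
- by move=> x _; rewrite adde_ge0 // wip_pos.
apply: ge0_le_integral => //.
- by move=> x _; exact: (wip_pos (fun x => u x + v x)).
- exact: (measurable_wip muv).
- by apply: measurable_funeM; apply: emeasurable_funD; exact: measurable_wip.
move=> x _; rewrite -EFinD -EFinM lee_fin -mulrDr [leRHS]mulrCA ler_wpM2l //.
by have := ip_ge0 (u x - v x); rewrite !ipE (ipC (v x) (u x)) => p; lra.
Qed.

Lemma wip_sconv_le (Kw : R) phi u (A : R) :
  (forall x, 1 <= w x) ->
  (forall x y, (forall i, `|coord i (x - y)| <= 1) -> w x <= Kw * w y) ->
  (forall i, unit_test (phi i)) -> 0 < A ->
  (forall x, (\int[leb3]_y (`|tens phi (x - y)|)%:E <= A%:E)%E) ->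
  (forall y, (\int[leb3]_x (`|tens phi (x - y)|)%:E <= A%:E)%E) -> sqint u ->
  (wip (sconv (tens phi) u) <= (A * A * Kw)%:E * wip u)%E.
Proof.
move=> w1 wK tp A0 hA hA' su.
have mt := measurable_tens (fun i => unit_test_measurable (tp i)).
have ms : spinor_measurable (sconv (tens phi) u).
  apply/spinor_measurableP => p; rewrite (_ : (fun x => _) = conv (tens phi) (fun y => cmp p (u y))).
    by apply: measurable_conv => //; exact: (sqint_cmp p su).1.
  by apply/funext => x; rewrite cmp_sconv.
rewrite !wip_sum ?su.1 //; last exact: su.1.
rewrite ge0_sume_distrr; last by move=> p _; exact: wsq_ge0.
apply: lee_sum => p _.
rewrite (_ : (fun x => _) = conv (tens phi) (fun y => cmp p (u y))).
  by apply: conv_weighted_le => //; exact: sqint_cmp.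
by apply/funext => x; rewrite cmp_sconv.
Qed.
End weighted_spinor_norm.

Lemma sqint_sconv phi u : (forall i, unit_test (phi i)) -> sqint u ->
  sqint (sconv (tens phi) u).
Proof.
move=> tp su; have mt := measurable_tens (fun i => unit_test_measurable (tp i)).
split.
  apply/spinor_measurableP => p; rewrite (_ : (fun x => _) = conv (tens phi) (fun y => cmp p (u y))).
    by apply: measurable_conv => //; exact: (sqint_cmp p su).1.
  by apply/funext => x; rewrite cmp_sconv.
have [A A0 [h1 h2]] := tens_kernel_bound tp.
have m1 : measurable_fun [set: mR3] (fun=> 1 : R) by exact: measurable_cst.
have := @wip_sconv_le (fun=> 1) m1 (fun=> ler01) 1 phi u A _ _ tp A0 h1 h2 su.
rewrite /wip; under eq_integral do rewrite mul1r.
move=> h; apply: le_lt_trans (h _ _) _ => //; first by move=> *; rewrite mul1r.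
rewrite lte_mul_pinfty // ?lee_fin; first by rewrite mulr1 mulr_ge0 // ltW.
by under eq_integral do rewrite mul1r; exact: su.2.
Qed.

Lemma sder_sconv j phi u : (forall i, unit_test (phi i)) -> sqint u ->
  sder j (sconv (tens phi) u) (sconv (tens (dtens j phi)) u).
Proof.
move=> tp su x k.
have h p : is_derive x (basis3 j) (fun y => cmp p (sconv (tens phi) u y))
    (cmp p (sconv (tens (dtens j phi)) u x)).
  rewrite (_ : (fun y => _) = conv (tens phi) (fun y => cmp p (u y))).
    by rewrite cmp_sconv; apply: is_derive_conv => //; exact: sqint_cmp.
  by apply/funext => y; rewrite cmp_sconv.
by split; [exact: (h (false, k))|exact: (h (true, k))].
Qed.

Lemma sgood_sconv j phi u : (forall i, unit_test (phi i)) -> sqint u ->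
  sgood j (sconv (tens phi) u) (sconv (tens (dtens j phi)) u).
Proof.
move=> tp su; have tdp := unit_test_dtens j tp; split.
- exact: sder_sconv.
- exact: sder_cont (sder_sconv j tdp su).
- exact: sqint_sconv.
- exact: sqint_sconv.
Qed.

Section spinor_density.
Variables (w : R3 R -> R) (Kw : R).
Hypothesis mw : measurable_fun [set: mR3] w.
Hypothesis w1 : forall x, 1 <= w x.
Hypothesis wK : forall x y, (forall i, `|coord i (x - y)| <= 1) -> w x <= Kw * w y.
Hypothesis wI : forall r, (\int[leb3]_x (w x * \1_(cube (0 : R3 R) r) x)%:E < +oo)%E.

Let w0 x : 0 <= w x. Proof. by apply: le_trans (w1 x). Qed.

Definition smoll n u : spinor R := sconv (tens (mol n)) u.

Lemma wip_smoll n u : sqint u -> (wip w (smoll n u) <= Kw%:E * wip w u)%E.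
Proof.
move=> su; have [h1 h2] := mol_mass_norm (R := R) n.
by have := wip_sconv_le mw w0 w1 wK (mol_test n) ltr01 h1 h2 su; rewrite !mul1r.
Qed.

Lemma wip_sqint u : spinor_measurable u -> (wip w u < +oo)%E -> sqint u.
Proof.
move=> mu iu; split=> //; apply: le_lt_trans iu.
apply: ge0_le_integral => //.
- by move=> x _; rewrite lee_fin ip_ge0.
- by apply/measurable_EFinP; exact: measurable_ip.
- exact: measurable_wip.
- by move=> x _; rewrite lee_fin -[leLHS]mul1r ler_wpM2r ?ip_ge0.
Qed.

Lemma smoll_density u (e : R) : spinor_measurable u -> (wip w u < +oo)%E -> 0 < e ->
  exists n, (wip w (fun x => smoll n u x - u x)%R <= e%:E)%E.
Proof.
move=> mu iu e0; have su := wip_sqint mu iu.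
have wp p : wsqi w (fun x => cmp p (u x)).
  split; first exact: (sqint_cmp p su).1.
  apply: le_lt_trans iu; rewrite wip_sum // (bigD1 p) //=.
  by rewrite leeDl // sume_ge0 // => q _; exact: wsq_ge0.
(* One eighth of the error for each real component. *)
have e8 : 0 < e / 8 by rewrite divr_gt0.
have /choice[N hN] p := (mollification_density mw w1 wK wI (wp p)).2 _ e8.
pose n := (\max_p N p)%N; exists n.
have ms : spinor_measurable (fun x => smoll n u x - u x).
  have m1 := (sqint_sconv (mol_test n) su).1.
  apply/spinor_measurableP => p.
  rewrite (_ : (fun x => _) = (fun x => cmp p (smoll n u x) - cmp p (u x))).
    apply: measurable_funB; first exact: (sqint_cmp p (sqint_sconv (mol_test n) su)).1.
    exact: (sqint_cmp p su).1.
  by apply/funext => x; rewrite cmpB.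
rewrite wip_sum //; apply: (@le_trans _ _ (\sum_(p : bool * 'I_4) (e / 8)%:E)%E).
  apply: lee_sum => p _; rewrite (_ : (fun x => _) =
     (fun x => moll n (fun y => cmp p (u y)) x - cmp p (u x))).
    by apply: hN; exact: leq_bigmax.
  by apply/funext => x; rewrite cmpB cmp_sconv.
rewrite sumEFin sumr_const card_prod card_bool card_ord lee_fin.
rewrite (_ : (2 * 4)%N = 8%N) // -[leLHS]mulr_natr.
by rewrite -mulrA mulVf ?mulr1 // pnatr_eq0.
Qed.
End spinor_density.
End spinor_convolution.

(** * Resolvent estimates *)

Section core_estimate.
Context {R : realType}.
Local Notation mR := (measurableTypeR R).
Local Notation mR3 := (R3 mR).
Implicit Types (x y : R3 R).
Variable (alpha : 'I_4 -> 'M[R[i]]_4).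
Hypothesis alpha_dirac : dirac_matrices alpha.
Variable (theta : R).
Hypothesis theta_gt : 2^-1 < theta.
Hypothesis theta_le1 : theta <= 1.

Let del : R := (2 * theta - 1) / 1200.

Definition lweight x : R := wS del theta x.
Definition gweight x : R := (wS del theta x)^-1.

Let del_gt0 : 0 < del.
Proof. by apply: divr_gt0; [have h := theta_gt; lra|rewrite ltr0n]. Qed.

Let del_le1 : del <= 1.
Proof.
rewrite /del ler_pdivrMr ?ltr0n // mul1r; have h := theta_le1.
apply: (@le_trans _ _ 1); first by lra.
by rewrite ler1n.
Qed.

Let theta0 : 0 <= theta. Proof. by have h := theta_gt; lra. Qed.

Let del2_le1 : del ^+ 2 <= 1.
Proof. by rewrite expr_le1 // ltW. Qed.

Lemma gweightE x : gweight x = wq del x `^ theta.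
Proof. by rewrite /gweight /wS powRN invrK. Qed.

Lemma measurable_lweight : measurable_fun [set: mR3] lweight.
Proof. exact: measurable_wpow. Qed.

Lemma measurable_gweight : measurable_fun [set: mR3] gweight.
Proof.
rewrite (_ : gweight = (fun x => wq del x `^ theta)); first exact: measurable_wpow.
by apply/funext => x; exact: gweightE.
Qed.

Lemma lweight_gt0 x : 0 < lweight x. Proof. exact: wS_gt0. Qed.

Lemma gweight_ge1 x : 1 <= gweight x.
Proof. by rewrite gweightE -(powRr0 (wq del x)) ler_powR // wq_ge1. Qed.

Lemma lweight_le1 x : lweight x <= 1.
Proof. by rewrite -[lweight x]invrK invf_le1 ?gweight_ge1 // (lt_le_trans ltr01 (gweight_ge1 x)). Qed.

(** Summing [x_i^2 <= 2 y_i^2 + 2] gives [|x|^2 <= 2 |y|^2 + 6], and [del <= 1] bounds the constant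
    by [1 + 6]. *)
Lemma wq_shift x y : (forall i, `|coord i (x - y)| <= 1) -> wq del x <= 7 * wq del y.
Proof.
move=> h.
have hi i : coord i x ^+ 2 <= 2 * coord i y ^+ 2 + 2.
  have := h i; rewrite coordB => hc.
  have : (coord i x - coord i y) ^+ 2 <= 1.
    by rewrite -(real_normK (num_real _)) expr_le1.
  have := sqr_ge0 (coord i x - 2 * coord i y).
  rewrite -subr_ge0 => h1; rewrite -subr_ge0 => h2.
  rewrite -subr_ge0; suff -> : 2 * coord i y ^+ 2 + 2 - coord i x ^+ 2 =
    (coord i x - 2 * coord i y) ^+ 2 + 2 * (1 - (coord i x - coord i y) ^+ 2) by lra.
  by ring.
have : sqn x <= 2 * sqn y + 6.
  rewrite /sqn !sum3; have := hi 0; have := hi 1; have := hi 2%:R; lra.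
move/(ler_wpM2l (sqr_ge0 del)) => h6; rewrite /wq.
have s0 : 0 <= del ^+ 2 * sqn y by rewrite mulr_ge0 ?sqr_ge0 // sqn_ge0.
have d1 := del2_le1; rewrite mulrDr mulrCA in h6; lra.
Qed.

Lemma gweight_shift x y : (forall i, `|coord i (x - y)| <= 1) -> gweight x <= 7 * gweight y.
Proof.
move=> h; rewrite !gweightE; have q0 z := wq_gt0 del z.
apply: (@le_trans _ _ ((7 * wq del y) `^ theta)).
  by apply: ge0_ler_powR => //; rewrite ?nnegrE ?mulr_ge0 ?(ltW (q0 _)) //; exact: wq_shift.
rewrite powRM // ?(ltW (q0 _)) // ler_wpM2r ?powR_ge0 //.
by rewrite -[leRHS]powRr1 // ler_powR // ler1n.
Qed.

Lemma gweight_local r :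
  (\int[leb3]_x (gweight x * \1_(cube (0 : R3 R) r) x)%:E < +oo)%E.
Proof.
pose B : R := 1 + 3 * r ^+ 2.
have B1 : 1 <= B by rewrite /B lerDl mulr_ge0 // sqr_ge0.
have i1 := integrableZl measurableT B (integrable_cube (0 : R3 R) r).
apply: le_lt_trans (integrable_lty measurableT i1).
have mc := measurable_indic (R := R) (measurable_cube (0 : R3 R) r).
apply: ge0_le_integral => //.
- move=> x _; rewrite lee_fin mulr_ge0 ?indicE //.
  by apply: le_trans (gweight_ge1 x).
- by apply/measurable_EFinP; apply: measurable_funM => //; exact: measurable_gweight.
- exact: measurable_int i1.
move=> x _; rewrite /= -EFinM lee_fin indicE.
have [/set_mem/cubeP xc|_] := boolP (x \in _); last by rewrite !mulr0.
rewrite !mulr1 gweightE; apply: (@le_trans _ _ (wq del x `^ 1)).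
  by rewrite ler_powR // wq_ge1.
rewrite powRr1 ?(ltW (wq_gt0 _ _)) // /wq /B lerD2l.
have hi i : coord i x ^+ 2 <= r ^+ 2.
  have := xc i; rewrite (_ : coord i 0 = 0); last by elim/ord3_ind: i.
  rewrite subr0 -(real_normK (num_real (coord i x))) => h.
  by rewrite lerXn2r ?nnegrE // (le_trans _ h).
have s3 : sqn x <= 3 * r ^+ 2.
  by rewrite /sqn sum3; have := hi 0; have := hi 1; have := hi 2%:R; lra.
apply: le_trans s3; rewrite -[leRHS]mul1r ler_wpM2r //; exact: sqn_ge0.
Qed.

(* [v] is the weak derivative of [u], tested against products of one-variable
   functions only. *)
Definition molweak (j : 'I_3) (u v : spinor R) : Prop :=
  forall phi, (forall i, unit_test (phi i)) ->
  forall x, sconv (tens (dtens j phi)) u x = sconv (tens phi) v x.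

Section fixed_energy.
Variable z : R[i].

Let fE u (V : 'I_3 -> spinor R) : (fun x => dirac_symbol alpha z (u x) (V ^~ x)) =
  (fun x => (dA alpha 0 (V 0 x) + dA alpha 1 (V 1 x) +
      dA alpha 2%:R (V 2%:R x)) + dB alpha (u x) + (- z)%:M *m u x).
Proof. by apply/funext => x; rewrite /dirac_symbol sum3 mul_scalar_mx scaleNr. Qed.

Lemma sqint_dA j u : sqint u -> sqint (fun x => dA alpha j (u x)).
Proof. by apply: (@sqint_mx _ _ 1) => a; rewrite mul1r; exact: dA_iso. Qed.

Lemma sqint_dB u : sqint u -> sqint (fun x => dB alpha (u x)).
Proof. by apply: (@sqint_mx _ _ 1) => a; rewrite mul1r; exact: dB_iso. Qed.

Lemma sqint_scale c u : sqint u -> sqint (fun x => c%:M *m u x).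
Proof. by apply: (@sqint_mx _ _ (complex.Re c ^+ 2 + complex.Im c ^+ 2)) => a; exact: ip_scale. Qed.

Lemma sqint_dirac u V : sqint u -> (forall j, sqint (V j)) ->
  sqint (fun x => dirac_symbol alpha z (u x) (V ^~ x)).
Proof.
move=> su sV; rewrite fE.
by do !apply: sqintD; [exact: sqint_dA|exact: sqint_dA|exact: sqint_dA|exact: sqint_dB|exact: sqint_scale].
Qed.

Lemma sconv_dirac phi u V x : (forall i, unit_test (phi i)) ->
  sqint u -> (forall j, sqint (V j)) ->
  sconv (tens phi) (fun x => dirac_symbol alpha z (u x) (V ^~ x)) x =
  dirac_symbol alpha z (sconv (tens phi) u x) (fun j => sconv (tens phi) (V j) x).
Proof.
move=> tp su sV.
have sA j := sqint_dA j (sV j); have sB := sqint_dB su; have sz := sqint_scale (- z) su.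
have s1 := sqintD (sA 0) (sA 1); have s2 := sqintD s1 (sA 2%:R); have s3 := sqintD s2 sB.
rewrite fE.
rewrite (sconvD x tp s3 sz) (sconvD x tp s2 sB) (sconvD x tp s1 (sA 2%:R)).
rewrite (sconvD x tp (sA 0) (sA 1)).
rewrite /dA /dB (@sconv_mx _ phi _ (V 0) x tp (sV 0) (sA 0)).
rewrite (@sconv_mx _ phi _ (V 1) x tp (sV 1) (sA 1)).
rewrite (@sconv_mx _ phi _ (V 2%:R) x tp (sV 2%:R) (sA 2%:R)).
rewrite (@sconv_mx _ phi _ u x tp su sB) (@sconv_mx _ phi _ u x tp su sz).
by rewrite /dirac_symbol sum3 mul_scalar_mx scaleNr.
Qed.
End fixed_energy.

(** The 7 is the shift constant of [gweight], the 2 the loss in splitting [u] into its mollification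
    and a remainder. *)
Definition core_const : R := 2 * (7 * smooth_const theta).

(** Mollification commutes with the constant-coefficient operator [H_0 - z] and is uniformly bounded
    for [gweight], so the smooth estimate applies to each mollification of [u]. As [lweight <= 1],
    the remainder need only be small in the unweighted norm. *)
Lemma core_estimate (lam mu : R) (u : spinor R) (V : 'I_3 -> spinor R) :
  2 <= `|lam| -> mu != 0 -> `|mu| <= 1 -> sqint u -> (forall j, sqint (V j)) ->
  (forall j, molweak j u (V j)) ->
  (wip lweight u <= core_const%:E *
     wip gweight (fun x => dirac_symbol alpha (lam +i* mu) (u x) (V ^~ x)))%E.
Proof.
move=> lam2 mu0 mu1 su sV uV.
set g := fun x => dirac_symbol alpha (lam +i* mu) (u x) (V ^~ x).
have sg : sqint g by exact: sqint_dirac.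
have C0 := smooth_const_gt0 theta_gt.
have lam4 : 4 <= lam ^+ 2.
  by rewrite -(real_normK (num_real lam)) (_ : 4 = 2 ^+ 2) ?lerXn2r ?nnegrE //; ring.
have ml := measurable_lweight; have mg := measurable_gweight.
have l0 x := ltW (lweight_gt0 x).
have mol1 n : (wip lweight (smoll n u) <= (7 * smooth_const theta)%:E * wip gweight g)%E.
  pose U j := sconv (tens (dtens j (mol n))) u.
  pose UU k j := sconv (tens (dtens k (dtens j (mol n)))) u.
  have tm := mol_test (R := R) n.
  have uU k : sgood k (smoll n u) (U k) by exact: sgood_sconv.
  have UUU j k : sgood k (U j) (UU k j) by apply: sgood_sconv => //; exact: unit_test_dtens.
  have UUs j k x : UU j k x = UU k j x by rewrite /UU dtensC.
  have := smooth_bound alpha_dirac theta_gt theta_le1 lam4 mu0 mu1 uU UUU UUs.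
  move/le_trans; apply; rewrite (mulrC 7) EFinM -muleA.
  apply: lee_wpmul2l; first by rewrite lee_fin ltW.
  have := wip_smoll mg gweight_ge1 gweight_shift n sg; apply: le_trans.
  rewrite le_eqVlt; apply/orP; left; apply/eqP; apply: eq_integral => x _.
  have -> : dirac_symbol alpha (lam +i* mu) (smoll n u x) (U ^~ x) = smoll n g x; last by [].
  rewrite /smoll (sconv_dirac _ x tm su sV); congr dirac_symbol; apply/funext => j.
  exact: uV.
apply/lee_addgt0Pr => e e0.
have e2 : 0 < e / 2 by rewrite divr_gt0.
have m1 : measurable_fun [set: mR3] (fun=> 1 : R) by exact: measurable_cst.
have i1 r : (\int[leb3]_x (1 * \1_(cube (0 : R3 R) r) x)%:E < +oo)%E.
  by under eq_integral do rewrite mul1r; exact: integrable_lty (integrable_cube _ _).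
have u1 : (wip (fun=> 1%R) u < +oo)%E.
  by rewrite /wip; under eq_integral do rewrite mul1r; exact: su.2.
have k1 (x y : R3 R) : (forall i, `|coord i (x - y)| <= 1) -> 1 <= 1 * 1 :> R by rewrite mulr1.
have [n hn] := @smoll_density _ (fun=> 1) 1 m1 (fun=> lexx 1) k1 i1 u _ su.1 u1 e2.
have ms := (sqint_sconv (mol_test (R := R) n) su).1.
have md : spinor_measurable (fun x => u x - smoll n u x).
  apply/spinor_measurableP => p.
  rewrite (_ : (fun x => _) = (fun x => cmp p (u x) - cmp p (smoll n u x))).
    by apply: measurable_funB; [exact: ((spinor_measurableP _).1 su.1)|exact: ((spinor_measurableP _).1 ms)].
  by apply/funext => x; rewrite cmpB.
have eu : u = (fun x => smoll n u x + (u x - smoll n u x)).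
  by apply/funext => x; rewrite addrC subrK.
rewrite {1}eu; apply: le_trans (wip_leD ml l0 ms md) _.
have hd : (wip lweight (fun x => u x - smoll n u x)%R <= (e / 2)%:E)%E.
  apply: le_trans hn; apply: ge0_le_integral => //.
  - by move=> x _; exact: (wip_pos l0 (fun x => u x - smoll n u x)).
  - exact: (measurable_wip ml md).
  - apply: measurable_wip => //; apply/spinor_measurableP => p.
    rewrite (_ : (fun x => _) = (fun x => cmp p (smoll n u x) - cmp p (u x))).
      by apply: measurable_funB; [exact: ((spinor_measurableP _).1 ms)|exact: ((spinor_measurableP _).1 su.1)].
    by apply/funext => x; rewrite cmpB.
  - move=> x _; rewrite lee_fin -[u x - _]opprB ipNl ipNr opprK ler_wpM2r ?ip_ge0 //.
    exact: lweight_le1.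
apply: (@le_trans _ _ (2%:E * ((7 * smooth_const theta)%:E * wip gweight g + (e / 2)%:E))%E).
  by apply: lee_wpmul2l; [rewrite lee_fin|apply: leeD; [exact: mol1|exact: hd]].
rewrite ge0_muleDr.
- rewrite muleA -EFinM -EFinM leeD2l // lee_fin; lra.
- rewrite mule_ge0 ?lee_fin ?mulr_ge0 ?(ltW C0) // wip_ge0 // => x.
  by apply: le_trans (gweight_ge1 x).
- by rewrite lee_fin ltW.
Qed.
End core_estimate.

(** * Weak derivatives tested by convolution kernels *)

Section weak_derivatives.
Context {R : realType}.
Local Notation mR := (measurableTypeR R).
Local Notation mR3 := (R3 mR).
Implicit Types (x y : R3 R) (phi psi : 'I_3 -> R -> R) (u v : spinor R).

Lemma continuous_coord (i : 'I_3) : continuous (coord i : R3 R -> R).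
Proof.
move=> x; elim/ord3_ind: i; rewrite /coord /=.
- by apply: (@continuous_comp _ _ _ fst fst); [exact: cvg_fst|exact: cvg_fst].
- by apply: (@continuous_comp _ _ _ fst snd); [exact: cvg_fst|exact: cvg_snd].
- exact: cvg_snd.
Qed.

Lemma continuous_tens psi : (forall i, continuous (psi i)) -> continuous (tens psi).
Proof.
move=> cp x; rewrite /tens.
have h i : {for x, continuous (fun y => psi i (coord i y))}.
  by apply: continuous_comp; [exact: continuous_coord|exact: cp].
by apply: cvgM; [apply: cvgM|]; exact: h.
Qed.

Lemma partial_tens j psi : (forall i, smooth 1 (psi i)) ->
  partial j (tens psi) = tens (dtens j psi).
Proof.
move=> sp; apply/funext => x; rewrite /partial.
by have [_ ->] := is_derive_tens j x sp.
Qed.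

Lemma Ck_tens n psi : (forall i k, smooth k (psi i)) -> Ck n (tens psi).
Proof.
elim: n psi => [|n ih] psi sp /=.
  by split=> //; apply: continuous_tens => i; exact: smooth_continuous (sp i 1%N).
split=> [|j]; first by apply: continuous_tens => i; exact: smooth_continuous (sp i 1%N).
split=> [x|]; first by have [] := is_derive_tens j x (fun i => sp i 1%N).
rewrite partial_tens //; apply: ih => i k; rewrite /dtens.
by case: eqP => _ //; exact: (sp i k.+1).2.
Qed.

Lemma compact_cube x (r : R) : compact (cube x r : set (R3 R)).
Proof. by apply: compact_setX; first apply: compact_setX; exact: segment_compact. Qed.

Lemma test_function_tens x (r : R) psi : (forall i k, smooth k (psi i)) ->
  (forall y, tens psi y != 0 -> cube x r y) -> test_function (tens psi).
Proof.
move=> sp hc; split=> [n|]; first exact: Ck_tens.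
apply: (@subclosed_compact _ _ (cube x r : set (R3 R))).
- exact: closed_closure.
- exact: compact_cube.
- have cc : closed (cube x r : set (R3 R)).
    by apply: compact_closed; [exact: norm_hausdorff|exact: compact_cube].
  rewrite closure_id in cc; rewrite cc; apply: closureS; exact: hc.
Qed.

(** Factors of the test function [y |-> phi (x - y)], written affinely so that [smooth_affine]
    applies. *)
Definition reflect_at x phi (i : 'I_3) (t : R) : R := phi i (-1 * t + coord i x).

Lemma tens_reflect x phi y : tens (reflect_at x phi) y = tens phi (x - y).
Proof. by rewrite /tens /reflect_at !coordB !mulN1r ![_ + coord _ x]addrC. Qed.

Lemma dtens_reflect j x phi y : (forall i, smooth 1 (phi i)) ->
  tens (dtens j (reflect_at x phi)) y = - tens (dtens j phi) (x - y).
Proof.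
move=> sp.
have d i t : derive1 (reflect_at x phi i) t = - derive1 (phi i) (coord i x - t).
  rewrite derive1E /reflect_at.
  have h1 : is_derive (-1 * t + coord i x) (1:R) (phi i) (derive1 (phi i) (-1 * t + coord i x)).
    exact: smooth_is_derive (sp i).
  have h2 : is_derive t (1:R) (fun t : R => -1 * t + coord i x) (-1).
    by apply: is_derive_eq; rewrite /GRing.scale /= ?scaler0; ring.
  have := @is_derive1_comp _ (phi i) (fun t : R => -1 * t + coord i x) t _ _ h1 h2.
  by move=> [_]; rewrite /comp => ->; rewrite mulN1r mulrC mulN1r addrC.
have r i t : reflect_at x phi i t = phi i (coord i x - t).
  by rewrite /reflect_at mulN1r addrC.
rewrite /tens /dtens !coordB.
by elim/ord3_ind: j => /=; rewrite !r d; ring.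
Qed.

Lemma smooth_reflect x phi i k : (forall i k, smooth k (phi i)) -> smooth k (reflect_at x phi i).
Proof. by move=> sp; apply: smooth_affine. Qed.

Lemma test_function_reflect x phi : (forall i, unit_test (phi i)) ->
  test_function (tens (reflect_at x phi)).
Proof.
move=> tp; apply: (@test_function_tens x 1) => [i k|y].
  by apply: smooth_reflect => i' k'; exact: (tp i').1.
rewrite tens_reflect => /(tens_support tp) h; apply/cubeP => i; have := h i.
rewrite coordB distrC ler_norml => /andP[a b]; apply/andP; split; lra.
Qed.

(** The weak derivative is tested against [y |-> phi (x - y)]; the sign from differentiating this
    reflection cancels the sign of integration by parts. *)
Lemma molweak_weak_partial j u v : sqint u -> sqint v -> is_weak_partial j u v -> molweak j u v.
Proof.
move=> su sv h phi tp x; apply: cmp_ext => p; rewrite !cmp_sconv.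
have sp i : smooth 1 (phi i) by exact: (tp i).1.
have tt := test_function_reflect x tp.
have := h _ tt p.2; rewrite /cintegral /=.
set I1 := Rintegral _ _ _; set I2 := Rintegral _ _ _.
set J1 := Rintegral _ _ _; set J2 := Rintegral _ _ _.
case=> hr hi.
have ReM' (c : R[i]) (r : R) : complex.Re (c * r%:C) = complex.Re c * r.
  by case: c => a b /=; rewrite mulr0 subr0.
have ImM' (c : R[i]) (r : R) : complex.Im (c * r%:C) = complex.Im c * r.
  by case: c => a b /=; rewrite mulr0 add0r.
have sr : forall i, smooth 1 (reflect_at x phi i) by move=> i; exact: smooth_affine.
have E (c : R3 R -> R) : sqi c ->
    Rintegral leb3 setT (fun y => c y * partial j (tens (reflect_at x phi)) y) =
    - conv (tens (dtens j phi)) c x.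
  move=> sc; rewrite partial_tens // /conv.
  rewrite -[RHS]mulN1r -RintegralZl //; last exact: conv_integrable (unit_test_dtens j tp) sc.
  by apply: eq_Rintegral => y _; rewrite dtens_reflect // mulN1r mulrN mulrC.
have E' (c : R3 R -> R) :
    Rintegral leb3 setT (fun y => c y * tens (reflect_at x phi) y) = conv (tens phi) c x.
  by apply: eq_Rintegral => y _; rewrite tens_reflect mulrC.
have e1 : I1 = - conv (tens (dtens j phi)) (fun y => complex.Re (u y p.2 0)) x.
  rewrite -E; last exact: (sqint_cmp (false, p.2) su).
  by apply: eq_Rintegral => y _; rewrite ReM'.
have e2 : I2 = - conv (tens (dtens j phi)) (fun y => complex.Im (u y p.2 0)) x.
  rewrite -E; last exact: (sqint_cmp (true, p.2) su).
  by apply: eq_Rintegral => y _; rewrite ImM'.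
have f1 : J1 = conv (tens phi) (fun y => complex.Re (v y p.2 0)) x.
  by rewrite -E'; apply: eq_Rintegral => y _; rewrite ReM'.
have f2 : J2 = conv (tens phi) (fun y => complex.Im (v y p.2 0)) x.
  by rewrite -E'; apply: eq_Rintegral => y _; rewrite ImM'.
move: hr hi; rewrite e1 e2 f1 f2 => /oppr_inj hr /oppr_inj hi.
by rewrite /cmp; case: p.1.
Qed.

(** Integration by parts: the product of the reflected kernel with the convolution is integrable
    with integrable derivative, so that derivative has integral zero. *)
Lemma conv_parts j phi psi h x : (forall i, unit_test (phi i)) -> (forall i, unit_test (psi i)) ->
  sqi h -> sqi (conv (tens psi) h) -> sqi (conv (tens (dtens j psi)) h) ->
  conv (tens (dtens j phi)) (conv (tens psi) h) x =
  conv (tens phi) (conv (tens (dtens j psi)) h) x.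
Proof.
move=> tp ts sh s1 s2; have sp i : smooth 1 (phi i) by exact: (tp i).1.
have tdp := unit_test_dtens j tp; have tds := unit_test_dtens j ts.
pose F y := tens phi (x - y) * conv (tens psi) h y.
pose dF y := - tens (dtens j phi) (x - y) * conv (tens psi) h y +
  tens phi (x - y) * conv (tens (dtens j psi)) h y.
have i1 := conv_integrable x tdp s1; have i2 := conv_integrable x tp s2.
have dFE : (EFin \o dF) = (fun y => (tens phi (x - y)%R * conv (tens (dtens j psi)) h y)%:E -
   (tens (dtens j phi) (x - y)%R * conv (tens psi) h y)%:E)%E.
  by apply/funext => y; rewrite /dF /= -EFinB; congr EFin; ring.
have idF : leb3.-integrable [set: mR3] (EFin \o dF) by rewrite dFE; exact: (integrableB measurableT i2 i1).
have dt chi y : (forall i, unit_test (chi i)) ->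
    is_derive y (basis3 j) (fun y => tens chi (x - y)) (- tens (dtens j chi) (x - y)).
  move=> tc; rewrite -dtens_reflect => [|i]; last exact: (tc i).1.
  rewrite (_ : (fun y => _) = tens (reflect_at x chi)).
    by apply: is_derive_tens => i; apply: smooth_affine; exact: (tc i).1.
  by apply/funext => z; rewrite tens_reflect.
have dc chi y (tc : forall i, unit_test (chi i)) := is_derive_conv j y tc sh.
have hF y : is_derive y (basis3 j) F (dF y).
  have h1 := dt _ y tp; have h2 := dc _ y ts.
  by apply: is_derive_eq; rewrite /dF /GRing.scale /=; ring.
have lc : line_continuous (basis3 j) dF.
  apply: line_continuousD; apply: line_continuousM.
  - apply: line_continuousN; apply: derivable_line_continuous3 => y; exact: dt.
  - by apply: derivable_line_continuous3 => y; exact: dc.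
  - by apply: derivable_line_continuous3 => y; exact: dt.
  - by apply: derivable_line_continuous3 => y; exact: dc.
have z0 := integral_derivative0 hF lc (conv_integrable x tp s1) idF.
have R0 : Rintegral leb3 setT dF = 0 by rewrite /Rintegral z0.
have E0 := RintegralB measurableT i2 i1.
apply/esym/eqP; rewrite -subr_eq0; apply/eqP.
apply: (etrans (esym E0)); apply: etrans R0.
by apply: eq_Rintegral => y _; rewrite /dF mulNr addrC.
Qed.

(** Lets the mollification [h] of [f], used for the strong limit, enter the same estimate as
    elements of H^1. *)
Lemma molweak_sconv j psi u : (forall i, unit_test (psi i)) -> sqint u ->
  molweak j (sconv (tens psi) u) (sconv (tens (dtens j psi)) u).
Proof.
move=> ts su phi tp x; apply: cmp_ext => p.
have s1 := sqint_cmp p (sqint_sconv ts su).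
have s2 := sqint_cmp p (sqint_sconv (unit_test_dtens j ts) su).
have E chi : (fun y => cmp p (sconv (tens chi) u y)) = conv (tens chi) (fun y => cmp p (u y)).
  by apply/funext => y; rewrite cmp_sconv.
have t1 : sqi (conv (tens psi) (fun y => cmp p (u y))) by rewrite -(E psi).
have t2 : sqi (conv (tens (dtens j psi)) (fun y => cmp p (u y))) by rewrite -(E (dtens j psi)).
rewrite [LHS]cmp_sconv [RHS]cmp_sconv.
apply: etrans (etrans (conv_parts x tp ts (sqint_cmp p su) t1 t2) _).
  by congr conv; exact: E.
by congr conv; exact/esym/E.
Qed.

Lemma molweakD j u u' v v' : sqint u -> sqint u' -> sqint v -> sqint v' ->
  molweak j u v -> molweak j u' v' -> molweak j (fun x => u x + u' x) (fun x => v x + v' x).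
Proof.
move=> su su' sv sv' h h' phi tp x.
have tdp := unit_test_dtens j tp.
by rewrite (sconvD x tdp su su') (sconvD x tp sv sv') h // h'.
Qed.

Lemma molweakZ j (c : R[i]) u v : sqint u -> sqint v -> molweak j u v ->
  molweak j (fun x => c%:M *m u x) (fun x => c%:M *m v x).
Proof.
move=> su sv h phi tp x; have tdp := unit_test_dtens j tp.
rewrite (@sconv_mx _ (dtens j phi) _ u x tdp su (sqint_scale c su)).
by rewrite (@sconv_mx _ phi _ v x tp sv (sqint_scale c sv)) h.
Qed.
End weak_derivatives.

(** * Weighted norms as integrals of squares *)

Section weighted_norms.
Context {R : realType}.
Local Notation mR := (measurableTypeR R).
Local Notation mR3 := (R3 mR).
Local Notation V := 'cV[R[i]]_4.
Implicit Types (x y : R3 R) (u v f : spinor R).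

Definition jweight (s : R) x : R := japanese x `^ (2 * s).

Lemma norm4_sq (v : V) : norm4 v ^+ 2 = ip v v.
Proof.
rewrite /norm4 sqr_sqrtr; last by apply: sumr_ge0 => k _; exact: sqr_ge0.
apply: eq_bigr => k _; rewrite /cmod sqr_sqrtr ?addr_ge0 ?sqr_ge0 //.
Qed.

Lemma japaneseE x (s : R) : japanese x `^ s = wq 1 x `^ (s / 2).
Proof.
have q0 : 0 <= wq 1 x by exact: ltW (wq_gt0 1 x).
rewrite (_ : japanese x = wq 1 x `^ 2^-1).
  by rewrite -powRrM mulrC.
rewrite powR12_sqrt // /japanese /wq /sqn sum3 /coord /= expr1n mul1r; congr Num.sqrt.
Qed.

Lemma jweightE s x : jweight s x = wq 1 x `^ s.
Proof. by rewrite /jweight japaneseE mulrAC divff ?mul1r // pnatr_eq0. Qed.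

Lemma jweight_gt0 s x : 0 < jweight s x.
Proof. by rewrite jweightE powR_gt0 // wq_gt0. Qed.

Lemma measurable_jweight s : measurable_fun [set: mR3] (jweight s).
Proof.
rewrite (_ : jweight s = (fun x => wq 1 x `^ s)); first exact: measurable_wpow.
by apply/funext => x; exact: jweightE.
Qed.

Lemma wnorm_sq (s : R) u : (wnorm s u `^ 2 = wip (jweight s) u)%E.
Proof.
rewrite /wnorm poweR_Lnorm ?pnatr_eq0 //; apply: eq_integral => x _.
rewrite abse_EFin poweR_EFin; congr EFin; rewrite powR_mulrn // real_normK ?num_real //.
rewrite exprMn norm4_sq; congr (_ * _).
by rewrite /jweight mulrC powRrM powR_mulrn // powR_ge0.
Qed.

Lemma wnorm_ge0 (s : R) u : (0 <= wnorm s u)%E.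
Proof. exact: Lnorm_ge0. Qed.

Lemma wip_of_wnorm (s c : R) u : (wnorm s u <= c%:E)%E -> (wip (jweight s) u <= (c ^+ 2)%:E)%E.
Proof.
move=> h; rewrite -wnorm_sq; have := wnorm_ge0 s u; move: h.
case: (wnorm s u) => [r| |] //.
rewrite poweR_EFin !lee_fin => rc r0.
by rewrite powR_mulrn // lerXn2r // nnegrE // (le_trans r0).
Qed.

Lemma wnorm_of_wip (s c : R) u : 0 <= c -> (wip (jweight s) u <= (c ^+ 2)%:E)%E ->
  (wnorm s u <= c%:E)%E.
Proof.
move=> c0; rewrite -wnorm_sq; have := wnorm_ge0 s u.
case: (wnorm s u) => [r| |] //; last by rewrite poweRyr ?pnatr_eq0.
rewrite poweR_EFin !lee_fin => r0; rewrite powR_mulrn // => h.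
by rewrite -(@ler_pXn2r _ 2) // nnegrE.
Qed.

Lemma wnorm_fin (s : R) u : (wnorm s u < +oo)%E <-> (wip (jweight s) u < +oo)%E.
Proof.
rewrite -wnorm_sq; have := wnorm_ge0 s u.
case: (wnorm s u) => [r| |] // _; last by rewrite poweRyr ?pnatr_eq0.
by rewrite poweR_EFin !ltry.
Qed.

Lemma L2w0_sqint u : L2w 0 u -> sqint u.
Proof.
move=> [mu /wnorm_fin iu]; split=> //; move: iu; rewrite /wip.
by under eq_integral do rewrite /jweight mulr0 powRr0 mul1r.
Qed.

Lemma wip_mono (w w' : R3 R -> R) u : measurable_fun [set: mR3] w ->
  measurable_fun [set: mR3] w' -> (forall x, 0 <= w x <= w' x) -> spinor_measurable u ->
  (wip w u <= wip w' u)%E.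
Proof.
move=> mw mw' h mu; apply: ge0_le_integral => //.
- by move=> x _; apply: wip_pos => y; have /andP[] := h y.
- exact: measurable_wip.
- exact: measurable_wip.
- by move=> x _; rewrite lee_fin ler_wpM2r ?ip_ge0 //; have /andP[] := h x.
Qed.

Section comparison.
Variable (theta : R).
Hypothesis theta_gt : 2^-1 < theta.
Hypothesis theta_le1 : theta <= 1.

Let del : R := (2 * theta - 1) / 1200.

Lemma wq_le_japanese x : wq del x <= wq 1 x.
Proof.
have d0 : 0 <= del by apply: divr_ge0; [have h := theta_gt; lra|exact: ler0n].
have d1 : del <= 1.
  rewrite /del ler_pdivrMr ?ltr0n // mul1r; have h := theta_le1.
  by apply: (@le_trans _ _ 1); [lra|rewrite ler1n].
by rewrite lerD2l ler_wpM2r ?sqn_ge0 // expr1n expr_le1.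
Qed.

(** Since [del <= 1], [q] is at most [1 + |x|^2]. With [jweight_le_lweight], this carries estimates
    from the weights in [q] to the spaces [L_{2,s}] and [L_{2,-s}]. *)
Lemma gweight_le_jweight s x : theta <= s -> gweight theta x <= jweight s x.
Proof.
move=> ts; rewrite gweightE jweightE; have q0 z := ltW (wq_gt0 z x).
apply: (@le_trans _ _ (wq 1 x `^ theta)); last by rewrite ler_powR // wq_ge1.
apply: ge0_ler_powR; rewrite ?nnegrE ?q0 //; last exact: wq_le_japanese.
by have h := theta_gt; lra.
Qed.

Lemma jweight_le_lweight s x : theta <= s -> jweight (- s) x <= lweight theta x.
Proof.
move=> ts; have gj := gweight_le_jweight x ts.
rewrite jweightE powRN -jweightE /lweight -[wS _ _ _]invrK.
by rewrite lef_pV2 ?posrE ?jweight_gt0 ?invr_gt0 ?wS_gt0.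
Qed.

(** The origin of the condition [2 theta <= 1 + epsilon]: the square of a potential decaying like
    [<x>^(-2 theta)] compensates the growth of [gweight] and leaves the weight of the left-hand
    side. *)
Lemma decay_weight x (r : R) : 2 * theta <= r ->
  gweight theta x * (japanese x `^ (- r)) ^+ 2 <= lweight theta x.
Proof.
move=> tr; have g1 := gweight_le_jweight x (lexx theta).
have l1 := jweight_le_lweight x (lexx theta).
have e : (japanese x `^ (- r)) ^+ 2 = wq 1 x `^ (- r).
  by rewrite japaneseE -powR_mulrn ?powR_ge0 // -powRrM divfK // pnatr_eq0.
rewrite e; apply: le_trans l1; rewrite !jweightE in g1 *.
have q0 := wq_gt0 1 x.
apply: (@le_trans _ _ (wq 1 x `^ theta * wq 1 x `^ (- (2 * theta)))).
  apply: ler_pM => //; [|exact: powR_ge0|].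
    by apply: le_trans (gweight_ge1 theta_gt x).
  by rewrite ler_powR ?wq_ge1 // lerN2.
rewrite -powRD; last by rewrite (gt_eqF q0) implybT.
by rewrite (_ : theta + _ = - theta) //; ring.
Qed.
End comparison.
End weighted_norms.

(** * Algebra of the perturbed equation *)

Section resolvent_estimate.
Context {R : realType}.
Local Notation mR := (measurableTypeR R).
Local Notation mR3 := (R3 mR).
Local Notation V := 'cV[R[i]]_4.
Implicit Types (x y : R3 R) (u v f h : spinor R).

Lemma cauchy_schwarz4 (c : 'I_4 -> R) : (\sum_k c k) ^+ 2 <= 4 * \sum_k c k ^+ 2.
Proof.
rewrite !big_ord_recl !big_ord0 !addr0.
set a := c _; set b := c _; set d := c _; set e := c _.
have := sqr_ge0 (a - b); have := sqr_ge0 (a - d); have := sqr_ge0 (a - e).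
have := sqr_ge0 (b - d); have := sqr_ge0 (b - e); have := sqr_ge0 (d - e).
rewrite !sqrrB !sqrrD; lra.
Qed.

(** A factor 4 from Cauchy-Schwarz in each row, and another from the number of rows. *)
Lemma ip_mx_le (M : 'M[R[i]]_4) (q : R) (v : V) : (forall j k, cmod (M j k) <= q) ->
  ip (M *m v) (M *m v) <= 16 * q ^+ 2 * ip v v.
Proof.
move=> hM; pose n k := complex.Re (v k 0) ^+ 2 + complex.Im (v k 0) ^+ 2.
have vE : ip v v = \sum_k n k by apply: eq_bigr => k _; rewrite -!expr2.
have ReS (F : 'I_4 -> R[i]) : complex.Re (\sum_k F k) = \sum_k complex.Re (F k).
  by rewrite !big_ord_recl !big_ord0 !ReD.
have ImS (F : 'I_4 -> R[i]) : complex.Im (\sum_k F k) = \sum_k complex.Im (F k).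
  by rewrite !big_ord_recl !big_ord0 !ImD.
have row j : complex.Re ((M *m v) j 0) * complex.Re ((M *m v) j 0) +
    complex.Im ((M *m v) j 0) * complex.Im ((M *m v) j 0) <= 4 * (q ^+ 2 * \sum_k n k).
  rewrite mxE ReS ImS -!expr2.
  apply: le_trans (lerD (cauchy_schwarz4 _) (cauchy_schwarz4 _)) _.
  rewrite -mulrDr ler_wpM2l // -big_split /= mulr_sumr; apply: ler_sum => k _.
  have := hM j k; rewrite /cmod /n; case: (M j k) (v k 0) => [a b] [c d] /= hq.
  have s0 : 0 <= a ^+ 2 + b ^+ 2 by rewrite addr_ge0 ?sqr_ge0.
  have q2 : a ^+ 2 + b ^+ 2 <= q ^+ 2.
    rewrite -(sqr_sqrtr s0) lerXn2r ?nnegrE ?sqrtr_ge0 //.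
    exact: le_trans (sqrtr_ge0 _) hq.
  rewrite (_ : (a * c - b * d) ^+ 2 + _ = (a ^+ 2 + b ^+ 2) * (c ^+ 2 + d ^+ 2)); last by ring.
  by rewrite ler_wpM2r // addr_ge0 ?sqr_ge0.
apply: (@le_trans _ _ (\sum_(j < 4) 4 * (q ^+ 2 * \sum_k n k))); first by apply: ler_sum => j _; exact: row.
rewrite sumr_const card_ord vE -mulr_natr le_eqVlt; apply/orP; left; apply/eqP; ring.
Qed.

Variable (alpha : 'I_4 -> 'M[R[i]]_4).
Hypothesis alpha_dirac : dirac_matrices alpha.

(** Adding [b / z] to the solution removes [b] from the right-hand side at the price of [H_0 b / z],
    which is small for large [z]. *)
Lemma dirac_symbol_shift (z c : R[i]) (a b : V) (A B : 'I_3 -> V) : c * z = 1 ->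
  dirac_symbol alpha z (a + c%:M *m b) (fun j => A j + c%:M *m B j) =
  dirac_symbol alpha z a A + c%:M *m dirac_symbol alpha 0 b B - b.
Proof.
move=> cz; rewrite /dirac_symbol /dA /dB !mul_scalar_mx scale0r subr0.
rewrite !sum3 !mulmxDr !mul_scalar_mx -!scalemxAr !scalerDr !scalerA mulrC cz scale1r.
set a0 := Am _ _ *m A _; set a1 := Am _ _ *m A _; set a2 := Am _ _ *m A _.
set b0 := c *: _; set b1 := c *: _; set b2 := c *: _.
set b3 := c *: _; set a3 := Bm _ *m _; set za := z *: a.
clearbody a0 a1 a2 a3 b0 b1 b2 b3 za.
apply: cmp_ext => p; rewrite !(cmpD, cmpN); ring.
Qed.

Lemma dirac_opE Q t z u x :
  (dirac_op alpha Q t u - z *: u) x =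
  dirac_symbol alpha z (u x) (fun j => weak_partial j u x) + t%:C *: (Q x *m u x).
Proof.
rewrite /dirac_op /dirac_symbol /dA /dB /Am /Bm.
have -> : (\sum_(j < 3) (- ci *: alpha (lift ord_max j)) *m weak_partial j u x) =
    - (0 +i* 1) *: (\sum_(j < 3) alpha (lift ord_max j) *m weak_partial j u x).
  by rewrite scaler_sumr; apply: eq_bigr => j _; rewrite -scalemxAl.
by rewrite /= [RHS]addrAC.
Qed.
End resolvent_estimate.

(** The pointwise bound is assumed only almost everywhere, because this is how the resolvent
    equation holds; the integrals may be infinite. *)
Lemma ae_integral_le3 d (T : measurableType d) (R : realType) (m : {measure set T -> \bar R})
    (F f1 f2 f3 : T -> R) (c2 c3 : R) :
  measurable_fun setT F -> measurable_fun setT f1 -> measurable_fun setT f2 ->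
  measurable_fun setT f3 -> (forall x, 0 <= F x) -> (forall x, 0 <= f1 x) ->
  (forall x, 0 <= f2 x) -> (forall x, 0 <= f3 x) -> 0 <= c2 -> 0 <= c3 ->
  (\forall x \ae m, F x <= 3 * (f1 x + c2 * f2 x + c3 * f3 x)) ->
  (\int[m]_x (F x)%:E <= 3%:E * (\int[m]_x (f1 x)%:E + c2%:E * \int[m]_x (f2 x)%:E +
    c3%:E * \int[m]_x (f3 x)%:E))%E.
Proof.
move=> mF m1 m2 m3 F0 f10 f20 f30 c20 c30 h.
have e (g : T -> R) : measurable_fun setT g -> measurable_fun setT (fun x => (g x)%:E).
  by move=> mg; exact/measurable_EFinP.
have p1 x : [set: T] x -> (0 <= (f1 x)%:E)%E by rewrite lee_fin.
have p2 x : [set: T] x -> (0 <= (f2 x)%:E)%E by rewrite lee_fin.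
have p3 x : [set: T] x -> (0 <= (f3 x)%:E)%E by rewrite lee_fin.
have q2 x : (0 <= (c2 * f2 x)%:E)%E by rewrite lee_fin mulr_ge0.
have q3 x : (0 <= (c3 * f3 x)%:E)%E by rewrite lee_fin mulr_ge0.
have n2 := measurable_funM (measurable_cst c2) m2.
have n3 := measurable_funM (measurable_cst c3) m3.
have E2 : (c2%:E * \int[m]_x (f2 x)%:E = \int[m]_x (c2 * f2 x)%:E)%E.
  by rewrite -ge0_integralZl_EFin //; exact: (e _ m2).
have E3 : (c3%:E * \int[m]_x (f3 x)%:E = \int[m]_x (c3 * f3 x)%:E)%E.
  by rewrite -ge0_integralZl_EFin //; exact: (e _ m3).
rewrite E2 E3 -ge0_integralD //; [|exact: (e _ m1)|exact: (e _ n2)].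
rewrite -ge0_integralD //; first last.
- exact: (e _ n3).
- by apply: emeasurable_funD; [exact: (e _ m1)|exact: (e _ n2)].
- by move=> x _; exact: adde_ge0 (p1 x I) (q2 x).
have s0 x : (0 <= (f1 x)%:E + (c2 * f2 x)%:E + (c3 * f3 x)%:E)%E.
  exact: adde_ge0 (adde_ge0 (p1 x I) (q2 x)) (q3 x).
have ms : measurable_fun setT (fun x => ((f1 x)%:E + (c2 * f2 x)%:E + (c3 * f3 x)%:E)%E).
  by apply: emeasurable_funD (e _ n3); exact: emeasurable_funD (e _ m1) (e _ n2).
rewrite -ge0_integralZl_EFin //.
apply: ae_ge0_le_integral => //; try exact: (e _ mF).
- by move=> x _; rewrite lee_fin.
- by move=> x _; apply: mule_ge0 => //; rewrite lee_fin.
- exact: measurable_funeM.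
by move: h; apply: filterS => x hx _; rewrite -!EFinD -EFinM lee_fin.
Qed.

(** * A priori bound for the resolvent of H_t *)

Section perturbed_resolvent.
Context {R : realType}.
Local Notation mR := (measurableTypeR R).
Local Notation mR3 := (R3 mR).
Local Notation V := 'cV[R[i]]_4.
Implicit Types (x y : R3 R) (u v f h : spinor R).
Variable (alpha : 'I_4 -> 'M[R[i]]_4).
Hypothesis alpha_dirac : dirac_matrices alpha.
Variable (theta : R).
Hypothesis theta_gt : 2^-1 < theta.
Hypothesis theta_le1 : theta <= 1.
Variables (Q : R3 R -> 'M[R[i]]_4) (K r : R).
Hypothesis Q_le : forall x j k, cmod (Q x j k) <= K * japanese x `^ (- r).
Hypothesis r_ge : 2 * theta <= r.

Let g0 x : 0 <= gweight theta x.
Proof. by apply: le_trans (gweight_ge1 theta_gt x). Qed.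
Let l0 x : 0 <= lweight theta x. Proof. exact: ltW (lweight_gt0 theta x). Qed.
Let mg := measurable_gweight theta.
Let ml := measurable_lweight theta.

Lemma potential_le x (v : V) :
  gweight theta x * ip (Q x *m v) (Q x *m v) <= 16 * K ^+ 2 * (lweight theta x * ip v v).
Proof.
apply: (@le_trans _ _ (gweight theta x * (16 * (K * japanese x `^ (- r)) ^+ 2 * ip v v))).
  by rewrite ler_wpM2l //; exact: ip_mx_le.
have d := decay_weight theta_gt theta_le1 x r_ge.
have k0 : 0 <= 16 * K ^+ 2 * ip v v.
  by apply: mulr_ge0; [apply: mulr_ge0; [exact: ler0n|exact: sqr_ge0]|exact: ip_ge0].
have hh := ler_wpM2l k0 d.
by apply: (le_trans _ (le_trans hh _)); rewrite le_eqVlt; apply/orP; left; apply/eqP; ring.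
Qed.

Definition complex_inv (lam mu : R) : R[i] :=
  (lam / (lam ^+ 2 + mu ^+ 2)) +i* (- mu / (lam ^+ 2 + mu ^+ 2)).

Lemma complex_invP lam mu : lam != 0 -> complex_inv lam mu * (lam +i* mu) = 1.
Proof.
move=> l0'; have d0 : lam ^+ 2 + mu ^+ 2 != 0.
  by rewrite gt_eqF // ltr_wpDr ?sqr_ge0 // exprn_even_gt0.
by apply/eqP; rewrite eq_complex /=; apply/andP; split; apply/eqP; field.
Qed.

Lemma complex_inv_norm lam mu : lam != 0 ->
  complex.Re (complex_inv lam mu) ^+ 2 + complex.Im (complex_inv lam mu) ^+ 2 <= (lam ^+ 2)^-1.
Proof.
move=> l0'; have p0 : 0 < lam ^+ 2 by rewrite exprn_even_gt0.
have d0 : 0 < lam ^+ 2 + mu ^+ 2 by rewrite ltr_wpDr ?sqr_ge0.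
have d1 := lt0r_neq0 d0.
rewrite /= (_ : _ + _ = (lam ^+ 2 + mu ^+ 2)^-1); last by field.
by rewrite lef_pV2 ?posrE // lerDl sqr_ge0.
Qed.

Lemma ip_le3 (a b c : V) : ip (a + b - c) (a + b - c) <= 3 * (ip a a + ip b b + ip c c).
Proof.
have := ip_ge0 (a - b); have := ip_ge0 (a + c); have := ip_ge0 (b + c).
rewrite !ipE (ipC b a) (ipC c a) (ipC c b); lra.
Qed.

Let Cc := core_const theta.

Let Cc0 : 0 <= Cc.
Proof.
have h := smooth_const_gt0 theta_gt.
by rewrite /Cc /core_const; apply: mulr_ge0 => //; apply: mulr_ge0 => //; exact: ltW.
Qed.

(** One estimate serves both claims: [h = 0] with [b = 0] gives the uniform bound, while for a fixed
    [h] close to [f] the terms in [b] vanish as [lam] grows. *)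
Lemma resolvent_bound (t lam mu : R) u f h (Hd : 'I_3 -> spinor R) (a b : R) :
  2 <= `|lam| -> mu != 0 -> `|mu| <= 1 -> 192 * Cc * (t ^+ 2 * K ^+ 2) <= 1 ->
  spinor_measurable f -> H1 u ->
  dirac_op alpha Q t u - (lam +i* mu) *: u = f %[ae leb3] ->
  sqint h -> (forall j, sqint (Hd j)) -> (forall j, molweak j h (Hd j)) ->
  (wip (gweight theta) (fun x => (f x - h x)%R) <= a%:E)%E ->
  (wip (gweight theta) (fun x => dirac_symbol alpha 0%R (h x) (Hd ^~ x)) <= b%:E)%E ->
  (wip (lweight theta) h <= b%:E)%E ->
  (wip (lweight theta) u <= (12 * Cc * (a + b / lam ^+ 2) + 4 * b / lam ^+ 2)%:E)%E.
Proof.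
move=> lam2 mu0 mu1 t_small mf [L2u dH] uf sh sHd hHd ha hb hb'.
have su := L2w0_sqint L2u.
pose W j := weak_partial j u.
have WP j : L2w 0 (W j) /\ is_weak_partial j u (W j).
  by rewrite /W /weak_partial; have := xgetPex (0 : spinor R) (dH j).
have sW j := L2w0_sqint (WP j).1.
have uW j := molweak_weak_partial su (sW j) (WP j).2.
have lam0 : lam != 0.
  by rewrite -normr_gt0; apply: lt_le_trans lam2.
set z := lam +i* mu; set c := complex_inv lam mu.
have cz : c * z = 1 := complex_invP mu lam0.
set n2 := complex.Re c ^+ 2 + complex.Im c ^+ 2.
have n2le : n2 <= (lam ^+ 2)^-1 := complex_inv_norm mu lam0.
have n20 : 0 <= n2 by rewrite addr_ge0 ?sqr_ge0.
have sch := sqint_scale c sh.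
pose v x := u x + c%:M *m h x.
pose G j x := W j x + c%:M *m Hd j x.
have sv : sqint v by exact: sqintD.
have sG j : sqint (G j) by apply: sqintD => //; exact: sqint_scale.
have vG j : molweak j v (G j).
  by apply: molweakD => //; [exact: sqint_scale|exact: molweakZ].
have core := core_estimate alpha_dirac theta_gt theta_le1 lam2 mu0 mu1 sv sG vG.
set g := fun x => dirac_symbol alpha (lam +i* mu) (v x) (G ^~ x) in core.
set H0h := fun x => dirac_symbol alpha 0 (h x) (Hd ^~ x) in hb.
have mH : spinor_measurable H0h := (sqint_dirac alpha_dirac 0 sh sHd).1.
have mg' : spinor_measurable g := (sqint_dirac alpha_dirac _ sv sG).1.
have mfh : spinor_measurable (fun x => f x - h x).
  apply/spinor_measurableP => p.
  rewrite (_ : (fun x => _) = (fun x => cmp p (f x) - cmp p (h x))).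
    by apply: measurable_funB; [exact: ((spinor_measurableP _).1 mf)|exact: ((spinor_measurableP _).1 sh.1)].
  by apply/funext => x; rewrite cmpB.
pose k2 := t ^+ 2 * (16 * K ^+ 2).
have k20 : 0 <= k2 by apply: mulr_ge0; [exact: sqr_ge0|apply: mulr_ge0 => //; exact: sqr_ge0].
have arith (P i1 i2 i3 i4 L : R) : t ^+ 2 * (P * i3) <= t ^+ 2 * (16 * K ^+ 2 * (L * i4)) ->
    P * (3 * (i1 + n2 * i2 + t * (t * i3))) <= 3 * (P * i1 + n2 * (P * i2) + k2 * (L * i4)).
  move=> hp; rewrite -subr_ge0.
  rewrite (_ : _ - _ = 3 * (t ^+ 2 * (16 * K ^+ 2 * (L * i4)) - t ^+ 2 * (P * i3))).
    by rewrite mulr_ge0 // subr_ge0.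
  by rewrite /k2; ring.
have gle : (wip (gweight theta) g <= 3%:E * (wip (gweight theta) (fun x => (f x - h x)%R) +
    n2%:E * wip (gweight theta) H0h + k2%:E * wip (lweight theta) u))%E.
  apply: ae_integral_le3 => //.
  - by apply: measurable_funM => //; exact: measurable_ip.
  - by apply: measurable_funM => //; exact: (measurable_ip mfh mfh).
  - by apply: measurable_funM => //; exact: measurable_ip.
  - by apply: measurable_funM => //; exact: (measurable_ip su.1 su.1).
  - by move=> x; rewrite mulr_ge0 ?ip_ge0.
  - by move=> x; rewrite mulr_ge0 ?ip_ge0.
  - by move=> x; rewrite mulr_ge0 ?ip_ge0.
  - by move=> x; rewrite mulr_ge0 ?ip_ge0.
  apply: (@filterS mR3 (almost_everywhere leb3) _ _ _ _ uf) => x /(_ I) ufx.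
  have gx : g x = (f x - h x) + c%:M *m H0h x - t%:C *: (Q x *m u x).
    rewrite /g /v /G (dirac_symbol_shift _ _ _ _ _ cz) -ufx dirac_opE -/z.
    set d1 := dirac_symbol _ _ _ _; set d2 := c%:M *m _; set d3 := t%:C *: _.
    clearbody d1 d2 d3; apply: cmp_ext => p; rewrite !(cmpD, cmpN); ring.
  rewrite gx; apply: (@le_trans _ _ (gweight theta x * (3 * (ip (f x - h x) (f x - h x) +
    ip (c%:M *m H0h x) (c%:M *m H0h x) + ip (t%:C *: (Q x *m u x)) (t%:C *: (Q x *m u x)))))).
    by apply: ler_wpM2l; [exact: g0|exact: ip_le3].
  rewrite ip_scale -/n2 -/(rscale t _) ipZl ipZr.
  have hp := ler_wpM2l (sqr_ge0 t) (potential_le x (u x)).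
  exact: (arith _ _ _ _ _ _ hp).
(* Absorbing the potential subtracts this quantity from both sides, so it must be finite; this
   follows from [u] being in L_2 and [lweight <= 1]. *)
have u_fin : (wip (lweight theta) u < +oo)%E.
  apply: le_lt_trans su.2; apply: ge0_le_integral => //.
  - by move=> x _; exact: wip_pos.
  - exact: (measurable_wip ml su.1).
  - by apply/measurable_EFinP; exact: (measurable_ip su.1 su.1).
  - move=> x _; rewrite lee_fin -[leRHS]mul1r ler_wpM2r ?ip_ge0 //.
    exact: lweight_le1.
have [n nE] : exists n : R, wip (lweight theta) u = n%:E.
  by exists (fine (wip (lweight theta) u)); rewrite fineK // ge0_fin_numE // wip_ge0.
have n_ge0 : 0 <= n by rewrite -lee_fin -nE wip_ge0.
have b0 : 0 <= b by rewrite -lee_fin; apply: le_trans hb'; exact: wip_ge0.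
have gle' : (wip (gweight theta) g <= (3 * (a + n2 * b + k2 * n))%:E)%E.
  apply: (le_trans gle); rewrite nE [leRHS]EFinM; apply: lee_wpmul2l; first by rewrite lee_fin.
  rewrite (_ : (a + n2 * b + k2 * n)%:E = (a%:E + n2%:E * b%:E + k2%:E * n%:E)%E) //.
  apply: leeD; last exact: lexx.
  by apply: leeD; [exact: ha|apply: lee_wpmul2l; [rewrite lee_fin|exact: hb]].
have vle : (wip (lweight theta) v <= (Cc * (3 * (a + n2 * b + k2 * n)))%:E)%E.
  have C0e : (0 <= Cc%:E)%E by rewrite lee_fin.
  by apply: (le_trans core); exact: (lee_wpmul2l C0e gle').
have hle : (wip (lweight theta) (fun x => (- c)%:M *m h x) <= (n2 * b)%:E)%E.
  rewrite (_ : wip _ _ = (n2%:E * wip (lweight theta) h)%E).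
    by rewrite EFinM; apply: lee_wpmul2l; [rewrite lee_fin|exact: hb'].
  rewrite /wip -ge0_integralZl_EFin //.
  - apply: eq_integral => x _; rewrite -EFinM ip_scale mulrCA; congr (_ * _)%:E.
    by rewrite /n2; case: (c) => p q /=; rewrite !sqrrN.
  - by move=> x _; exact: wip_pos.
  - exact: (measurable_wip ml sh.1).
have ule : (n%:E <= (2 * (Cc * (3 * (a + n2 * b + k2 * n)) + n2 * b))%:E)%E.
  rewrite -nE (_ : u = (fun x => v x + (- c)%:M *m h x)); last first.
    by apply/funext => x; rewrite /v !mul_scalar_mx scaleNr addrK.
  apply: le_trans (wip_leD ml l0 sv.1 (sqint_scale (- c) sh).1) _.
  rewrite EFinM; apply: lee_wpmul2l; first by rewrite lee_fin.
  by rewrite EFinD; apply: leeD.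
rewrite nE lee_fin; rewrite lee_fin in ule.
(* Here [192 = 12 * 16], with 16 from [ip_mx_le]. The potential then contributes
   [6 Cc k2 n <= n / 2] to the bound on [n], and moving it to the left doubles the other terms. *)
have k2s : 12 * (Cc * k2) <= 1.
  by apply: le_trans t_small; rewrite le_eqVlt; apply/orP; left; apply/eqP; rewrite /k2; ring.
have kn : 12 * (Cc * k2) * n <= n by rewrite -[leRHS]mul1r ler_wpM2r.
have nb : n2 * b <= b / lam ^+ 2 by rewrite mulrC ler_wpM2l.
have Cnb := ler_wpM2l Cc0 nb.
move: ule kn nb Cnb; rewrite !mulrDr -[4 * b / _]mulrA.
set X := b / lam ^+ 2; set Y := n2 * b; clearbody X Y => ule kn nb Cnb.
have e1 : Cc * (3 * (k2 * n)) = 3 * (Cc * k2 * n) by ring.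
have e2 : Cc * (3 * Y) = 3 * (Cc * Y) by ring.
have e3 : Cc * (3 * a) = 3 * (Cc * a) by ring.
have e4 : 12 * (Cc * k2) * n = 12 * (Cc * k2 * n) by ring.
have e5 : 12 * Cc * a = 12 * (Cc * a) by ring.
have e6 : 12 * Cc * X = 12 * (Cc * X) by ring.
rewrite e1 e2 e3 in ule; rewrite e4 in kn; rewrite e5 e6; lra.
Qed.
End perturbed_resolvent.

Lemma cvg_ereal0P (R : realType) (T : Type) (F : set_system T) (FF : Filter F)
    (g : T -> \bar R) : (forall x, (0 <= g x)%E) ->
  (g x @[x --> F] --> 0%E) <-> (forall c : R, 0 < c -> \forall x \near F, (g x <= c%:E)%E).
Proof.
move=> g0; split=> [h c c0|h].
  have [hf hc] := (fine_cvgP _ _).1 h; move/cvgrPdist_le : hc => /(_ c c0) hc.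
  near=> x; have xf : g x \is a fin_num by near: x.
  rewrite -(fineK xf) lee_fin.
  have : `|0 - fine (g x)| <= c by near: x.
  by rewrite sub0r normrN ger0_norm // fine_ge0.
apply/fine_cvgP; split.
  have := h 1 ltr01; apply: filterS => x hx.
  by rewrite ge0_fin_numE //; apply: le_lt_trans hx (ltry 1).
apply/cvgrPdist_le => e e0; have := h e e0; apply: filterS => x hx.
have xf : g x \is a fin_num by rewrite ge0_fin_numE //; apply: le_lt_trans hx (ltry e).
by rewrite sub0r normrN ger0_norm ?fine_ge0 // -lee_fin fineK.
Unshelve. all: by end_near. Qed.

(** * Boundary values of the resolvent: uniform bound and strong convergence *)

Section limiting_absorption.
Context {R : realType}.
Local Notation mR := (measurableTypeR R).
Local Notation mR3 := (R3 mR).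
Implicit Types (x y : R3 R) (u v f h : spinor R).

Lemma wip_opp (w : R3 R -> R) u : wip w (fun x => - u x) = wip w u.
Proof. by apply: eq_integral => x _; rewrite ipNl ipNr opprK. Qed.

Lemma spinor_measurable0 : spinor_measurable (0 : spinor R).
Proof.
apply/spinor_measurableP => p; rewrite (_ : (fun x => _) = (fun=> cmp p (0 : 'cV[R[i]]_4))) //.
Qed.

Lemma wip0 (w : R3 R -> R) : wip w (fun=> 0) = 0%E.
Proof.
rewrite /wip -[RHS](integral0 leb3 setT); apply: eq_integral => x _.
by rewrite (_ : ip 0 0 = 0) ?mulr0 // /ip big1 // => k _; rewrite mxE /= !mulr0 addr0.
Qed.

Lemma spinor_measurableB u v : spinor_measurable u -> spinor_measurable v ->
  spinor_measurable (fun x => u x - v x).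
Proof.
move=> mu mv; apply/spinor_measurableP => p.
rewrite (_ : (fun x => _) = (fun x => cmp p (u x) - cmp p (v x))).
  by apply: measurable_funB; [exact: ((spinor_measurableP _).1 mu)|exact: ((spinor_measurableP _).1 mv)].
by apply/funext => x; rewrite cmpB.
Qed.

(** A single [mu] close to 0 suffices for each accuracy. The factor 2 is the price of the triangle
    inequality for squared norms. *)
Lemma extended_resolvent_le (alpha : 'I_4 -> 'M[R[i]]_4) (Q : R3 R -> 'M[R[i]]_4)
    (s : R) (sg : bool) (t lambda : R) T f (B : R) :
  is_extended_resolvent alpha Q s sg t lambda T -> L2w s f ->
  (forall mu, mu != 0 -> `|mu| <= 1 ->
    spinor_measurable (resolvent alpha Q t (lambda +i* mu) f) /\
    (wip (jweight (- s)) (resolvent alpha Q t (lambda +i* mu) f) <= B%:E)%E) ->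
  (wip (jweight (- s)) (T f) <= (2 * B)%:E)%E.
Proof.
move=> [[Tf _ _] lap] sf hB; have [mT _] := Tf _ sf.
apply/lee_addgt0Pr => e e0.
(* The squared distance [c^2 = e / 2], doubled by [wip_leD], contributes exactly [e]. *)
pose c := Num.sqrt (e / 2); have c0 : 0 < c by rewrite sqrtr_gt0 divr_gt0.
have := (cvg_ereal0P _ (fun mu => wnorm_ge0 _ _)).1 (lap f sf) c c0.
move=> hc.
have [mu [mu0 mu1 hmu]] : exists mu : R, [/\ 0 < mu, mu <= 1 &
    (wnorm (- s) (resolvent alpha Q t (lambda +i* ((-1) ^+ sg * mu)) f - T f)%R <= c%:E)%E].
  have [mu] : exists mu : R, 0 < mu /\ mu <= 1 /\
    (wnorm (- s) (resolvent alpha Q t (lambda +i* ((-1) ^+ sg * mu)) f - T f)%R <= c%:E)%E.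
    apply: (@filter_ex _ (0^'+)); near=> mu; split; [|split].
    - by near: mu; exact: nbhs_right_gt.
    - by near: mu; exact: nbhs_right_le.
    - by near: mu; exact: hc.
  by move=> [? [? ?]]; exists mu.
set nu := (-1) ^+ sg * mu in hmu.
have nu0 : nu != 0 by rewrite /nu mulf_neq0 ?signr_eq0 // gt_eqF.
have nu1 : `|nu| <= 1 by rewrite /nu normrM normr_sign mul1r ger0_norm // ltW.
have [mR' hR] := hB nu nu0 nu1; set Rf := resolvent _ _ _ _ _ in mR' hR hmu.
have hd := wip_of_wnorm hmu; rewrite sqr_sqrtr in hd; last by rewrite divr_ge0 // ltW.
have mj := measurable_jweight (- s); have j0 x := ltW (jweight_gt0 (- s) x).
have md := spinor_measurableB mR' mT.
have md' : spinor_measurable (fun x => - (Rf x - T f x)).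
  rewrite (_ : (fun x => _) = (fun x => T f x - Rf x)); first exact: spinor_measurableB.
  by apply/funext => x; rewrite opprB.
rewrite (_ : T f = (fun x => Rf x + - (Rf x - T f x))); last first.
  by apply/funext => x; rewrite opprB addrC subrK.
apply: le_trans (wip_leD mj j0 mR' md') _; rewrite wip_opp.
apply: (@le_trans _ _ (2%:E * (B%:E + (e / 2)%:E))%E).
  by apply: lee_wpmul2l; [rewrite lee_fin|apply: leeD; [exact: hR|exact: hd]].
rewrite -EFinD -EFinM -EFinD lee_fin le_eqVlt; apply/orP; left; apply/eqP; field.
Unshelve. all: by end_near. Qed.

Lemma sqint0 : sqint (fun=> 0 : 'cV[R[i]]_4).
Proof.
split; first exact: spinor_measurable0.
rewrite (_ : (\int[leb3]_x _)%E = 0%E) ?ltry // -[RHS](wip0 (fun=> 1)).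
by apply: eq_integral => x _; rewrite mul1r.
Qed.

Lemma molweak0 j : molweak j (fun=> 0 : 'cV[R[i]]_4) (fun=> 0).
Proof.
have h (rho : R3 R -> R) x : sconv rho (fun=> 0 : 'cV[R[i]]_4) x = 0.
  apply: cmp_ext => p; rewrite cmp_sconv /conv (_ : (fun y => _) = cst 0).
    by rewrite Rintegral_cst // mul0r /cmp mxE; case: p.1.
  by apply/funext => y; rewrite /cmp mxE; case: p.1; rewrite mulr0.
by move=> phi _ x; rewrite !h.
Qed.

Section resolvent_norm.
Variable (alpha : 'I_4 -> 'M[R[i]]_4).
Hypothesis alpha_dirac : dirac_matrices alpha.
Variables (theta s : R).
Hypothesis theta_gt : 2^-1 < theta.
Hypothesis theta_le1 : theta <= 1.
Hypothesis theta_s : theta <= s.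
Variables (Q : R3 R -> 'M[R[i]]_4) (K r : R).
Hypothesis Q_le : forall x j k, cmod (Q x j k) <= K * japanese x `^ (- r).
Hypothesis r_ge : 2 * theta <= r.

Let Cc := core_const theta.

Lemma core_const_ge0 : 0 <= core_const theta.
Proof.
have h := smooth_const_gt0 theta_gt.
by rewrite /core_const; apply: mulr_ge0 => //; apply: mulr_ge0 => //; exact: ltW.
Qed.

Lemma extended_resolvent_bound (sg : bool) (t lam : R) T f h (Hd : 'I_3 -> spinor R) (a b : R) :
  is_extended_resolvent alpha Q s sg t lam T -> L2w s f ->
  2 <= `|lam| -> 192 * Cc * (t ^+ 2 * K ^+ 2) <= 1 ->
  sqint h -> (forall j, sqint (Hd j)) -> (forall j, molweak j h (Hd j)) ->
  (wip (gweight theta) (fun x => (f x - h x)%R) <= a%:E)%E ->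
  (wip (gweight theta) (fun x => dirac_symbol alpha 0%R (h x) (Hd ^~ x)) <= b%:E)%E ->
  (wip (lweight theta) h <= b%:E)%E ->
  (wip (jweight (- s)) (T f) <=
    (2 * (12 * Cc * (a + b / lam ^+ 2) + 4 * b / lam ^+ 2))%:E)%E.
Proof.
move=> ext sf lam2 ts sh sHd hHd ha hb hb'; apply: (extended_resolvent_le ext sf) => mu mu0 mu1.
have C0 := core_const_ge0.
have a0 : 0 <= a.
  rewrite -lee_fin; apply: le_trans ha; apply: wip_ge0 => x.
  by apply: le_trans (gweight_ge1 theta_gt x).
have b0 : 0 <= b.
  by rewrite -lee_fin; apply: le_trans hb'; apply: wip_ge0 => x; exact: ltW (lweight_gt0 _ x).
(* [xget] returns some solution in H^1, or the default 0 when there is none; in the latter case the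
   bound is the nonnegativity of its right side. *)
rewrite /resolvent; case: xgetP => [u _ [uH uf]|_]; last first.
  split; first exact: spinor_measurable0.
  rewrite [X in (X <= _)%E](_ : _ = 0%E); last exact: wip0.
  have l0 : 0 <= b / lam ^+ 2 by rewrite divr_ge0 // sqr_ge0.
  rewrite lee_fin -mulrA; apply: addr_ge0; last by rewrite -mulrA mulr_ge0.
  by rewrite mulr_ge0 // mulr_ge0 // addr_ge0.
have mu' := (L2w0_sqint uH.1).1; split=> //.
have bd := resolvent_bound alpha_dirac theta_gt theta_le1 Q_le r_ge lam2 mu0 mu1 ts sf.1 uH uf
  sh sHd hHd ha hb hb'.
apply: le_trans bd; apply: wip_mono => //.
- exact: measurable_jweight.
- exact: measurable_lweight.
- by move=> x; rewrite ltW ?jweight_gt0 //= jweight_le_lweight.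
Qed.

Lemma wip_gweight_jweight f : spinor_measurable f ->
  (wip (gweight theta) f <= wip (jweight s) f)%E.
Proof.
move=> mf; apply: wip_mono => //.
- exact: measurable_gweight.
- exact: measurable_jweight.
move=> x; rewrite gweight_le_jweight // andbT.
by apply: le_trans (gweight_ge1 theta_gt x).
Qed.

(** The case [h = 0], [a = 1], [b = 0] bounds the squared norm by [24 Cc]; this is below
    [(24 Cc + 1)^2], so no square root is taken. *)
Lemma extended_resolvent_uniform (sg : bool) (t lam : R) T :
  is_extended_resolvent alpha Q s sg t lam T ->
  2 <= `|lam| -> 192 * Cc * (t ^+ 2 * K ^+ 2) <= 1 ->
  (opnorm s (- s) T <= (24 * Cc + 1)%:E)%E.
Proof.
move=> ext lam2 ts; apply: ge_ereal_sup => _ [f [sf f1] <-].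
have C0 := core_const_ge0; have C1 : 0 <= 24 * Cc by rewrite mulr_ge0.
apply: wnorm_of_wip; first by rewrite addr_ge0.
pose z0 : spinor R := fun=> 0; pose Z0 : 'I_3 -> spinor R := fun=> z0.
have ha : (wip (gweight theta) (fun x => (f x - z0 x)%R) <= 1%:E)%E.
  rewrite (_ : (fun x => _) = f); last by apply/funext => x; rewrite subr0.
  apply: le_trans (wip_gweight_jweight sf.1) _.
  by rewrite -(expr1n R 2); apply: wip_of_wnorm.
have hb : (wip (gweight theta) (fun x => dirac_symbol alpha 0%R (z0 x) (Z0 ^~ x)) <= 0%:E)%E.
  rewrite (_ : (fun x => _) = z0); first by rewrite wip0.
  by apply/funext => x; rewrite /dirac_symbol /dA /dB big1 ?mulmx0 ?scaler0 ?addr0 ?subr0 // => j _; rewrite mulmx0.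
have hb' : (wip (lweight theta) z0 <= 0%:E)%E by rewrite wip0.
have := extended_resolvent_bound ext sf lam2 ts sqint0 (fun=> sqint0) molweak0 ha hb hb'.
move=> h; apply: le_trans h _; rewrite lee_fin mul0r mulr0 mul0r !addr0 mulr1.
rewrite (_ : 2 * (12 * Cc) = 24 * Cc); last by ring.
by apply: (@le_trans _ _ (24 * Cc + 1)); [rewrite lerDl|rewrite expr2 ler_peMr ?lerDr // addr_ge0].
Qed.

Lemma wip_finD (w : R3 R -> R) u v : measurable_fun [set: mR3] w -> (forall x, 0 <= w x) ->
  spinor_measurable u -> spinor_measurable v ->
  (wip w u < +oo)%E -> (wip w v < +oo)%E -> (wip w (fun x => u x + v x)%R < +oo)%E.
Proof.
move=> mw w0 mu mv iu iv; apply: le_lt_trans (wip_leD mw w0 mu mv) _.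
by rewrite lte_mul_pinfty ?lee_fin // lte_add_pinfty.
Qed.

(** The mollification [h] depends on [f] and [c] but not on [lam]. Its derivatives are convolutions
    of [f] with differentiated kernels, hence finite for [gweight], and so [H_0 h] is too. *)
Lemma extended_resolvent_vanish (sg : bool) (t c : R) (T : R -> spinor R -> spinor R) f :
  (forall lam, 1 < `|lam| -> is_extended_resolvent alpha Q s sg t lam (T lam)) ->
  192 * Cc * (t ^+ 2 * K ^+ 2) <= 1 -> L2w s f -> 0 < c ->
  exists L : R, forall lam, L <= `|lam| -> (wnorm (- s) (T lam f) <= c%:E)%E.
Proof.
move=> ext ts sf c0.
have C0 := core_const_ge0.
have g0 x : 0 <= gweight theta x by apply: le_trans (gweight_ge1 theta_gt x).
have mg := measurable_gweight theta.
have fi : (wip (gweight theta) f < +oo)%E.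
  apply: le_lt_trans (wip_gweight_jweight sf.1) _; exact/wnorm_fin/sf.2.
have g1 := gweight_ge1 theta_gt.
have gK := gweight_shift theta_gt theta_le1.
have sqf := wip_sqint mg g1 sf.1 fi.
(* Makes the share [24 Cc a] of the approximation error at most [c^2 / 2]; the summand 1 keeps the
   denominator positive. *)
pose a := c ^+ 2 / (48 * (Cc + 1)).
have C1 : 0 < Cc + 1 by rewrite ltr_wpDl.
have a0 : 0 < a by rewrite divr_gt0 ?exprn_gt0 ?mulr_gt0.
have [n hn] := smoll_density mg g1 gK (gweight_local theta_gt theta_le1) sf.1 fi a0.
pose h := smoll n f; pose Hd j := sconv (tens (dtens j (mol n))) f.
have tm := mol_test (R := R) n.
have sh : sqint h by exact: sqint_sconv.
have tdm j := unit_test_dtens j tm.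
have sHd j : sqint (Hd j) by apply: sqint_sconv => //; exact: tdm.
have hHd j : molweak j h (Hd j) by exact: molweak_sconv.
have ha : (wip (gweight theta) (fun x => (f x - h x)%R) <= a%:E)%E.
  rewrite -wip_opp; apply: le_trans hn; rewrite le_eqVlt; apply/orP; left; apply/eqP.
  by congr wip; apply/funext => x; rewrite opprB.
have fconv phi : (forall i, unit_test (phi i)) -> (wip (gweight theta) (sconv (tens phi) f) < +oo)%E.
  move=> tp; have [A A0 [h1 h2]] := tens_kernel_bound tp.
  apply: le_lt_trans (wip_sconv_le mg g0 g1 gK tp A0 h1 h2 sqf) _.
  by rewrite lte_mul_pinfty // lee_fin !mulr_ge0 // ltW.
have ipA j u : wip (gweight theta) (fun x => dA alpha j (u x)) = wip (gweight theta) u.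
  by apply: eq_integral => x _; rewrite dA_iso.
have ipB u : wip (gweight theta) (fun x => dB alpha (u x)) = wip (gweight theta) u.
  by apply: eq_integral => x _; rewrite dB_iso.
have Hfin : (wip (gweight theta) (fun x => dirac_symbol alpha 0%R (h x) (Hd ^~ x)) < +oo)%E.
  rewrite (_ : (fun x => _) = (fun x => (dA alpha 0 (Hd 0 x) + dA alpha 1 (Hd 1 x) +
      dA alpha 2%:R (Hd 2%:R x)) + dB alpha (h x))); last first.
    by apply/funext => x; rewrite /dirac_symbol sum3 scale0r subr0.
  have mA j : spinor_measurable (fun x => dA alpha j (Hd j x)) := (sqint_dA alpha_dirac j (sHd j)).1.
  have fA j : (wip (gweight theta) (fun x => dA alpha j (Hd j x)) < +oo)%E by rewrite ipA; exact: fconv.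
  have mB : spinor_measurable (fun x => dB alpha (h x)) := (sqint_dB alpha_dirac sh).1.
  have fB : (wip (gweight theta) (fun x => dB alpha (h x)) < +oo)%E by rewrite ipB; exact: fconv.
  have m01 := spinor_measurableD (mA 0) (mA 1); have m012 := spinor_measurableD m01 (mA 2%:R).
  have f01 := wip_finD mg g0 (mA 0) (mA 1) (fA 0) (fA 1).
  have f012 := wip_finD mg g0 m01 (mA 2%:R) f01 (fA 2%:R).
  exact: (wip_finD mg g0 m012 mB f012 fB).
have lfin : (wip (lweight theta) h < +oo)%E.
  apply: le_lt_trans (fconv _ tm); apply: wip_mono => //.
  - exact: measurable_lweight.
  - move=> x; rewrite (ltW (lweight_gt0 theta x)) /=.
    exact: le_trans (lweight_le1 theta_gt x) (g1 x).
  - exact: sh.1.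
have l0 x : 0 <= lweight theta x by exact: ltW (lweight_gt0 theta x).
pose b1 := fine (wip (gweight theta) (fun x => dirac_symbol alpha 0%R (h x) (Hd ^~ x))).
pose b2 := fine (wip (lweight theta) h).
have b10 : 0 <= b1 by rewrite fine_ge0 // wip_ge0.
have b20 : 0 <= b2 by rewrite fine_ge0 // wip_ge0.
have hb : (wip (gweight theta) (fun x => dirac_symbol alpha 0%R (h x) (Hd ^~ x)) <= (b1 + b2)%:E)%E.
  apply: (@le_trans _ _ b1%:E); last by rewrite lee_fin lerDl.
  by rewrite /b1 fineK // ge0_fin_numE // wip_ge0.
have hb' : (wip (lweight theta) h <= (b1 + b2)%:E)%E.
  apply: (@le_trans _ _ b2%:E); last by rewrite lee_fin lerDr.
  by rewrite /b2 fineK // ge0_fin_numE // wip_ge0.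
pose b := b1 + b2; have b0 : 0 <= b by rewrite addr_ge0.
(* Once [lam^2 >= M], the terms [(24 Cc + 8) b / lam^2] are at most the other half of [c^2]. *)
pose M := 2 * (24 * Cc + 8) * b / c ^+ 2.
have c2 : 0 < c ^+ 2 by rewrite exprn_gt0.
have M0 : 0 <= M.
  by rewrite /M divr_ge0 ?(ltW c2) // mulr_ge0 // mulr_ge0 // addr_ge0 // mulr_ge0.
(* The summand 2 ensures [|lam| >= 2], and then [lam^2 >= |lam| >= M]. *)
exists (M + 2) => lam lamL.
have lam2 : 2 <= `|lam| by apply: le_trans lamL; rewrite lerDr.
have lam1 : 1 < `|lam| by apply: lt_le_trans lam2; rewrite ltr1n.
apply: wnorm_of_wip; first exact: ltW.
apply: le_trans (extended_resolvent_bound (ext lam lam1) sf lam2 ts sh sHd hHd ha hb hb') _.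
rewrite lee_fin -/b.
have lamsq : M <= lam ^+ 2.
  rewrite -(real_normK (num_real lam)) expr2.
  have h2 : 1 * M <= `|lam| * `|lam|.
    by apply: ler_pM => //; [exact: ltW|apply: le_trans lamL; rewrite lerDl].
  by rewrite mul1r in h2.
have l2 : 0 < lam ^+ 2.
  by rewrite -(real_normK (num_real lam)) exprn_gt0 //; apply: lt_trans lam1.
have e1 : (24 * Cc + 8) * (b / lam ^+ 2) <= c ^+ 2 / 2.
  rewrite mulrA ler_pdivrMr // [leRHS]mulrC.
  have := ler_wpM2r (ltW c2) lamsq; rewrite /M divfK ?gt_eqF // => h1.
  by rewrite [leRHS]mulrA ler_pdivlMr // [leLHS]mulrC mulrA.
have e2 : 24 * Cc * a <= c ^+ 2 / 2.
  rewrite /a mulrA ler_pdivrMr ?mulr_gt0 //.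
  rewrite (_ : c ^+ 2 / 2 * _ = 24 * (Cc + 1) * c ^+ 2); last by field.
  by rewrite ler_wpM2r ?(ltW c2) // ler_wpM2l // lerDl.
rewrite -[4 * b / _]mulrA; set X := b / lam ^+ 2 in e1 *.
rewrite (_ : 2 * _ = 24 * Cc * a + (24 * Cc + 8) * X); last by ring.
by apply: le_trans (lerD e2 e1) _; rewrite -splitr.
Qed.
End resolvent_norm.
End limiting_absorption.

Theorem theorem2p6 (R : realType) (alpha : 'I_4 -> 'M[R[i]]_4)
    (alpha_dirac : dirac_matrices alpha)
    (Q : R3 R -> 'M[R[i]]_4)
    (Q_herm : forall x, Q x \is hermsymmx)
    (Q_C1 : forall j k, cCk 1 (fun x => Q x j k))
    (Q_decay : exists epsilon K : R, [/\ 0 < epsilon, 0 < K &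
      forall x j k,
        japanese x `^ (1 + epsilon) * cmod (Q x j k)
        + \sum_(l < 3) cmod (cpartial l (fun y => Q y j k) x) <= K])
    (s : R) (s_gt : 2^-1 < s)
    (Rext : bool -> R -> R -> spinor R -> spinor R)
    (Rext_lap : forall (sg : bool) (t lambda : R), 1 < `|lambda| ->
      is_extended_resolvent alpha Q s sg t lambda (Rext sg t lambda)) :
  exists t0 C : R, [/\ 0 < t0, 0 < C &
    forall t : R, `|t| <= t0 -> forall sg : bool,
      (ereal_sup [set opnorm s (- s)%R (Rext sg t lambda)
                 | lambda in [set lambda : R | (2 <= `|lambda|)%R]] <= C%:E)%E
      /\
      forall f, L2w s f ->
        wnorm (- s) (Rext sg t lambda f) @[lambda --> +oo%R] --> 0%E /\
        wnorm (- s) (Rext sg t lambda f) @[lambda --> -oo%R] --> 0%E].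
Proof.
have [eps [K [eps0 K0 hQ]]] := Q_decay.
(* The bound by [s] is for comparing weights, the one by [r / 2] for absorbing the potential, the
   one by 1 for the multiplier field. The minimum exceeds 1/2 because [s > 1/2] and [eps > 0]. *)
pose r := 1 + eps; pose theta := Num.min s (Num.min (r / 2) 1).
have theta_gt : 2^-1 < theta by rewrite /theta /r !lt_min s_gt /=; apply/andP; split; lra.
have theta_le1 : theta <= 1 by rewrite /theta !ge_min lexx !orbT.
have theta_s : theta <= s by rewrite /theta ge_min lexx.
have r_ge : 2 * theta <= r.
  have : theta <= r / 2 by rewrite /theta !ge_min lexx orbT.
  lra.
have Q_le x j k : cmod (Q x j k) <= K * japanese x `^ (- r).
  have j0 : 0 < japanese x `^ r.
    by rewrite japaneseE powR_gt0 // wq_gt0.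
  rewrite powRN ler_pdivlMr // mulrC; apply: le_trans (hQ x j k).
  by rewrite lerDl; apply: sumr_ge0 => l _; exact: sqrtr_ge0.
pose Cc := core_const theta; have C0 : 0 <= Cc := core_const_ge0 theta_gt.
(* With [t0 = 1 / D] and [D >= 1], one has [t^2 <= |t| <= 1 / D], so the smallness condition on
   [t^2] holds without taking a square root. *)
pose D := 192 * Cc * K ^+ 2 + 1.
have P0 : 0 <= 192 * Cc * K ^+ 2.
  by apply: mulr_ge0; [apply: mulr_ge0 => //; exact: ler0n|exact: sqr_ge0].
have D1 : 1 <= D by rewrite /D lerDr.
have D0 : 0 < D by apply: lt_le_trans D1.
exists D^-1, (24 * Cc + 1); split; first by rewrite invr_gt0.
  by rewrite ltr_wpDl // mulr_ge0.
move=> t t_small sg.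
have ts : 192 * Cc * (t ^+ 2 * K ^+ 2) <= 1.
  have t2 : t ^+ 2 <= D^-1.
    rewrite -(real_normK (num_real t)) expr2 -[leRHS]mul1r; apply: ler_pM => //.
    by apply: le_trans t_small _; rewrite invf_le1.
  rewrite (_ : _ * _ = 192 * Cc * K ^+ 2 * t ^+ 2); last by ring.
  apply: le_trans (ler_wpM2l P0 t2) _.
  by rewrite ler_pdivrMr // mul1r /D lerDl.
split.
  apply: ge_ereal_sup => _ [lam /= lam2 <-].
  have lam1 : 1 < `|lam| by apply: lt_le_trans lam2; rewrite ltr1n.
  exact: (extended_resolvent_uniform alpha_dirac theta_gt theta_le1 theta_s Q_le r_ge
    (Rext_lap sg t lam lam1) lam2 ts).
move=> f sf.
have van (c : R) (c0 : 0 < c) := extended_resolvent_vanish alpha_dirac theta_gt theta_le1 theta_s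
  Q_le r_ge (fun lam => Rext_lap sg t lam) ts sf c0.
split; apply: (cvg_ereal0P _ (fun lam => wnorm_ge0 _ _)).2 => c /van[L hL].
  by near=> lam; apply: hL; apply: le_trans (ler_norm _); near: lam; apply: nbhs_pinfty_ge; exact: num_real.
near=> lam; apply: hL; rewrite -normrN; apply: le_trans (ler_norm _); rewrite lerNr.
by near: lam; apply: nbhs_ninfty_le; exact: num_real.
Unshelve. all: by end_near. Qed.
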